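(* Consider the RAT chain on $\Psi_{(n,r)}$, the set of equivalence classes of rhombic alternative tableaux whose type is a word of length $n$ in $\{d,a,e\}$ with exactly $r$ letters $a$. Let $F$ be a rhombic alternative tableau and let $\psi\in\Psi_{(n,r)}$ be its equivalence class. Then the steady state probability of the state $\psi$ is proportional to $\mathrm{wt}(F)$.
   Context: **Rhombic diagrams and tilings.** Let $W$ be a word in $\{d,a,e\}$ with $k$ $d$'s, $\ell$ $e$'s, $r$ $a$'s. A $d$-edge, $e$-edge, $a$-edge is a unit edge pointing south, west, southwest respectively. $P_1(W)$ is the path obtained by reading $W$ from left to right and drawing the corresponding edges; $P_2(W)$ is the path from the same (northeast) starting point consisting of $\ell$ west edges, then $r$ southwest edges, then $k$ south edges. $\Gamma(W)$ is the region enclosed between $P_1(W)$ (southeast boundary) and $P_2(W)$ (northwest boundary). A tiling of $\Gamma(W)$ is a tiling by $de$, $da$, $ae$ tiles, where a $BC$ tile is a parallelogram with $B$- and $C$-edges. An $e$-strip ($d$-strip) is a maximal strip of tiles consecutively adjacent along $e$-edges ($d$-edges); each $e$-edge ($d$-edge) of $P_1(W)$ starts one $e$-strip ($d$-strip), running upward (leftward) to $P_2(W)$, possibly with no tiles, in which case it is called empty (an empty $e$-strip is an $e$-edge of $P_1$ lying on the top boundary $P_2$; an empty $d$-strip is a $d$-edge of $P_1$ lying on the left boundary $P_2$). The length of a strip is its number of tiles. **RAT.** A rhombic alternative tableau (RAT) $F$ of type $W$ with tiling $\mathcal T$ (written $F\in\mathrm{fil}(W,\mathcal T)$) is a filling of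 the tiles such that: a $de$ tile is empty or contains $\alpha$ or $\beta$; a $da$ tile is empty or contains $\beta$; an $ae$ tile is empty or contains $\alpha$; every tile above an $\alpha$ in the same $e$-strip is empty and every tile left of a $\beta$ in the same $d$-strip is empty. A $q$ is then placed in each empty tile having neither an $\alpha$ below it in its $e$-strip nor a $\beta$ to its right in its $d$-strip, and $\mathrm{wt}(F)$ is the product of all symbols in $F$ times $\alpha^k\beta^\ell$. **Flips and equivalence.** Three tiles $de,da,ae$ forming a hexagon can be arranged in two ways: as a maximal hexagon (in the $e$-strip through it, from bottom to top, $de$ then $ae$) or as a minimal hexagon (in the $e$-strip through it, from bottom to top, $ae$ then $de$). A weight-preserving flip of a RAT replaces one arrangement by the other, keeps all other tiles and symbols, and fills the three new tiles in the unique way such that the result is a RAT of the same weight (as a monomial in $\alpha,\beta,q$) and the hexagon contains an $\alpha$ (resp. a $\beta$) after the flip if and only if it did before. Two RAT of the same type are equivalent if one is obtained from the other by a sequence of weight-preserving flips. $\Psi_{(n,r)}$ is the set of equivalence classes of RAT whose types have length $n$ and exactly $r$ $a$'s. Equivalent RAT have the same weight. **Compressing and blowing up.** A $d$-path in a tiling is a path along edges of the tiling from a point of $P_1$ to a point of $P_2$ consisting of $a$- and $e$-edges; an $e$-path is one consisting of $d$- and $a$-edges. Compressing a $d$-strip means deleting its tiles and gluing the north and south $e$- and $a$-edges of each of its tiles, so that the strip is replaced by a $d$-path; compressing an $e$-strip means gluing the west and east $d$- and $a$-edges of its tiles, so that it is replaced by an $e$-path. Inversely, blowing up a $d$-path replaces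 each of its $e$-edges by a $de$ tile and each of its $a$-edges by a $da$ tile, producing a $d$-strip; blowing up an $e$-path replaces each of its $d$-edges by a $de$ tile and each of its $a$-edges by an $ae$ tile, producing an $e$-strip. Compressing an empty strip deletes its edge; blowing up a path of length $0$ inserts an empty strip. Symbols in all other tiles are kept. Two operations: *inserting a $\beta$-strip of length $m$* means: let $p$ be the southernmost point of $P_1$ such that exactly $m$ $e$- and $a$-edges of $P_1$ lie southwest of (after) $p$, blow up any $d$-path starting at $p$, and, if $m>0$, place $\beta$ in the right-most tile of the new $d$-strip (other tiles of the strip empty). *Inserting an $\alpha$-strip of length $m$* means: let $p$ be the easternmost point of $P_1$ such that exactly $m$ $d$- and $a$-edges of $P_1$ lie northeast of (before) $p$, blow up any $e$-path starting at $p$, and, if $m>0$, place $\alpha$ in the bottom-most tile of the new $e$-strip (other tiles of the strip empty). **The RAT chain.** Fix $0\le q\le 1$ and $\alpha,\beta>0$ with all outgoing probabilities below summing to at most $1$. If $W$ has consecutive letters $de$, $da$ or $ae$ (a corner), every class of type $W$ contains a RAT with a tile of that kind at that corner; use such a representative for transitions at that corner. From the class of a RAT $F$ of type $W$, with $k$ the number of $d$'s in $W$, the chain moves to the class of the RAT $T$ described below with the indicated probability (and stays put with the remaining probability): 1. If $W=eX$: compress the empty $e$-strip of the first letter and insert a $\beta$-strip of length $n-k-1$; $T$ has type $dX$; probability $\alpha/(n+1)$. 2. If $W=Xd$: compress the empty $d$-strip of the last letter and insert an $\alpha$-strip of length $r+k-1$; $T$ has type $Xe$; probability $\beta/(n+1)$.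 3. For each corner $BC\in\{de,da,ae\}$, $W=XBCY$, with probability $1/(n+1)$ to $T$ of type $XCBY$: (i) if the corner tile contains $\beta$ (then $B=d$), compress the $d$-strip containing it, of length $\lambda$, and insert a $\beta$-strip of length $\lambda-1$; (ii) if the corner tile contains $\alpha$ (then $C=e$), compress the $e$-strip containing it, of length $\lambda$, and insert an $\alpha$-strip of length $\lambda-1$; (iii) if the corner tile contains $q$, remove that tile. 4. For each inner corner $CB\in\{ed,ad,ea\}$, $W=XCBY$: append a $BC$ tile containing $q$ to the outside of $F$ at that inner corner; $T$ has type $XBCY$; probability $q/(n+1)$. *)

(* Defs.v *)
From HB Require Import structures.
From mathcomp Require Import all_boot all_order all_algebra.

Set Implicit Arguments.
Unset Strict Implicit.
Unset Printing Implicit Defensive.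

Import Order.TTheory GRing.Theory Num.Theory.

Inductive letter := Ld | La | Le.

Definition letter_code (l : letter) : option bool :=
  match l with Ld => Some true | La => None | Le => Some false end.
Definition letter_decode (o : option bool) : letter :=
  match o with Some true => Ld | None => La | Some false => Le end.
Lemma letter_codeK : cancel letter_code letter_decode.
Proof. by case. Qed.
HB.instance Definition _ := Finite.copy letter (can_type letter_codeK).

Inductive kind := DE | DA | AE.

Definition kind_code (K : kind) : option bool :=
  match K with DE => Some true | DA => None | AE => Some false end.
Definition kind_decode (o : option bool) : kind :=
  match o with Some true => DE | None => DA | Some false => AE end.
Lemma kind_codeK : cancel kind_code kind_decode.
Proof. by case. Qed.
HB.instance Definition _ := Finite.copy kind (can_type kind_codeK).

(* [Cempty] means "neither alpha nor beta": the q's are determined by the rest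
   of the filling, see [has_q]. *)
Inductive content := Cempty | Calpha | Cbeta.

Definition content_code (c : content) : option bool :=
  match c with Calpha => Some true | Cempty => None | Cbeta => Some false end.
Definition content_decode (o : option bool) : content :=
  match o with Some true => Calpha | None => Cempty | Some false => Cbeta end.
Lemma content_codeK : cancel content_code content_decode.
Proof. by case. Qed.
HB.instance Definition _ := Finite.copy content (can_type content_codeK).

(* A BC tile is [K] with [kindB K = B] and [kindC K = C]. *)
Definition kindB (K : kind) : letter :=
  match K with DE => Ld | DA => Ld | AE => La end.
Definition kindC (K : kind) : letter :=
  match K with DE => Le | DA => La | AE => Le end.
Definition kind_of (B C : letter) : option kind :=
  match B, C with
  | Ld, Le => Some DE | Ld, La => Some DA | La, Le => Some AE | _, _ => None
  end.

(* A point reached from the northeast starting point by v Ld south, v La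
   southwest and v Le west unit steps, in any order.  South, west and southwest
   unit vectors are linearly independent over the rationals, so distinct v are
   distinct points of the plane. *)
Definition vertex := {ffun letter -> nat}.
Definition step (v : vertex) (l : letter) : vertex := [ffun m => v m + (m == l)].
Definition vertex_of (X : seq letter) : vertex := [ffun l => count_mem l X].

(* (v, l) is the unit l-edge going from v to step v l *)
Definition edge := (vertex * letter)%type.

Fixpoint path_edges (v : vertex) (W : seq letter) : seq edge :=
  if W is l :: W' then (v, l) :: path_edges (step v l) W' else [::].

Definition P1 (W : seq letter) : seq edge := path_edges (vertex_of [::]) W.
Definition P2 (W : seq letter) : seq edge :=
  path_edges (vertex_of [::])
    (nseq (count_mem Le W) Le ++ nseq (count_mem La W) La
     ++ nseq (count_mem Ld W) Ld).

(* A tile is given by its kind and its northeast-most vertex, from which its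
   two sides (B then C on the southeast, C then B on the northwest) start.  In
   a diagram of a word of length n that vertex has all coordinates < n. *)
Definition tile (n : nat) := (kind * {ffun letter -> 'I_n})%type.

Section Tiles.
Variable n : nat.
Implicit Types t s : tile n.

Definition anchor t : vertex := [ffun l => val (t.2 l)].
Definition loc t : kind * vertex := (t.1, anchor t).
Definition has_edge (l : letter) t : bool := (l == kindB t.1) || (l == kindC t.1).

(* The l-edge of t on its southeast, resp. northwest, side (if has_edge l t) *)
Definition se_edge (l : letter) t : edge :=
  (if l == kindB t.1 then anchor t else step (anchor t) (kindB t.1), l).
Definition nw_edge (l : letter) t : edge :=
  (if l == kindC t.1 then anchor t else step (anchor t) (kindC t.1), l).

Definition se_edges t : seq edge := [:: se_edge (kindB t.1) t; se_edge (kindC t.1) t].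
Definition nw_edges t : seq edge := [:: nw_edge (kindC t.1) t; nw_edge (kindB t.1) t].

(* T is a tiling of the region between P1 W and P2 W: the tiles fit together
   edge to edge.  Every unit edge that lies on P1 or is the northwest side of a
   tile is matched with one that lies on P2 or is the southeast side of a tile,
   counted with multiplicity.  All tiles having the same orientation, this says
   that the boundaries of the tiles add up to the boundary P1 - P2 of the
   region; comparing winding numbers, the tiles cover every generic point of
   the region exactly once and no generic point outside it. *)
Definition is_tiling (W : seq letter) (T : {set tile n}) : bool :=
  perm_eq (P1 W ++ flatten [seq nw_edges t | t <- enum T])
          (P2 W ++ flatten [seq se_edges t | t <- enum T]).

Definition placed := (tile n * content)%type.
Definition filling := {set placed}.

Implicit Types F G : filling.

(* s is the next tile after t in the l-strip of t, going away from P1: upward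
   for l = Le, leftward for l = Ld *)
Definition next_in_strip (l : letter) F t s : bool :=
  [&& t \in [set p.1 | p in F], s \in [set p.1 | p in F],
      has_edge l t, has_edge l s & nw_edge l t == se_edge l s].

Definition further (l : letter) F t s : bool :=
  (t != s) && connect (next_in_strip l F) t s.

(* s is above t in the same e-strip, s is left of t in the same d-strip *)
Definition above F s t : bool := further Le F t s.
Definition left_of F s t : bool := further Ld F t s.

(* Tiles adjacent along an l-edge have the same l-coordinate, and P1 has
   exactly one l-edge with l-coordinate i, namely its (i+1)-st one: the tiles
   below are those of the strip which starts at this edge. *)
Definition in_strip (l : letter) (i : nat) t : bool :=
  has_edge l t && (t.2 l == i :> nat).

Definition strip_length (l : letter) (i : nat) F : nat :=
  #|[set p in F | in_strip l i p.1]|.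

Definition allowed (K : kind) (c : content) : bool :=
  match K, c with DA, Calpha => false | AE, Cbeta => false | _, _ => true end.

Definition is_filling F : bool :=
  [&& [forall p in F, forall s in F, (p.1 == s.1) ==> (p == s)],
      [forall p in F, allowed p.1.1 p.2],
      [forall p in F, forall s in F,
         (p.2 == Calpha) && above F s.1 p.1 ==> (s.2 == Cempty)]
    & [forall p in F, forall s in F,
         (p.2 == Cbeta) && left_of F s.1 p.1 ==> (s.2 == Cempty)]].

Definition has_q F (p : placed) : bool :=
  [&& p \in F, p.2 == Cempty,
      ~~ [exists s in F, (s.2 == Calpha) && above F p.1 s.1]
    & ~~ [exists s in F, (s.2 == Cbeta) && left_of F p.1 s.1]].

Definition nb_alpha F : nat := #|[set p in F | p.2 == Calpha]|.
Definition nb_beta F : nat := #|[set p in F | p.2 == Cbeta]|.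
Definition nb_q F : nat := #|[set p in F | has_q F p]|.

(* Removing the strip which starts at the (i+1)-st l-edge of P1 glues its two
   sides: everything on its far side from the starting point of P1, i.e. with
   l-coordinate > i, is translated back by one l-edge. *)
Lemma ord_dec_subproof (i : 'I_n) : (i.-1 < n)%N.
Proof. exact: leq_ltn_trans (leq_pred i) (ltn_ord i). Qed.
Definition ord_dec (i : 'I_n) : 'I_n := Ordinal (ord_dec_subproof i).

Definition shift (l : letter) (i : nat) t : tile n :=
  (t.1, [ffun m => if (m == l) && (i < t.2 m)%N then ord_dec (t.2 m) else t.2 m]).

Definition compress (l : letter) (i : nat) F : filling :=
  [set (shift l i p.1, p.2) | p in F & ~~ in_strip l i p.1].

(* The filling T of type WT is obtained from the filling G of type W by
   inserting a beta-strip of length m.  Here W = U ++ V, where U leads to the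
   point p, and blowing up is expressed as the inverse of compressing: T has a
   d-strip, starting at p, whose compression gives back G. *)
Definition insert_beta (m : nat) (W : seq letter) G (WT : seq letter) (T : filling) : bool :=
  [exists k : 'I_(size W).+1,
    let U := take k W in
    let V := drop k W in
    let i := count_mem Ld U in
    [&& count (predC1 Ld) V == m, ohead V != Some Ld,
        WT == U ++ Ld :: V, compress Ld i T == G
      & [forall p in T, in_strip Ld i p.1 ==>
           (p.2 == if [exists s in T, left_of T p.1 s.1] then Cempty else Cbeta)]]].

Definition insert_alpha (m : nat) (W : seq letter) G (WT : seq letter) (T : filling) : bool :=
  [exists k : 'I_(size W).+1,
    let U := take k W in
    let V := drop k W in
    let i := count_mem Le U in
    [&& count (predC1 Le) U == m, ohead (rev U) != Some Le,
        WT == U ++ Le :: V, compress Le i T == G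
      & [forall p in T, in_strip Le i p.1 ==>
           (p.2 == if [exists s in T, above T p.1 s.1] then Cempty else Calpha)]]].

End Tiles.

Definition is_RAT (n r : nat) (F : n.-tuple letter * filling n) : bool :=
  [&& count_mem La F.1 == r, is_tiling F.1 [set p.1 | p in F.2] & is_filling F.2].

Definition RAT (n r : nat) := {F : n.-tuple letter * filling n | is_RAT r F}.
HB.instance Definition _ (n r : nat) := Finite.copy (RAT n r)
  {F : n.-tuple letter * filling n | is_RAT r F}.

Section RATs.
Variables n r : nat.
Implicit Types F G T : RAT n r.

Definition word F : n.-tuple letter := (val F).1.
Definition fil F : filling n := (val F).2.

(* The hexagon with northeast-most vertex v *)
Definition max_hexagon (v : vertex) : seq (kind * vertex) :=
  [:: (DA, v); (DE, step v La); (AE, v)].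
Definition min_hexagon (v : vertex) : seq (kind * vertex) :=
  [:: (AE, step v Ld); (DE, v); (DA, step v Le)].

Definition tiles_at (H : seq (kind * vertex)) F : filling n :=
  [set p in fil F | loc p.1 \in H].
Definition contains_tiles (H : seq (kind * vertex)) F : bool :=
  all (fun x => [exists p in fil F, loc p.1 == x]) H.

(* F and G have the same type, so their weights agree iff they have the same
   numbers of alphas, betas and q's. *)
Definition flip_max_min (v : vertex) F G : bool :=
  let H := tiles_at (max_hexagon v) F in
  let K := tiles_at (min_hexagon v) G in
  [&& word F == word G,
      contains_tiles (max_hexagon v) F, contains_tiles (min_hexagon v) G,
      fil F :\: H == fil G :\: K,
      nb_alpha (fil F) == nb_alpha (fil G), nb_beta (fil F) == nb_beta (fil G),
      nb_q (fil F) == nb_q (fil G),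
      [exists p in H, p.2 == Calpha] == [exists p in K, p.2 == Calpha]
    & [exists p in H, p.2 == Cbeta] == [exists p in K, p.2 == Cbeta]].

Definition flip F G : bool :=
  [exists t : tile n, flip_max_min (anchor t) F G || flip_max_min (anchor t) G F].

Definition equivalent F G : bool := connect flip F G.

Definition Psi := {c : {set RAT n r} | [exists F, c == [set G | equivalent F G]]}.
HB.instance Definition _ := Finite.copy Psi
  {c : {set RAT n r} | [exists F, c == [set G | equivalent F G]]}.

Lemma class_subproof F : [exists F', [set G | equivalent F G] == [set G | equivalent F' G]].
Proof. by apply/existsP; exists F. Qed.
Definition class F : Psi := exist _ [set G | equivalent F G] (class_subproof F).

Definition repr (psi : Psi) : RAT n r := xchoose (existsP (valP psi)).

(* The common type of the members of psi *)
Definition type_of (psi : Psi) : n.-tuple letter := word (repr psi).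

(* The corner B C is between X and Y in the type of F *)
Definition corner_move (X : seq letter) (B C : letter) (Y : seq letter) (K : kind)
    F T : bool :=
  let v := vertex_of X in
  (X ++ C :: B :: Y == word T) &&
  [exists p in fil F, (loc p.1 == (K, v)) &&
    match p.2 with
    | Cbeta =>
        insert_beta (strip_length Ld (v Ld) (fil F)).-1
          (X ++ C :: Y) (compress Ld (v Ld) (fil F)) (word T) (fil T)
    | Calpha =>
        insert_alpha (strip_length Le (v Le) (fil F)).-1
          (X ++ B :: Y) (compress Le (v Le) (fil F)) (word T) (fil T)
    | Cempty => has_q (fil F) p && (fil T == fil F :\ p)
    end].

(* The inner corner C B is between X and Y in the type of F, K is the kind BC *)
Definition inner_corner_move (X : seq letter) (C B : letter) (Y : seq letter) (K : kind)
    F T : bool :=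
  (X ++ B :: C :: Y == word T) &&
  [exists t : tile n,
    [&& loc t == (K, vertex_of X), fil T == (t, Cempty) |: fil F
      & has_q (fil T) (t, Cempty)]].

(* The transitions are indexed by the n + 1 positions i = 0, ..., n in a word of
   length n, i being the number of letters on the left of the position.  [move i
   F T]: the transition rule at position i can send F to T.  The first element
   of the match is the part of the word before the position, reversed. *)
Definition move (i : 'I_n.+1) F T : bool :=
  let k := count_mem Ld (word F) in
  match rev (take i (word F)), drop i (word F) with
  | [::], Le :: X =>
      (Ld :: X == word T) &&
      insert_beta (n - k - 1) X (compress Le 0 (fil F)) (word T) (fil T)
  | Ld :: X', [::] =>
      let X := rev X' in
      (rcons X Le == word T) &&
      insert_alpha (r + k - 1) X (compress Ld (k - 1) (fil F)) (word T) (fil T)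
  | B :: X', C :: Y =>
      match kind_of B C, kind_of C B with
      | Some K, _ => corner_move (rev X') B C Y K F T
      | None, Some K => inner_corner_move (rev X') B C Y K F T
      | None, None => false
      end
  | _, _ => false
  end.

(* Any admissible representative F of psi and any result T may be used. *)
Definition class_move (i : 'I_n.+1) (psi phi : Psi) : bool :=
  [exists F in val psi, exists T in val phi, move i F T].

Section Chain.
Variables (R : realFieldType) (alpha beta q : R).
Local Open Scope ring_scope.

Definition wt F : R :=
  alpha ^+ nb_alpha (fil F) * beta ^+ nb_beta (fil F) * q ^+ nb_q (fil F)
  * (alpha ^+ count_mem Ld (word F) * beta ^+ count_mem Le (word F)).

(* The probability of the transition at position i of the word W *)
Definition prob (W : seq letter) (i : nat) : R :=
  match ohead (rev (take i W)), ohead (drop i W) with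
  | None, Some Le => alpha / n.+1%:R
  | Some Ld, None => beta / n.+1%:R
  | Some B, Some C =>
      if kind_of B C then 1 / n.+1%:R
      else if kind_of C B then q / n.+1%:R
      else 0
  | _, _ => 0
  end.

Definition out_prob (psi : Psi) : R := \sum_(i < n.+1) prob (type_of psi) i.

Definition RAT_chain (psi phi : Psi) : R :=
  \sum_(i < n.+1 | class_move i psi phi) prob (type_of psi) i
  + (if psi == phi then 1 - out_prob psi else 0).

End Chain.

End RATs.

Section FiniteMarkovChains.
Variables (R : realFieldType) (S : finType).
Local Open Scope ring_scope.

Definition is_transition_matrix (P : S -> S -> R) : Prop :=
  (forall x y, 0 <= P x y) /\ (forall x, \sum_y P x y = 1).

Definition steady_state (P : S -> S -> R) (pi : {ffun S -> R}) : Prop :=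
  [/\ forall x, 0 <= pi x, \sum_x pi x = 1
    & forall y, \sum_x pi x * P x y = pi y].

End FiniteMarkovChains.

(* Main.v *)
Require Import Defs.
From mathcomp Require Import all_boot all_order all_algebra.
From mathcomp Require Import zify ring.

Set Implicit Arguments.
Unset Strict Implicit.
Unset Printing Implicit Defensive.

Import Order.TTheory GRing.Theory Num.Theory.

(** The tableaux of a word are generated by sweeping their diagrams.  Start from
    the southeast boundary; as long as the path has a corner, place a tile there,
    which exchanges two consecutive letters of the path; when no corner is left, the
    path is the northwest boundary.  Each letter of the path is a strand, which
    follows a strip, and a strand is alive until the symbol of its strip is placed.
    A crossing of two live strands is labelled by the content of the tile, an
    empty tile then being one with a q, and a crossing with a dead strand has no
    label.  The list of the crossings is a history of the tableau.  It is determined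
    by the tableau up to commutations of independent crossings, and a
    weight-preserving flip exchanges the two ways in which three strands d, a, e
    can cross pairwise.  Hence a class of tableaux is a word together with a class
    of histories ([equivalentP]), for the equivalence [heq] generated by
    commutations and by the twelve moves of [braid_table].

    Histories have two properties known from Garside monoids.  A history can be
    started at any corner of the path, up to equivalence ([pull_corner]), and
    crossings at the front can be cancelled ([heq_cancel]).  Both follow by pulling
    corners through histories, and because the letters have only three ranks no
    configuration of more than three strands has to be examined.

    In this language, compressing a strip which carries its symbol in the first tile
    is deleting a strand which dies at its first crossing.  Such a strand can be
    inserted in every history ([exists_inert]), and the class of the result is
    determined by the class of what it is inserted in ([heq_del_inert]).  So the
    transitions of the chain become transparent.  A transition which moves a strip
    is determined by the tableau without this strip, by the letter and by the length
    of the strip; it replaces the strip by the next one in the cyclic order in which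
    the d-strips by decreasing lengths are followed by the e-strips by decreasing
    lengths.  The other transitions remove or append a tile with a q at a corner.
    It follows that the pairs of a class and a position at which a transition is
    possible are permuted ([transition_perm]), where the position of the result is
    that of the inserted strip or of the modified corner.  The probability flow,
    weight times probability of the transition, is preserved by this permutation.
    For a removed or an appended tile the factor q occurs in the weight on one side
    and in the probability on the other side ([qlink_flow]).  For a moved strip, the
    flow is alpha beta / (n + 1) times the weight of the tableau without the strip,
    for all strips of the cycle ([inserted_flow]): a nonempty strip contributes alpha beta
    to the weight, by its letter and its symbol, and for an empty strip the factor
    which is missing is in the probability.  Summing over all the positions, the
    flow into a class equals the flow out of it, so the weights are invariant.

    The invariant distribution is unique since one class is reached from all
    others: corner transitions sort the letters of the word, the last d can be
    turned into an e, and the sorted word without d has a single tableau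
    ([measure_decreases], [steady_state_unique]). *)

(** * Strands and histories *)

(** A letter of the path which sweeps the diagram, together with the state of
    its strip: a d-strand dies when a beta is put into its strip and an
    e-strand when an alpha is, after which the tiles of the strip are empty
    and carry no q. *)
Inductive strand := LiveD | DeadD | LiveA | LiveE | DeadE.

Definition letter_of (x : strand) : letter :=
  match x with LiveD | DeadD => Ld | LiveA => La | LiveE | DeadE => Le end.
Definition live (l : letter) : strand :=
  match l with Ld => LiveD | La => LiveA | Le => LiveE end.
Definition kill (x : strand) : strand :=
  match x with LiveD => DeadD | LiveE => DeadE | y => y end.
Definition dead (x : strand) : bool :=
  match x with DeadD | DeadE => true | _ => false end.
(** The order of the letters along the northwest boundary, so that a corner is
    a descent. *)
Definition lrank (l : letter) : nat :=
  match l with Le => 0 | La => 1 | Ld => 2 end.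
Definition rank (x : strand) : nat := lrank (letter_of x).

(** The label of a crossing: [None] when one of the two strands is dead, so that
    the tile is empty without carrying a q; [Some Cempty] is a q. *)
Definition label := option content.
(** A crossing is the position of its corner in the current path and its
    label. *)
Definition history := seq (nat * label).

(** A tile is placed at a corner of the path: its southeast sides x, y are
    replaced by its northwest sides. Exactly the labels allowed by the rules
    of a tableau are accepted. *)
Definition cross (x y : strand) (c : label) : option (strand * strand) :=
  match x, y, c with
  | LiveD, LiveE, Some Cempty => Some (LiveE, LiveD)
  | LiveD, LiveE, Some Calpha => Some (DeadE, LiveD)
  | LiveD, LiveE, Some Cbeta => Some (LiveE, DeadD)
  | LiveD, LiveA, Some Cempty => Some (LiveA, LiveD)
  | LiveD, LiveA, Some Cbeta => Some (LiveA, DeadD)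
  | LiveA, LiveE, Some Cempty => Some (LiveE, LiveA)
  | LiveA, LiveE, Some Calpha => Some (DeadE, LiveA)
  | LiveD, DeadE, None => Some (DeadE, LiveD)
  | LiveA, DeadE, None => Some (DeadE, LiveA)
  | DeadD, LiveE, None => Some (LiveE, DeadD)
  | DeadD, DeadE, None => Some (DeadE, DeadD)
  | DeadD, LiveA, None => Some (LiveA, DeadD)
  | _, _, _ => None
  end.

Fixpoint sweep (w : seq strand) (p : nat) (c : label) {struct p} : option (seq strand) :=
  match p, w with
  | 0, x :: y :: w' => omap (fun s => s.1 :: s.2 :: w') (cross x y c)
  | p'.+1, x :: w' => omap (cons x) (sweep w' p' c)
  | _, _ => None
  end.

Arguments sweep w p c : simpl nomatch.

Fixpoint run (w : seq strand) (H : history) : option (seq strand) :=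
  if H is (p, c) :: K then obind (run^~ K) (sweep w p c) else Some w.

Definition rank_at (w : seq strand) (k : nat) : nat := rank (nth LiveA w k).
Definition corner (p : nat) (w : seq strand) : bool :=
  (p.+1 < size w) && (rank_at w p.+1 < rank_at w p).
(** The path has reached the northwest boundary. *)
Definition final (w : seq strand) : Prop := forall p, corner p w = false.

(** The two ways of tiling a hexagon, listed by the labels of their crossings
    in the order in which the path sweeps them: da, de, ae on the left, ae, de,
    da on the right.  These are the pairs of fillings of a hexagon which have
    the same symbols and leave the same strands alive. *)
Definition braid_table : seq ((label * label * label) * (label * label * label)) :=
  let q := Some Cempty in let a := Some Calpha in let b := Some Cbeta in
  [:: ((b, None, q), (q, b, None)); ((b, None, a), (a, None, b));
      ((q, a, None), (a, None, q)); ((q, b, q), (q, q, b));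
      ((q, b, a), (q, a, b)); ((q, q, q), (q, q, q)); ((q, q, a), (q, a, q));
      ((q, None, None), (None, None, q)); ((b, None, None), (None, None, b));
      ((None, None, q), (q, None, None)); ((None, None, a), (a, None, None));
      ((None, None, None), (None, None, None))].

(** Equivalence of histories: independent crossings commute, and a hexagon may
    be swept in its other tiling. These moves do not mention the initial path,
    which makes inductions on them uniform. *)
Inductive heq : history -> history -> Prop :=
| heq_refl H : heq H H
| heq_sym H H' : heq H H' -> heq H' H
| heq_trans H H' H'' : heq H H' -> heq H' H'' -> heq H H''
| heq_cons x H H' : heq H H' -> heq (x :: H) (x :: H')
| heq_swap p c p' c' K : p.+1 < p' ->
    heq ((p, c) :: (p', c') :: K) ((p', c') :: (p, c) :: K)
| heq_braid p c1 c2 c3 c1' c2' c3' K :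
    ((c1, c2, c3), (c1', c2', c3')) \in braid_table ->
    heq [:: (p, c1), (p.+1, c2), (p, c3) & K]
        [:: (p.+1, c1'), (p, c2'), (p.+1, c3') & K].

Lemma rank_le x : rank x <= 2. Proof. by case: x. Qed.

Lemma cross_rank x y c s : cross x y c = Some s ->
  [/\ rank y < rank x, letter_of s.1 = letter_of y & letter_of s.2 = letter_of x].
Proof. by case: x; case: y; case: c => [[]|] //= [<-]. Qed.

(** Every corner can be crossed: with no label if one of the strands is dead,
    with a q otherwise. *)
Lemma cross_total x y : rank y < rank x -> exists c s, cross x y c = Some s.
Proof.
by case: x; case: y => //= _; 
  first [by exists None; eexists | by exists (Some Cempty); eexists].
Qed.

Lemma sweep_catl X w p c : sweep (X ++ w) (size X + p) c = omap (cat X) (sweep w p c).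
Proof.
elim: X => [|x X IH] /=; first by case: sweep.
by rewrite IH; case: sweep.
Qed.

Lemma sweep_catr u Y p c : p.+1 < size u ->
  sweep (u ++ Y) p c = omap (cat^~ Y) (sweep u p c).
Proof.
elim: p u => [|p IH] [|x [|y u]] //= hs; first by case: cross.
by have /= -> := IH (y :: u) hs; case: sweep.
Qed.

Lemma sweep_oversize w p c : size w <= p.+1 -> sweep w p c = None.
Proof.
elim: p w => [|p IH] [|x w] //=; first by case: w.
by move=> hs; rewrite IH.
Qed.

Lemma sweepP w p c w' : sweep w p c = Some w' ->
  exists X x y Y x' y', [/\ w = X ++ x :: y :: Y, size X = p,
    cross x y c = Some (y', x') & w' = X ++ y' :: x' :: Y].
Proof.
elim: p w w' => [|p IH] [|x w] //= w'.
  case: w => //= y w; case E: cross => [[y' x']|] //= [<-].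
  by exists [::], x, y, w, x', y'.
case E: sweep => [v|] //= [<-].
have [X [x0 [y0 [Y [x' [y' [e1 e2 e3 ->]]]]]]] := IH _ _ E.
by exists (x :: X), x0, y0, Y, x', y'; rewrite e1 /= e2.
Qed.

Lemma sweep_cat X x y Y c :
  sweep (X ++ x :: y :: Y) (size X) c =
  omap (fun s => X ++ s.1 :: s.2 :: Y) (cross x y c).
Proof. by rewrite -{1}[size X]addn0 sweep_catl /=; case: cross. Qed.

(** Only the ranks of the strands matter for the position of the corners, and a
    sweep exchanges two of them. *)
Lemma sweep_rk w p c w' : sweep w p c = Some w' ->
  [/\ size w' = size w, corner p w
    & forall k, rank_at w' k = if k == p then rank_at w p.+1
                          else if k == p.+1 then rank_at w p else rank_at w k].
Proof.
move=> /sweepP [X [x [y [Y [x' [y' [-> sX hc ->]]]]]]].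
have [/= lt ly lx] := cross_rank hc.
have eX k : nth LiveA (X ++ k) p = nth LiveA k 0 by rewrite nth_cat sX ltnn subnn.
have eXS k : nth LiveA (X ++ k) p.+1 = nth LiveA k 1.
  by rewrite nth_cat sX ltnNge leqnSn /= subSnn.
split; first by rewrite !size_cat.
- by rewrite /corner /rank_at eX eXS /= lt andbT size_cat sX /=; lia.
- move=> k; rewrite /rank_at; case: eqP => [->|/eqP k1].
    by rewrite eX eXS /= /rank ly.
  case: eqP => [->|/eqP k2]; first by rewrite eX eXS /= /rank lx.
  rewrite !nth_cat sX; case: ltnP => // hk.
  by have -> : k - p = (k - p - 2).+2 by lia.
Qed.

Lemma corner_split p w : corner p w ->
  exists X x y Y, [/\ w = X ++ x :: y :: Y, size X = p & rank y < rank x].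
Proof.
move=> /andP[hs hr]; exists (take p w), (nth LiveA w p), (nth LiveA w p.+1), (drop p.+2 w).
rewrite -!drop_nth ?cat_take_drop ?size_takel //; lia.
Qed.

Lemma corner_cat X x y Y : corner (size X) (X ++ x :: y :: Y) = (rank y < rank x).
Proof.
have h : ((size X).+1 < size X) = false by lia.
by rewrite /corner /rank_at !nth_cat ltnn subnn h subSnn size_cat /= !addnS !ltnS leq_addr.
Qed.

Lemma corner_sweep p w : corner p w -> exists c w', sweep w p c = Some w'.
Proof.
case/corner_split=> X [x [y [Y [-> <- lt]]]].
by have [c [s e]] := cross_total lt; exists c; rewrite sweep_cat e /=; eexists.
Qed.

Lemma run_cat w H K : run w (H ++ K) = obind (run^~ K) (run w H).
Proof. by elim: H w => [|[p c] H IH] w //=; case: sweep => //= w'; exact: IH. Qed.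

Lemma run_cons w p c K u : run w ((p, c) :: K) = Some u ->
  exists2 w', sweep w p c = Some w' & run w' K = Some u.
Proof. by rewrite /=; case: sweep => //= w' e; exists w'. Qed.

Lemma heq_catl A H H' : heq H H' -> heq (A ++ H) (A ++ H').
Proof. by move=> h; elim: A => //= x A IH; apply: heq_cons. Qed.

Lemma heq_size H H' : heq H H' -> size H = size H'.
Proof. by elim=> //= *; congruence. Qed.

Lemma sweep_comm w p c p' c' : p.+1 < p' ->
  obind (fun v => sweep v p' c') (sweep w p c) = obind (fun v => sweep v p c) (sweep w p' c').
Proof.
elim: p p' w => [|p IH] [|p'] [|x w] //= hp.
  case: p' w hp => [|p'] [|y w] //= _.
  by case E: cross => [[? ?]|] /=; case: sweep => //= ?; rewrite E.
have {IH} := IH p' w hp.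
case: (sweep w p c) => [v|] /=; case: (sweep w p' c') => [v'|] //=.
- by move=> ->.
- by move=> ->.
by move=> <-.
Qed.

Lemma run_braid3 x y z w m m' : (m, m') \in braid_table ->
  run [:: x, y, z & w] [:: (0, m.1.1); (1, m.1.2); (0, m.2)] =
  run [:: x, y, z & w] [:: (1, m'.1.1); (0, m'.1.2); (1, m'.2)].
Proof.
rewrite !inE.
by repeat (case/orP); move=> /eqP[-> ->]; case: x => //; case: y => //; case: z.
Qed.

Definition shift_history (k : nat) (H : history) : history :=
  [seq (k + x.1, x.2) | x <- H].

Lemma run_catl X w H : run (X ++ w) (shift_history (size X) H) = omap (cat X) (run w H).
Proof.
elim: H w => [|[p c] H IH] w //=; rewrite sweep_catl.
by case: sweep => //= v; rewrite IH.
Qed.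

Lemma run_braid w p m m' : (m, m') \in braid_table ->
  run w [:: (p, m.1.1); (p.+1, m.1.2); (p, m.2)] =
  run w [:: (p.+1, m'.1.1); (p, m'.1.2); (p.+1, m'.2)].
Proof.
move=> hm; have [hp|hp] := leqP (size w) p.
  have h1 : size w <= p.+1 by lia.
  have h2 : size w <= p.+2 by lia.
  by rewrite /= (sweep_oversize _ h1) (sweep_oversize _ h2).
rewrite -(cat_take_drop p w); set X := take p w; set v := drop p w.
have sX : size X = p by rewrite size_takel //; lia.
have -> : [:: (p, m.1.1); (p.+1, m.1.2); (p, m.2)] =
          shift_history (size X) [:: (0, m.1.1); (1, m.1.2); (0, m.2)].
  by rewrite sX /shift_history /= addn0 addn1.
have -> : [:: (p.+1, m'.1.1); (p, m'.1.2); (p.+1, m'.2)] =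
          shift_history (size X) [:: (1, m'.1.1); (0, m'.1.2); (1, m'.2)].
  by rewrite sX /shift_history /= addn0 addn1.
rewrite !run_catl; case: v => [|x [|y [|z v]]] //; last by rewrite (run_braid3 _ _ _ _ hm).
by rewrite /=; case: cross => //= -[].
Qed.

(** Equivalent histories lead to the same path, with the same dead strands;
    for a hexagon this is a finite check on its three strands. *)
Lemma heq_run H H' : heq H H' -> forall w, run w H = run w H'.
Proof.
elim=> {H H'} //.
- by move=> H H' H'' _ IH1 _ IH2 w; rewrite IH1.
- by move=> [p c] H H' _ IH w /=; case: sweep.
- move=> p c p' c' K hp w.
  have e a b : run w [:: a, b & K] =
      obind (run^~ K) (obind (fun v => sweep v b.1 b.2) (sweep w a.1 a.2)).
    by case: a b => [i a] [j b] /=; case: (sweep w i a).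
  by rewrite !e sweep_comm.
- move=> p c1 c2 c3 c1' c2' c3' K hm w.
  rewrite (run_cat w [:: (p, c1); (p.+1, c2); (p, c3)] K).
  by rewrite (run_cat w [:: (p.+1, c1'); (p, c2'); (p.+1, c3')] K) (run_braid w p hm).
Qed.

(** Conversely the three crossings of a hexagon always form one side of an
    entry of the table. *)
Lemma braid_exists w p c1 c2 c3 u :
  run w [:: (p, c1); (p.+1, c2); (p, c3)] = Some u ->
  exists c1' c2' c3', ((c1, c2, c3), (c1', c2', c3')) \in braid_table.
Proof.
move=> /= ; case E1: sweep => [w1|] //=; case E2: sweep => [w2|] //=; case E3: sweep => [w3|] // _.
have [X [x [y [Y [x' [y' [ew sX h1 e1]]]]]]] := sweepP E1.
move: E2 E3; rewrite {}e1 -sX.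
case: Y ew => [|z Y] ew.
  by rewrite sweep_oversize // size_cat /=; lia.
have -> : X ++ [:: y', x', z & Y] = rcons X y' ++ [:: x', z & Y] by rewrite cat_rcons.
rewrite -[(size X).+1](size_rcons X y') sweep_cat; case h2: cross => [[z' x'']|] //= [<-].
rewrite cat_rcons sweep_cat; case h3: cross => [[z'' y'']|] //= _.
have : (c1, c2, c3) \in unzip1 braid_table.
  clear -h1 h2 h3.
  by case: x h1; case: y => //; case: c1 => [[]|] //= [? ?]; subst;
    case: z h2 => //; case: c2 => [[]|] //= [? ?]; subst;
    case: c3 h3 => [[]|] //= _.
by case/mapP=> -[? [[a b] c]] h /= ->; exists a, b, c.
Qed.

Lemma braid_exists' w p c1 c2 c3 u :
  run w [:: (p.+1, c1); (p, c2); (p.+1, c3)] = Some u ->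
  exists c1' c2' c3', ((c1', c2', c3'), (c1, c2, c3)) \in braid_table.
Proof.
move=> /= ; case E1: sweep => [w1|] //=; case E2: sweep => [w2|] //=; case E3: sweep => [w3|] // _.
have [X' [x [y [Y [x' [y' [ew sX h1 e1]]]]]]] := sweepP E1.
move: E2 E3; rewrite {}e1.
case/lastP: X' sX ew => [|X t] // sX ew; rewrite size_rcons in sX.
case: sX => <-.
rewrite cat_rcons sweep_cat; case h2: cross => [[y'' t']|] //= [<-].
have -> : X ++ [:: y'', t', x' & Y] = rcons X y'' ++ [:: t', x' & Y] by rewrite cat_rcons.
rewrite -[(size X).+1](size_rcons X y'') sweep_cat; case h3: cross => [[x'' t'']|] //= _.
have : (c1, c2, c3) \in unzip2 braid_table.
  clear -h1 h2 h3.
  by case: x h1; case: y => //; case: c1 => [[]|] //= [? ?]; subst;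
    case: t h2 => //; case: c2 => [[]|] //= [? ?]; subst;
    case: c3 h3 => [[]|] //= _.
by case/mapP=> -[[[a b] c] ?] h /= ->; exists a, b, c.
Qed.

Lemma braid_fun m m1 m2 :
  (m, m1) \in braid_table -> (m, m2) \in braid_table -> m1 = m2.
Proof.
move=> h1 h2.
have : all (fun a => all (fun b => (a.1 == b.1) ==> (a.2 == b.2)) braid_table) braid_table by [].
by move=> /allP/(_ _ h1)/allP/(_ _ h2) /=; rewrite eqxx => /eqP.
Qed.

Lemma braid_inj m m1 m2 :
  (m1, m) \in braid_table -> (m2, m) \in braid_table -> m1 = m2.
Proof.
move=> h1 h2.
have : all (fun a => all (fun b => (a.2 == b.2) ==> (a.1 == b.1)) braid_table) braid_table by [].
by move=> /allP/(_ _ h1)/allP/(_ _ h2) /=; rewrite eqxx => /eqP.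
Qed.

(** * Pulling a corner to the front of a history *)

(** [Pulled p H c K]: pulling the crossing at the corner [p] to the front of [H]
    yields the label [c] and the remaining history [K].  Crossings far from [p]
    are commuted with it; a crossing which overlaps [p] starts, together with
    [p], a hexagon, whose other tiling is used instead. *)
Inductive Pulled : nat -> history -> label -> history -> Prop :=
| Pulled_here p c K : Pulled p ((p, c) :: K) c K
| Pulled_far p p' c' K c K1 : (p'.+1 < p) || (p.+1 < p') ->
    Pulled p K c K1 -> Pulled p ((p', c') :: K) c ((p', c') :: K1)
| Pulled_up p c1 K c2 K2 c3 K3 b1 b2 b3 :
    Pulled p K c2 K2 -> Pulled p.+1 K2 c3 K3 ->
    ((b1, b2, b3), (c1, c2, c3)) \in braid_table ->
    Pulled p ((p.+1, c1) :: K) b1 [:: (p.+1, b2), (p, b3) & K3]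
| Pulled_down p c1 K c2 K2 c3 K3 b1 b2 b3 :
    Pulled p.+1 K c2 K2 -> Pulled p K2 c3 K3 ->
    ((c1, c2, c3), (b1, b2, b3)) \in braid_table ->
    Pulled p.+1 ((p, c1) :: K) b1 [:: (p, b2), (p.+1, b3) & K3].

Lemma Pulled_inv p q d K c L : Pulled p ((q, d) :: K) c L ->
  [\/ [/\ q = p, c = d & L = K],
      (q.+1 < p) || (p.+1 < q) /\ exists2 K1, Pulled p K c K1 & L = (q, d) :: K1,
      q = p.+1 /\ exists c2 K2 c3 K3 b2 b3,
        [/\ Pulled p K c2 K2, Pulled p.+1 K2 c3 K3,
            ((c, b2, b3), (d, c2, c3)) \in braid_table
          & L = [:: (p.+1, b2), (p, b3) & K3]]
    | p = q.+1 /\ exists c2 K2 c3 K3 b2 b3,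
        [/\ Pulled q.+1 K c2 K2, Pulled q K2 c3 K3,
            ((d, c2, c3), (c, b2, b3)) \in braid_table
          & L = [:: (q, b2), (q.+1, b3) & K3]]].
Proof.
move eH: ((q, d) :: K) => H h; case: h eH => {p H c L}.
- by move=> p c K' [-> -> ->]; constructor 1.
- by move=> p p' c' K' c K1 hp h [-> -> ->]; constructor 2; split=> //; exists K1.
- move=> p c1 K' c2 K2 c3 K3 b1 b2 b3 h1 h2 h3 [-> -> ->]; constructor 3.
  by split=> //; exists c2, K2, c3, K3, b2, b3.
- move=> p c1 K' c2 K2 c3 K3 b1 b2 b3 h1 h2 h3 [-> -> ->]; constructor 4.
  by split=> //; exists c2, K2, c3, K3, b2, b3.
Qed.

Lemma Pulled_nil p c L : ~ Pulled p [::] c L.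
Proof. by move eH: [::] => H h; case: h eH. Qed.

Lemma Pulled_heq p H c K : Pulled p H c K -> heq H ((p, c) :: K).
Proof.
elim=> {p H c K}.
- by move=> *; apply: heq_refl.
- move=> p p' c' K c K1 hp _ IH; apply: heq_trans (heq_cons _ IH) _.
  by case/orP: hp => hp; [apply: heq_swap | apply/heq_sym/heq_swap].
- move=> p c1 K c2 K2 c3 K3 b1 b2 b3 _ IH1 _ IH2 hm.
  apply: heq_trans (heq_cons _ (heq_trans IH1 (heq_cons _ IH2))) _.
  exact/heq_sym/heq_braid.
- move=> p c1 K c2 K2 c3 K3 b1 b2 b3 _ IH1 _ IH2 hm.
  apply: heq_trans (heq_cons _ (heq_trans IH1 (heq_cons _ IH2))) _.
  exact: heq_braid.
Qed.

Lemma Pulled_size p H c K : Pulled p H c K -> size H = (size K).+1.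
Proof. by move/Pulled_heq/heq_size. Qed.

Lemma rank_at_le w k : rank_at w k <= 2. Proof. exact: rank_le. Qed.

Lemma corner_far p q c w w' : sweep w q c = Some w' ->
  (q.+1 < p) || (p.+1 < q) -> corner p w -> corner p w'.
Proof.
move=> /sweep_rk [sw _ rw'] hpq; rewrite /corner sw !rw'.
have h1 : (p == q) = false by lia.
have h2 : (p == q.+1) = false by lia.
have h3 : (p.+1 == q) = false by lia.
have h4 : (p.+1 == q.+1) = false by lia.
by rewrite h1 h2 h3 h4.
Qed.

(** When two corners overlap, the three strands have decreasing ranks, which
    are therefore those of d, a, e; after one of the corners is crossed, the
    two other pairs of strands still have to cross, and do so at corners of
    the path. *)
Lemma corner_overlap p c w w' : corner p w -> corner p.+1 w ->
  sweep w p.+1 c = Some w' ->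
  corner p w' /\ forall c' w'', sweep w' p c' = Some w'' -> corner p.+1 w''.
Proof.
move=> /andP[h1 h2] /andP[h3 h4] /sweep_rk [sw _ rw'].
have hp : (p == p.+1) = false by lia.
have hp2 : (p == p.+2) = false by lia.
have hp3 : (p.+1 == p.+2) = false by lia.
have hp4 : (p.+2 == p) = false by lia.
have hp5 : (p.+2 == p.+1) = false by lia.
have hp6 : (p.+1 == p) = false by lia.
split; first by rewrite /corner sw !rw' !eqxx hp hp2 h1; lia.
move=> c' w'' /sweep_rk [sw' _ rw''].
by rewrite /corner sw' sw h3 !rw'' !rw' !eqxx ?hp ?hp2 ?hp3 ?hp4 ?hp5 ?hp6.
Qed.

Lemma corner_overlap' p c w w' : corner p w -> corner p.+1 w ->
  sweep w p c = Some w' ->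
  corner p.+1 w' /\ forall c' w'', sweep w' p.+1 c' = Some w'' -> corner p w''.
Proof.
move=> /andP[h1 h2] /andP[h3 h4] /sweep_rk [sw _ rw'].
have hp : (p == p.+1) = false by lia.
have hp2 : (p == p.+2) = false by lia.
have hp3 : (p.+1 == p.+2) = false by lia.
have hp4 : (p.+2 == p) = false by lia.
have hp5 : (p.+2 == p.+1) = false by lia.
have hp6 : (p.+1 == p) = false by lia.
split; first by rewrite /corner sw !rw' !eqxx ?hp ?hp2 ?hp3 ?hp4 ?hp5 ?hp6 h3; lia.
move=> c' w'' /sweep_rk [sw' _ rw''].
by rewrite /corner sw' sw h1 !rw'' !rw' !eqxx ?hp ?hp2 ?hp3 ?hp4 ?hp5 ?hp6.
Qed.

(** Every corner can be pulled to the front: a history ends in a word without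
    corners, so that the two strands of the corner must cross at some point. *)
Lemma Pulled_exists w H u p : run w H = Some u -> final u -> corner p w ->
  exists c K, Pulled p H c K.
Proof.
move: {2}(size H) (leqnn (size H)) => N.
elim: N w H u p => [|N IH] w [|[q d] K] u p //=.
- by move=> _ [->] /(_ p) ->.
- by move=> _ [->] /(_ p) ->.
rewrite ltnS => sK; case E: sweep => [w'|] //= hr fu cp.
have [_ cq _] := sweep_rk E.
have [hpq|hpq] := boolP ((q.+1 < p) || (p.+1 < q)).
  have [c [K1 h]] := IH _ _ _ _ sK hr fu (corner_far E hpq cp).
  by exists c, ((q, d) :: K1); apply: Pulled_far.
have [epq|npq] := eqVneq q p; first by subst q; exists d, K; apply: Pulled_here.
have [eq|neq] := eqVneq q p.+1.
  subst q; have [cp' hc] := corner_overlap cp cq E.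
  have [c2 [K2 h2]] := IH _ _ _ _ sK hr fu cp'.
  have [w2 e2 r2] : exists2 w2, sweep w' p c2 = Some w2 & run w2 K2 = Some u.
    by apply: run_cons; rewrite -(heq_run (Pulled_heq h2)).
  have [c3 [K3 h3]] : exists c3 K3, Pulled p.+1 K2 c3 K3.
    by apply: IH r2 fu (hc _ _ e2); rewrite -ltnS -(Pulled_size h2) ltnW.
  have [w3 e3 _] : exists2 w3, sweep w2 p.+1 c3 = Some w3 & run w3 K3 = Some u.
    by apply: run_cons; rewrite -(heq_run (Pulled_heq h3)).
  have r3 : run w [:: (p.+1, d); (p, c2); (p.+1, c3)] = Some w3 by rewrite /= E /= e2 /= e3.
  have [b1 [b2 [b3 hb]]] := braid_exists' r3.
  by exists b1, [:: (p.+1, b2), (p, b3) & K3]; apply: Pulled_up h2 h3 hb.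
have eq : p = q.+1 by move: hpq npq neq; lia.
subst p; have [cp' hc] := corner_overlap' cq cp E.
have [c2 [K2 h2]] := IH _ _ _ _ sK hr fu cp'.
have [w2 e2 r2] : exists2 w2, sweep w' q.+1 c2 = Some w2 & run w2 K2 = Some u.
  by apply: run_cons; rewrite -(heq_run (Pulled_heq h2)).
have [c3 [K3 h3]] : exists c3 K3, Pulled q K2 c3 K3.
  by apply: IH r2 fu (hc _ _ e2); rewrite -ltnS -(Pulled_size h2) ltnW.
have [w3 e3 _] : exists2 w3, sweep w2 q c3 = Some w3 & run w3 K3 = Some u.
  by apply: run_cons; rewrite -(heq_run (Pulled_heq h3)).
have r3 : run w [:: (q, d); (q.+1, c2); (q, c3)] = Some w3 by rewrite /= E /= e2 /= e3.
have [b1 [b2 [b3 hb]]] := braid_exists r3.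
by exists b1, [:: (q, b2), (q.+1, b3) & K3]; apply: Pulled_down h2 h3 hb.
Qed.

(** The hexagon at an overlapping corner determines its other tiling, because
    each side of the table lists a filling only once. *)
Lemma Pulled_det p H c K c' K' : Pulled p H c K -> Pulled p H c' K' -> c = c' /\ K = K'.
Proof.
move=> h; elim: h c' K' => {p H c K}.
- move=> p c K c' K' /Pulled_inv[[_ -> ->]|[]|[]|[]] //; lia.
- move=> p p' c' K c K1 hp _ IH c0 K0 /Pulled_inv[[]|[_ [K2 /IH[-> ->] ->]]|[]|[]] //; lia.
- move=> p c1 K c2 K2 c3 K3 b1 b2 b3 _ IH1 _ IH2 hm c0 K0
    /Pulled_inv[[]|[]|[_ [d2 [L2 [d3 [L3 [e2 [e3 [/IH1[<- <-] /IH2[<- <-] hm' ->]]]]]]]]|[]]; try lia.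
  by have [-> -> ->] := braid_inj hm hm'.
- move=> p c1 K c2 K2 c3 K3 b1 b2 b3 _ IH1 _ IH2 hm c0 K0
    /Pulled_inv[[]|[]|[]|[_ [d2 [L2 [d3 [L3 [e2 [e3 [/IH1[<- <-] /IH2[<- <-] hm' ->]]]]]]]]]; try lia.
  by have [-> -> ->] := braid_fun hm hm'.
Qed.

(** There are only three ranks. *)
Lemma corner3 p w : corner p w -> corner p.+1 w -> corner p.+2 w -> False.
Proof. by move=> /andP[_ h1] /andP[_ h2] /andP[_ h3]; have := rank_at_le w p; lia. Qed.

Lemma Pulled_run w p H c K u : Pulled p H c K -> run w H = Some u ->
  exists2 w', sweep w p c = Some w' & run w' K = Some u.
Proof. by move=> /Pulled_heq h r; apply: run_cons; rewrite -(heq_run h). Qed.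

(** Pulling a corner to the front is compatible with the equivalence of
    histories.  A corner overlaps at most one of two commuting crossings, and it
    overlaps the sweep of a hexagon only if it belongs to the hexagon, because
    there are only three ranks; so no coherence condition beyond the table is
    needed. *)
Lemma Pulled_coherent H H' w u p c K c' K' : heq H H' ->
  run w H = Some u -> final u -> corner p w ->
  Pulled p H c K -> Pulled p H' c' K' -> c = c' /\ heq K K'.
Proof.
move: {2}(size H) (leqnn (size H)) => N.
elim: N H H' w u p c K c' K' => [|N IHN] H H' w u p c K c' K' sH h.
  by case: H sH h => // _ _ _ _ _ /Pulled_nil.
elim: h sH w u p c K c' K' => {H H'}.
- move=> H _ w u p c K c' K' _ _ _ h1 h2.
  by have [-> ->] := Pulled_det h1 h2; split=> //; apply: heq_refl.
- move=> H H' h IH; rewrite -(heq_size h) => sH w u p c K c' K' r fu cp h1 h2.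
  rewrite -(heq_run h) in r.
  by have [-> /heq_sym] := IH sH _ _ _ _ _ _ _ r fu cp h2 h1.
- move=> H H' H'' h IH h' IH' sH w u p c K c' K' r fu cp h1 h2.
  have r' := r; rewrite (heq_run h) in r'.
  have [c0 [K0 h0]] := Pulled_exists r' fu cp.
  have [-> e1] := IH sH _ _ _ _ _ _ _ r fu cp h1 h0.
  rewrite (heq_size h) in sH.
  have [-> e2] := IH' sH _ _ _ _ _ _ _ r' fu cp h0 h2.
  by split=> //; apply: heq_trans e1 e2.
- move=> [q d] H H' h _ /= sH w u p c K c' K' r fu cp.
  have [w' e1 r'] := run_cons r.
  have [_ cq _] := sweep_rk e1.
  move=> /Pulled_inv[[eq -> ->]|[hpq [K1 h1 ->]]|[eq [c2 [K2 [c3 [K3 [b2 [b3 [h2 h3 hm ->]]]]]]]]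
                 |[eq [c2 [K2 [c3 [K3 [b2 [b3 [h2 h3 hm ->]]]]]]]]].
  + by move=> /Pulled_inv[[_ -> ->]|[]|[]|[]] //; lia.
  + move=> /Pulled_inv[[]|[_ [K1' h1' ->]]|[]|[]]; try (clear -hpq; lia).
    have [-> hK] := IHN _ _ _ _ _ _ _ _ _ sH h r' fu (corner_far e1 hpq cp) h1 h1'.
    by split=> //; apply: heq_cons.
  + move=> /Pulled_inv[[]|[]|[_ [d2 [L2 [d3 [L3 [e2 [e3 [k2 k3 hm' ->]]]]]]]]|[]]; try (clear -eq; lia).
    subst q; have [cp' hc] := corner_overlap cp cq e1.
    have [e hL2] := IHN _ _ _ _ _ _ _ _ _ sH h r' fu cp' h2 k2.
    have [w2 s2 r2] := Pulled_run h2 r'.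
    have sK2 : size K2 <= N by rewrite -ltnS -(Pulled_size h2) ltnW.
    have [e' hL3] := IHN _ _ _ _ _ _ _ _ _ sK2 hL2 r2 fu (hc _ _ s2) h3 k3.
    rewrite -e -e' in hm'; have [-> -> ->] := braid_inj hm hm'.
    by split=> //; do 2 apply: heq_cons.
  + move=> /Pulled_inv[[]|[]|[]|[_ [d2 [L2 [d3 [L3 [e2 [e3 [k2 k3 hm' ->]]]]]]]]]; try (clear -eq; lia).
    subst p; have [cp' hc] := corner_overlap' cq cp e1.
    have [e hL2] := IHN _ _ _ _ _ _ _ _ _ sH h r' fu cp' h2 k2.
    have [w2 s2 r2] := Pulled_run h2 r'.
    have sK2 : size K2 <= N by rewrite -ltnS -(Pulled_size h2) ltnW.
    have [e' hL3] := IHN _ _ _ _ _ _ _ _ _ sK2 hL2 r2 fu (hc _ _ s2) h3 k3.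
    rewrite -e -e' in hm'; have [-> -> ->] := braid_fun hm hm'.
    by split=> //; do 2 apply: heq_cons.
(* Two commuting crossings.  The corner [p] is one of them, or far from both, or
   it overlaps one of them; by [corner3] it does not overlap both. *)
- move=> a c0 b d K0 hab _ w u p c K c' K' r fu cp h1 h2.
  have [w1 s1 r1] := run_cons r; have [w2 s2 r2] := run_cons r1.
  have [_ ca _] := sweep_rk s1.
  have cb : corner b w.
    have r' := r; rewrite (heq_run (heq_swap _ _ _ hab)) in r'.
    by have [w3 s3 _] := run_cons r'; have [_ cb _] := sweep_rk s3.
  case/Pulled_inv: h1 => [[ea -> ->]|[hpa [L h1 ->]]|[ea [c2 [K2 [c3 [K3 [b2 [b3 [k2 k3 hm ->]]]]]]]]
                 |[ea [c2 [K2 [c3 [K3 [b2 [b3 [k2 k3 hm ->]]]]]]]]].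
  + subst a; case/Pulled_inv: h2 => [[]|[_ [L h2 ->]]|[]|[]]; try (clear -hab; lia).
    by have [-> ->] := Pulled_det h2 (Pulled_here _ _ _); split=> //; apply: heq_refl.
  + case/Pulled_inv: h1 => [[eb -> ->]|[hpb [L' h1 ->]]|[eb [c2 [K2 [c3 [K3 [b2 [b3 [k2 k3 hm ->]]]]]]]]
                 |[eb [c2 [K2 [c3 [K3 [b2 [b3 [k2 k3 hm ->]]]]]]]]].
    * subst b.
      by have [-> ->] := Pulled_det h2 (Pulled_here _ _ _); split=> //; apply: heq_refl.
    * have [-> ->] := Pulled_det h2 (Pulled_far _ hpb (Pulled_far _ hpa h1)).
      by split=> //; apply: heq_swap.
    * subst b.
      have hap : (a.+1 < p.+1) || (p.+2 < a) by clear -hab hpa; lia.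
      have [-> ->] := Pulled_det h2 (Pulled_up (Pulled_far _ hpa k2) (Pulled_far _ hap k3) hm).
      split=> //; apply: heq_trans (heq_swap _ _ _ _) (heq_cons _ (heq_swap _ _ _ _)); clear -hab hpa; lia.
    * subst p.
      have hap : (a.+1 < b) || (b.+1 < a) by clear -hab hpa; lia.
      have [-> ->] := Pulled_det h2 (Pulled_down (Pulled_far _ hpa k2) (Pulled_far _ hap k3) hm).
      split=> //; apply: heq_trans (heq_swap _ _ _ _) (heq_cons _ (heq_swap _ _ _ _)); clear -hab hpa; lia.
  + subst a.
    case/Pulled_inv: k2 => [[]|[hpb [L k2 e]]|[]|[]]; try (clear -hab; lia).
    subst K2; case/Pulled_inv: k3 => [[]|[hpb' [L' k3 e]]|[]|[]]; try (clear -hab; lia).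
    subst K3.
    have [-> ->] := Pulled_det h2 (Pulled_far _ hpb (Pulled_up k2 k3 hm)).
    split=> //; apply: heq_trans (heq_cons _ (heq_swap _ _ _ _)) (heq_swap _ _ _ _); clear -hab; lia.
  + subst p.
    case/Pulled_inv: k2 => [[]|[hpb [L k2 e]]|[eb]|[]]; try (clear -hab; lia).
    * subst K2; case/Pulled_inv: k3 => [[]|[hpb' [L' k3 e]]|[]|[]]; try (clear -hab; lia).
      subst K3.
      have [-> ->] := Pulled_det h2 (Pulled_far _ hpb (Pulled_down k2 k3 hm)).
      split=> //; apply: heq_trans (heq_cons _ (heq_swap _ _ _ _)) (heq_swap _ _ _ _); clear -hab hpb; lia.
    * by case: (corner3 ca cp); rewrite -eb.
(* A hexagon.  The corner [p] is one of the two corners of its strands, or it is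
   far from all crossings of the hexagon. *)
- move=> a m1 m2 m3 m1' m2' m3' K0 hm _ w u p c K c' K' r fu cp h1 h2.
  have [w1 s1 r1] := run_cons r; have [_ ca _] := sweep_rk s1.
  have ca' : corner a.+1 w.
    have r' := r; rewrite (heq_run (heq_braid _ _ hm)) in r'.
    by have [w3 s3 _] := run_cons r'; have [_ cb _] := sweep_rk s3.
  have [epa|npa] := eqVneq p a.
    subst p; have [-> ->] := Pulled_det h1 (Pulled_here _ _ _).
    have [-> ->] := Pulled_det h2 (Pulled_up (Pulled_here _ _ _) (Pulled_here _ _ _) hm).
    by split=> //; apply: heq_refl.
  have [epa|npa'] := eqVneq p a.+1.
    subst p; have [-> ->] := Pulled_det h1 (Pulled_down (Pulled_here _ _ _) (Pulled_here _ _ _) hm).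
    have [-> ->] := Pulled_det h2 (Pulled_here _ _ _).
    by split=> //; apply: heq_refl.
  have [epa|npa2] := eqVneq p a.+2; first by subst p; case: (corner3 ca ca').
  have [epa|npa3] := eqVneq p.+1 a; first by subst a; case: (corner3 cp ca).
  have far1 : (a.+1 < p) || (p.+1 < a) by clear -npa npa' npa2 npa3; lia.
  have far2 : (a.+2 < p) || (p.+1 < a.+1) by clear -npa npa' npa2 npa3; lia.
  case/Pulled_inv: h1 => [[]|[_ [L h1 e]]|[]|[]]; try (clear -far1; lia).
  case/Pulled_inv: h1 => [[]|[_ [L2 h1 e2]]|[]|[]]; try (clear -far2; lia).
  case/Pulled_inv: h1 => [[]|[_ [L3 h1 e3]]|[]|[]]; try (clear -far1; lia).
  have [-> ->] := Pulled_det h2 (Pulled_far _ far2 (Pulled_far _ far1 (Pulled_far _ far2 h1))).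
  by rewrite e e2 e3; split=> //; apply: heq_braid.
Qed.

(** Both histories are pulled at the corner where they start. This makes
    classes of histories behave like elements of a cancellative monoid, and it
    is the source of all uniqueness statements about classes. *)
Lemma heq_cancel p c K c' K' w u : heq ((p, c) :: K) ((p, c') :: K') ->
  run w ((p, c) :: K) = Some u -> final u -> c = c' /\ heq K K'.
Proof.
move=> h r fu; have [w1 s1 _] := run_cons r; have [_ cp _] := sweep_rk s1.
exact: Pulled_coherent h r fu cp (Pulled_here _ _ _) (Pulled_here _ _ _).
Qed.

Lemma pull_corner w H u p : run w H = Some u -> final u -> corner p w ->
  exists c K, heq H ((p, c) :: K).
Proof.
move=> r fu cp; have [c [K h]] := Pulled_exists r fu cp.
by exists c, K; apply: Pulled_heq.
Qed.

(** * Deleting a dead strand *)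

(** [del_strand z H]: the history [H] without the crossings of the strand which starts
    at position [z]; the positions are those in the words without this strand. *)
Fixpoint del_strand (z : nat) (H : history) : history :=
  if H is (p, c) :: K then
    if p == z then del_strand z.+1 K
    else if p.+1 == z then del_strand p K
    else (if p < z then p else p.-1, c) :: del_strand z K
  else [::].

Lemma sweep_marked X x Y p c w' : sweep (X ++ x :: Y) p c = Some w' ->
  [\/ p.+1 < size X /\ exists X', [/\ sweep X p c = Some X', size X' = size X
                                   & w' = X' ++ x :: Y],
      p.+1 = size X /\ exists X0 y x' y', [/\ X = rcons X0 y,
         cross y x c = Some (x', y') & w' = X0 ++ x' :: y' :: Y],
      p = size X /\ exists y Y0 x' y', [/\ Y = y :: Y0,
         cross x y c = Some (y', x') & w' = rcons X y' ++ x' :: Y0]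
    | size X < p /\ exists Y', [/\ sweep Y (p - (size X).+1) c = Some Y'
                                   & w' = X ++ x :: Y']].
Proof.
have [h|h] := ltnP p.+1 (size X).
  rewrite sweep_catr //; case E: sweep => [X'|] //= [<-]; constructor 1; split=> //.
  by exists X'; have [-> _ _] := sweep_rk E.
have [h'|h'] := eqVneq p.+1 (size X).
  case/lastP: X h' {h} => [|X0 y] //; rewrite size_rcons => -[->].
  rewrite cat_rcons sweep_cat; case E: cross => [[x' y']|] //= [<-]; constructor 2.
  by split=> //; exists X0, y, x', y'.
have [h2|h2] := eqVneq p (size X).
  case: Y => [|y Y]; first by rewrite sweep_oversize ?size_cat //= h2; lia.
  rewrite h2 sweep_cat; case E: cross => [[y' x']|] //= [<-]; constructor 3.
  by split=> //; exists y, Y, x', y'; rewrite cat_rcons.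
have h3 : size X < p by lia.
have ep : p = size (rcons X x) + (p - (size X).+1) by rewrite size_rcons subnKC.
rewrite -cat_rcons {1}ep sweep_catl.
case E: sweep => [Y'|] //= [<-]; constructor 4; split=> //.
by exists Y'; rewrite cat_rcons.
Qed.

Lemma cross_dead_l x y c s : dead x -> cross x y c = Some s ->
  [/\ c = None, s = (y, x) & letter_of x = Ld].
Proof. by case: x => //; case: y => //; case: c => [[]|] //= _ [<-]. Qed.

Lemma cross_dead_r x y c s : dead y -> cross x y c = Some s ->
  [/\ c = None, s = (y, x) & letter_of y = Le].
Proof. by case: y => //; case: x => //; case: c => [[]|] //= _ [<-]. Qed.

(** Dead strands cross all others without any effect. *)
Lemma sweep_dead X x Y p c w' : dead x -> sweep (X ++ x :: Y) p c = Some w' ->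
  exists X' Y', [/\ w' = X' ++ x :: Y',
    (p == size X = false -> p.+1 == size X = false -> size X' = size X /\
       sweep (X ++ Y) (if p < size X then p else p.-1) c = Some (X' ++ Y')),
    (p = size X -> [/\ c = None, size X' = p.+1, X' ++ Y' = X ++ Y & letter_of x = Ld])
    & (p.+1 = size X -> [/\ c = None, size X' = p, X' ++ Y' = X ++ Y & letter_of x = Le])].
Proof.
move=> dx /sweep_marked [[hp [X' [e sX ->]]]|[hp [X0 [y [x' [y' [eX e ->]]]]]]
  |[hp [y [Y0 [x' [y' [eY e ->]]]]]]|[hp [Y' [e ->]]]].
- exists X', Y; split=> //; try lia.
  by rewrite (ltn_trans (ltnSn p) hp) sweep_catr // e.
- have [-> [-> ->] ->] := cross_dead_r dx e.
  exists X0, (y :: Y); rewrite eX cat_rcons !size_rcons in hp *; split=> //; try lia.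
  by case: hp => ->.
- have [-> [-> ->] ->] := cross_dead_l dx e.
  exists (rcons X y), Y0; rewrite eY cat_rcons size_rcons; split=> //; try lia.
  by rewrite cat_rcons hp.
- exists X, Y'; split=> //; try lia.
  move=> _ _; split=> //; rewrite ltnNge (ltnW hp) /=.
  have -> : p.-1 = size X + (p - (size X).+1) by lia.
  by rewrite sweep_catl e.
Qed.

Lemma run_del_dead X x Y H u : dead x -> run (X ++ x :: Y) H = Some u ->
  exists X' Y', u = X' ++ x :: Y' /\ run (X ++ Y) (del_strand (size X) H) = Some (X' ++ Y').
Proof.
move=> dx; elim: H X Y => [|[p c] H IH] X Y /=.
  by move=> [<-]; exists X, Y.
case E: sweep => [w'|] //= r.
have [X1 [Y1 [ew h1 h2 h3]]] := sweep_dead dx E; rewrite {}ew in r.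
have [X' [Y' [-> h]]] := IH _ _ r; exists X', Y'; split=> //.
case: eqP => [e|/eqP/negbTE e]; first by have [_ sX eq _] := h2 e; rewrite -e -sX -eq.
case: eqP => [e'|/eqP/negbTE e']; first by have [_ sX eq _] := h3 e'; rewrite -eq -sX.
by have [sX s] := h1 e e'; rewrite /= s /= -sX.
Qed.

Lemma del_swap z p c p' c' K : p.+1 < p' ->
  heq (del_strand z ((p, c) :: (p', c') :: K)) (del_strand z ((p', c') :: (p, c) :: K)).
Proof.
move=> hp /=.
have [e1|n1] := eqVneq p z.
  subst p.
  have -> : (p' == z.+1) = false by lia.
  have -> : (p'.+1 == z.+1) = false by lia.
  have -> : (p' == z) = false by lia.
  have -> : (p'.+1 == z) = false by lia.
  have -> : (p' < z.+1) = false by lia.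
  have -> : (p' < z) = false by lia.
  by rewrite /= ?eqxx; apply: heq_refl.
have [e2|n2] := eqVneq p.+1 z.
  have -> : (p' == p) = false by lia.
  have -> : (p'.+1 == p) = false by lia.
  have -> : (p' == z) = false by lia.
  have -> : (p'.+1 == z) = false by lia.
  have -> : (p' < p) = false by lia.
  have -> : (p' < z) = false by lia.
  by rewrite /= ?(negbTE n1) ?e2 ?eqxx; apply: heq_refl.
have [e3|n3] := eqVneq p' z.
  have -> : (p == z.+1) = false by lia.
  have -> : (p.+1 == z.+1) = false by lia.
  have -> : p < z by lia.
  have -> : p < z.+1 by lia.
  by rewrite /= ?e3 ?eqxx; apply: heq_refl.
have [e4|n4] := eqVneq p'.+1 z.
  have -> : (p == p') = false by lia.
  have -> : (p.+1 == p') = false by lia.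
  have -> : p < z by lia.
  have -> : p < p' by lia.
  by rewrite /= ?(negbTE n3) ?e4 ?eqxx; apply: heq_refl.
rewrite /= ?(negbTE n1) ?(negbTE n2) ?(negbTE n3) ?(negbTE n4).
by apply: heq_swap; case: (ltnP p z); case: (ltnP p' z); lia.
Qed.

(** If the strand is dead, deleting it turns the two sides of a hexagon to which
    it belongs into the same single crossing. *)
Lemma heq_del X x Y H H' u : dead x -> heq H H' -> run (X ++ x :: Y) H = Some u ->
  heq (del_strand (size X) H) (del_strand (size X) H').
Proof.
move=> dx h; elim: h X Y u => {H H'}.
- by move=> *; apply: heq_refl.
- by move=> H H' h IH X Y u; rewrite -(heq_run h) => /IH /heq_sym.
- move=> H H' H'' h IH h' IH' X Y u r; apply: heq_trans (IH _ _ _ r) _.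
  by apply: (IH' X Y u); rewrite -(heq_run h).
- move=> [p c] H H' h IH X Y u r; have [w' e r'] := run_cons r.
  have [X1 [Y1 [ew h1 h2 h3]]] := sweep_dead dx e; rewrite {}ew in r'.
  have {}IH := IH _ _ _ r' => /=.
  case: eqP => [e1|/eqP/negbTE e1]; first by have [_ sX eq _] := h2 e1; rewrite -e1 -sX.
  case: eqP => [e2|/eqP/negbTE e2]; first by have [_ sX eq _] := h3 e2; rewrite -sX.
  by have [sX _] := h1 e1 e2; rewrite -sX in IH *; apply: heq_cons.
- by move=> p c p' c' K hp X Y u _; apply: del_swap.
- move=> p c1 c2 c3 c1' c2' c3' K hm X Y u r.
  have [w1 s1 r1] := run_cons r; have [w2 s2 r2] := run_cons r1; have [w3 s3 r3] := run_cons r2.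
  have [X1 [Y1 [ew h1 h2 h3]]] := sweep_dead dx s1; rewrite {}ew in s2.
  have [X2 [Y2 [ew k1 k2 k3]]] := sweep_dead dx s2; rewrite {}ew in s3.
  have [X3 [Y3 [ew l1 l2 l3]]] := sweep_dead dx s3.
  move: h1 h2 h3; set z := size X => h1 h2 h3 /=.
  have [lt|ge] := ltnP z p.
    have -> : (p == z) = false by lia.
    have -> : (p.+1 == z) = false by lia.
    have -> : (p.+2 == z) = false by lia.
    have -> : (p < z) = false by lia.
    have -> : (p.+1 < z) = false by lia.
    have := heq_braid p.-1 (del_strand z K) hm.
    by rewrite prednK //; apply: leq_ltn_trans lt.
  have [gt|le] := ltnP p.+2 z.
    have -> : (p == z) = false by lia.
    have -> : (p.+1 == z) = false by lia.
    have -> : (p.+2 == z) = false by lia.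
    have -> : p < z by lia.
    have -> : p.+1 < z by lia.
    exact: heq_braid.
  (* The dead strand is the d of the hexagon. *)
  have [e0|n0] := eqVneq p z.
    have [e1 sX1 _ _] := h2 e0; have [e2 sX2 _ _] := k2 (esym sX1).
    rewrite -e0 ?eqxx.
    have b1 : (p == p.+2) = false by lia.
    have b2 : (p.+1 == p.+2) = false by lia.
    have b3 : (p.+1 == p) = false by lia.
    have b4 : (p.+2 == p) = false by lia.
    have b5 : p < p.+2 by lia.
    rewrite /= ?eqxx /= ?(b1, b2, b3, b4, b5) /= ?(b1, b2, b3, b4, b5) /= ?eqxx /= ?(b1, b2, b3, b4, b5).
    have bl : (p.+1 < p) = false by lia.
    rewrite ?bl ?ltnn /=.
    have <- : c3 = c1' by move: hm; rewrite e1 e2 !inE; repeat (case/orP); move=> /eqP[] //; congruence.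
    exact: heq_refl.
  (* The dead strand is the e of the hexagon. *)
  have [e0|n1] := eqVneq p.+2 z.
    have n1 : (p.+1 == z) = false by lia.
    have [sX1 _] := h1 (negbTE n0) n1.
    have es : p.+2 = size X1 by rewrite sX1.
    have [e1 sX2 _ _] := k3 es; have [e2 _ _ _] := l3 (esym sX2).
    rewrite -e0 ?eqxx.
    have b6 : (p == p.+2) = false by lia.
    have b7 : (p.+1 == p.+2) = false by lia.
    have b8 : (p.+1 == p) = false by lia.
    have b9 : (p.+2 == p) = false by lia.
    have b10 : (p == p.+1) = false by lia.
    have b11 : p < p.+2 by lia.
    rewrite /= ?eqxx /= ?(b6, b7, b8, b9, b10, b11) /= ?(b6, b7, b8, b9, b10, b11) /= ?eqxx /= ?(b6, b7, b8, b9, b10, b11).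
    have bl : (p.+1 < p) = false by lia.
    rewrite ?bl ?ltnn /=.
    have <- : c1 = c3' by move: hm; rewrite e1 e2 !inE; repeat (case/orP); move=> /eqP[] //; congruence.
    exact: heq_refl.
  have ez : p.+1 = z by lia.
  (* The middle strand of a hexagon is an a, which is never dead. *)
  have [_ sX1 _ lE] := h3 ez.
  have m1 : (p.+1 == size X1) = false by lia.
  have m2 : (p.+2 == size X1) = false by lia.
  have [sX2 _] := k1 m1 m2.
  have es : p = size X2 by rewrite sX2.
  by have [_ _ _] := l2 es; rewrite lE.
Qed.

Lemma finalP w : final w <-> sorted leq (map rank w).
Proof.
split=> [h|/(sortedP 1) h p].
  apply/(sortedP 1) => i; rewrite size_map => hi.
  have := h i; rewrite /corner hi /= => /negbT; rewrite -leqNgt /rank_at.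
  by rewrite !(nth_map LiveA) // ltnW.
apply/negbTE/negP => /andP[hp]; rewrite /rank_at ltnNge => /negP; apply.
have hp' : p < size w by apply: ltnW.
by have := h p; rewrite size_map (nth_map LiveA) // (nth_map LiveA) //; apply.
Qed.

Lemma final_or_corner w : final w \/ exists p, corner p w.
Proof.
have [/hasP[p _ h]|/hasPn h] := boolP (has (corner^~ w) (iota 0 (size w))).
  by right; exists p.
left=> p; apply/negbTE/negP => cp.
have hin : p \in iota 0 (size w) by rewrite mem_iota /= add0n; case/andP: cp => /ltnW.
by rewrite (negbTE (h _ hin)) in cp.
Qed.

Lemma final_del X x Y : final (X ++ x :: Y) -> final (X ++ Y).
Proof.
move=> /finalP h; apply/finalP; apply: subseq_sorted h; first exact: leq_trans.
by rewrite !map_cat /=; apply: cat_subseq => //; apply: subseq_cons.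
Qed.

Lemma run_final w H u : final w -> run w H = Some u -> H = [::].
Proof.
case: H => [|[p c] K] // fw r; have [w' e _] := run_cons r.
by have [_ cp _] := sweep_rk e; rewrite fw in cp.
Qed.

(** A history is determined up to equivalence by what is left after deleting a
    dead strand: pull any corner to the front. If the dead strand is part of
    it, the label is forced, and otherwise the labels agree by cancellation in
    the remaining histories. *)
Lemma heq_of_del X x Y H H' u u' : dead x ->
  run (X ++ x :: Y) H = Some u -> final u ->
  run (X ++ x :: Y) H' = Some u' -> final u' ->
  heq (del_strand (size X) H) (del_strand (size X) H') -> heq H H'.
Proof.
move=> dx; move: {2}(size H) (leqnn (size H)) => N.
elim: N X Y H H' u u' => [|N IH] X Y H H' u u' sH r fu r' fu' hd;
  have [fw|[p cp]] := final_or_corner (X ++ x :: Y);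
  try by rewrite (run_final fw r) (run_final fw r'); apply: heq_refl.
  by move: r; case: H sH {hd} => // _ [eu]; move: fu; rewrite -eu => /(_ p); rewrite cp.
have [c [K hK]] := pull_corner r fu cp; have [c' [K' hK']] := pull_corner r' fu' cp.
have rK := r; rewrite (heq_run hK) in rK; have rK' := r'; rewrite (heq_run hK') in rK'.
have [w1 s1 r1] := run_cons rK; have [w1' s1' r1'] := run_cons rK'.
have {}hd : heq (del_strand (size X) ((p, c) :: K)) (del_strand (size X) ((p, c') :: K')).
  by apply: heq_trans (heq_sym (heq_del dx hK r)) (heq_trans hd (heq_del dx hK' r')).
have [X1 [Y1 [ew h1 h2 h3]]] := sweep_dead dx s1.
have [X1' [Y1' [_ h1' h2' h3']]] := sweep_dead dx s1'.
have sK : size K <= N by rewrite -ltnS -[(size K).+1]/(size ((p, c) :: K)) -(heq_size hK).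
suff [e hX] : c = c' /\ heq (del_strand (size X1) K) (del_strand (size X1) K').
  move: s1 r1 r1' s1'; rewrite ew -e => -> r1 r1' [ew']; rewrite -ew' in r1'.
  apply: heq_trans hK _; rewrite e; apply: heq_trans _ (heq_sym hK').
  by apply/heq_cons/(IH X1 Y1 _ _ _ _ sK r1 fu r1' fu' hX).
move: hd => /=.
case: eqP => [e|/eqP/negbTE e].
  by have [-> sX _ _] := h2 e; have [-> _ _ _] := h2' e; rewrite sX e.
case: eqP => [e2|/eqP/negbTE e2].
  by have [-> sX _ _] := h3 e2; have [-> _ _ _] := h3' e2; rewrite sX.
have [-> _] := h1 e e2 => hd.
have [X2 [Y2 [eu rd]]] := run_del_dead dx rK.
rewrite /= e e2 in rd.
by apply: (heq_cancel hd rd); apply: (@final_del _ x); rewrite -eu.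
Qed.

(** The potential bounds the number of crossings still to come. *)
Fixpoint potential (w : seq strand) : nat :=
  if w is x :: w' then rank x * size w' + potential w' else 0.

Lemma potential_sweep w p c w' : sweep w p c = Some w' -> potential w' < potential w.
Proof.
move=> /sweepP [X [x [y [Y [x' [y' [-> _ /cross_rank[/= lt ly lx] ->]]]]]]].
elim: X => [|z X IH] /=; last by rewrite !size_cat /= ltn_add2l.
rewrite /rank ly lx -!/(rank _); nia.
Qed.

(** A dead strand can be inserted anywhere: it is moved first, as long as it
    makes a corner; and when it makes none, the corners of the word without it
    are corners of the word with it. *)
Lemma insert_dead X x Y K u : dead x -> run (X ++ Y) K = Some u -> final u ->
  exists H u', [/\ run (X ++ x :: Y) H = Some u', final u' & del_strand (size X) H = K].
Proof.
move=> dx; move: {2}(potential _) (leqnn (potential (X ++ x :: Y))) => N.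
elim: N X Y K => [|N IH] X Y K sN r fu;
  have [fw|[p0 cp0]] := final_or_corner (X ++ x :: Y);
  try by rewrite (run_final (final_del fw) r); exists [::], (X ++ x :: Y).
  by have [c [w' /potential_sweep]] := corner_sweep cp0; lia.
have touch p : corner p (X ++ x :: Y) -> (p == size X) || (p.+1 == size X) ->
    exists H u', [/\ run (X ++ x :: Y) H = Some u', final u' & del_strand (size X) H = K].
  move=> cp tp; have [c [w' s]] := corner_sweep cp.
  have [X1 [Y1 [ew _ h2 h3]]] := sweep_dead dx s.
  have [sX eXY] : (if p == size X then size X1 = (size X).+1 else size X1 = p)
      /\ X1 ++ Y1 = X ++ Y.
    case: eqP tp => [e _|_ /= /eqP e]; first by have [_ -> -> _] := h2 e; rewrite e.
    by have [_ -> -> _] := h3 e.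
  have lt : potential (X1 ++ x :: Y1) <= N.
    by rewrite -ew -ltnS (leq_trans (potential_sweep s)).
  rewrite -eXY in r; have [H [u' [r' fu' hd]]] := IH _ _ _ lt r fu.
  exists ((p, c) :: H), u'; split=> //=; first by rewrite s /= ew.
  by case: eqP sX tp => [_ <-|_ <- /= ->].
have [/orP[h|h]|nt] := boolP (corner (size X) (X ++ x :: Y) ||
                      (0 < size X) && corner (size X).-1 (X ++ x :: Y)).
- by apply: touch h _; rewrite eqxx.
- by case/andP: h => h0 h; apply: touch h _; rewrite prednK // eqxx orbT.
have ntp p : corner p (X ++ x :: Y) -> (p != size X) && (p.+1 != size X).
  move=> cp; rewrite -negb_or; apply/negP => /orP h; case/negP: nt.
  by case: h => /eqP <-; rewrite /= cp ?orbT.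
case: K r {touch} => [|[p c] K] r.
  case: r => eu; subst u.
  have [c [w' s]] := corner_sweep cp0.
  have [X1 [Y1 [ew h1 _ _]]] := sweep_dead dx s.
  have /andP[/negbTE e1 /negbTE e2] := ntp _ cp0.
  have [_ s'] := h1 e1 e2.
  by have [_] := sweep_rk s'; rewrite fu.
have [v s r'] := run_cons r.
set p' := if p.+1 < size X then p else p.+1.
have [w' [X1 [Y1 [s' ew sX ev]]]] : exists w' X1 Y1, [/\ sweep (X ++ x :: Y) p' c = Some w',
    w' = X1 ++ x :: Y1, size X1 = size X & v = X1 ++ Y1].
  rewrite /p'; have [lt|ge] := ltnP p.+1 (size X).
    rewrite sweep_catr // in s; rewrite sweep_catr //.
    case E: sweep s => [X1|] //= [<-]; exists (X1 ++ x :: Y), X1, Y.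
    by have [-> _ _] := sweep_rk E.
  have [le|gt] := leqP (size X) p.
    have ep : p = size X + (p - size X) by rewrite subnKC.
    have ep1 : p.+1 = size (rcons X x) + (p - size X) by rewrite size_rcons addSn -ep.
    rewrite ep sweep_catl in s; rewrite -cat_rcons ep1 sweep_catl.
    case E: sweep s => [Y1|] //= [<-]; exists (X ++ x :: Y1), X, Y1.
    by rewrite cat_rcons.
  (* Otherwise the first crossing of [K] is that of the two neighbours of [x];
     then [x] makes a corner with one of them, by its rank. *)
  have epX : p.+1 = size X by lia.
  exfalso; case/lastP: X epX s nt {ntp sN r cp0 IH p' ge gt} => // X a.
  rewrite size_rcons => -[->]; rewrite cat_rcons.
  case: Y => [|b Y].
    by rewrite sweep_oversize // size_cat addn1.
  rewrite sweep_cat; case E: cross => [s|] //= _; have [lt _ _] := cross_rank E.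
  have -> : corner (size X).+1 (rcons X a ++ [:: x, b & Y]) = (rank b < rank x).
    by rewrite -(size_rcons X a) corner_cat.
  have -> : corner (size X) (rcons X a ++ [:: x, b & Y]) = (rank x < rank a).
    by rewrite cat_rcons corner_cat.
  by case: x dx lt {E} => // _; case: a => //; case: b.
(* The first crossing of [K] takes place at a corner which avoids [x]. *)
have /andP[/negbTE e1 /negbTE e2] : (p' != size X) && (p'.+1 != size X).
  by apply: ntp; have [] := sweep_rk s'.
have lt : potential (X1 ++ x :: Y1) <= N.
  by rewrite -ew -ltnS (leq_trans (potential_sweep s')).
rewrite ev in r'; have [H [u' [rH fu' hd]]] := IH _ _ _ lt r' fu.
exists ((p', c) :: H), u'; split=> //=; first by rewrite s' /= ew.
rewrite e1 e2 -sX hd sX; congr ((_, _) :: _).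
by move: e1 e2; rewrite /p'; case: ltnP => h; case: ltnP => //; lia.
Qed.

(** * Strands which die at their first crossing *)

Fixpoint first_touch (z : nat) (H : history) : option label :=
  if H is (p, c) :: K then
    if (p == z) || (p.+1 == z) then Some c else first_touch z K
  else None.

(** The symbol by which a live strand dies; a dead strand only has crossings
    labelled [None]. *)
Definition killer (x : strand) : label :=
  match x with LiveD => Some Cbeta | LiveE => Some Calpha | _ => None end.

(** The strand dies at its first crossing, if it has any: then deleting it does
    not disturb the other strands.  This describes the strips which are moved by
    the chain. *)
Definition inert (x : strand) (z : nat) (H : history) : bool :=
  first_touch z H \in [:: None; Some (killer x)].

Lemma cross_killer_l x y s : letter_of x != La -> cross x y (killer x) = Some s ->
  s = (y, kill x) /\ letter_of x = Ld.
Proof. by case: x => //; case: y => //= _ [<-]. Qed.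

Lemma cross_killer_r x y s : letter_of y != La -> cross x y (killer y) = Some s ->
  s = (kill y, x) /\ letter_of y = Le.
Proof. by case: y => //; case: x => //= _ [<-]. Qed.

Lemma dead_kill x : letter_of x != La -> dead (kill x). Proof. by case: x. Qed.
Lemma letter_kill x : letter_of (kill x) = letter_of x. Proof. by case: x. Qed.

Lemma inert_cons x z p c H : inert x z ((p, c) :: H) =
  if (p == z) || (p.+1 == z) then c == killer x else inert x z H.
Proof. by rewrite /inert /=; case: ifP => // _; rewrite !inE. Qed.

Lemma sweep_inert X x Y p c w' : letter_of x != La ->
  sweep (X ++ x :: Y) p c = Some w' ->
  [\/ [/\ p != size X, p.+1 != size X & exists X' Y',
          [/\ w' = X' ++ x :: Y', size X' = size X &
           sweep (X ++ Y) (if p < size X then p else p.-1) c = Some (X' ++ Y')]],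
      [/\ p = size X, letter_of x = Ld & c = killer x -> exists X' Y',
          [/\ w' = X' ++ kill x :: Y', size X' = p.+1 & X' ++ Y' = X ++ Y]]
    | [/\ p.+1 = size X, letter_of x = Le & c = killer x -> exists X' Y',
          [/\ w' = X' ++ kill x :: Y', size X' = p & X' ++ Y' = X ++ Y]]].
Proof.
move=> la /sweep_marked [[hp [X' [e sX ->]]]|[hp [X0 [y [x' [y' [eX e ->]]]]]]
  |[hp [y [Y0 [x' [y' [eY e ->]]]]]]|[hp [Y' [e ->]]]].
- constructor 1; split; try lia; exists X', Y; split=> //.
  by rewrite (ltn_trans (ltnSn p) hp) sweep_catr // e.
- constructor 3; split=> //.
    by have [/= h _ _] := cross_rank e; clear -h la; case: x h la => //; case: y.
  move=> ec; rewrite ec in e; have [[-> ->] _] := cross_killer_r la e.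
  by exists X0, (y :: Y); rewrite eX size_rcons cat_rcons in hp *; case: hp => ->.
- constructor 2; split=> //.
    by have [/= h _ _] := cross_rank e; clear -h la; case: x h la => //; case: y.
  move=> ec; rewrite ec in e; have [[-> ->] _] := cross_killer_l la e.
  by exists (rcons X y), Y0; rewrite eY size_rcons hp !cat_rcons.
- constructor 1; split; try lia; exists X, Y'; split=> //.
  rewrite ltnNge (ltnW hp) /=.
  have -> : p.-1 = size X + (p - (size X).+1) by lia.
  by rewrite sweep_catl e.
Qed.

Lemma run_del X x Y H u : letter_of x != La -> inert x (size X) H ->
  run (X ++ x :: Y) H = Some u ->
  exists X' x' Y', [/\ u = X' ++ x' :: Y', letter_of x' = letter_of x
    & run (X ++ Y) (del_strand (size X) H) = Some (X' ++ Y')].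
Proof.
move=> la; elim: H X Y => [|[p c] H IH] X Y.
  by move=> _ [<-]; exists X, x, Y.
rewrite inert_cons => hi r; have [w' s r'] := run_cons r.
have [[/negbTE e1 /negbTE e2 [X1 [Y1 [ew sX s1]]]]|[e1 _ h]|[e1 _ h]] := sweep_inert la s.
- rewrite e1 e2 -sX /= in hi; rewrite ew in r'.
  have [X' [x' [Y' [-> lx rd]]]] := IH _ _ hi r'.
  by exists X', x', Y'; rewrite /= e1 e2 /= s1 -sX.
- rewrite e1 eqxx /= in hi; have [X1 [Y1 [ew sX eXY]]] := h (eqP hi).
  rewrite ew in r'; have [X' [Y' [-> rd]]] := run_del_dead (dead_kill la) r'.
  by exists X', (kill x), Y'; rewrite letter_kill /= e1 eqxx -eXY -e1 -sX.
- rewrite e1 eqxx orbT /= in hi; have [X1 [Y1 [ew sX eXY]]] := h (eqP hi).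
  rewrite ew in r'; have [X' [Y' [-> rd]]] := run_del_dead (dead_kill la) r'.
  exists X', (kill x), Y'; rewrite letter_kill /= e1 eqxx -eXY.
  by case: eqP => [ep|_]; [lia | rewrite -sX].
Qed.

Lemma del_cons z p c H H' : p != z -> p.+1 != z ->
  heq (del_strand z H) (del_strand z H') -> heq (del_strand z ((p, c) :: H)) (del_strand z ((p, c) :: H')).
Proof. by move=> /negbTE e1 /negbTE e2 h /=; rewrite e1 e2; apply: heq_cons. Qed.

Lemma heq_swap_far p c p' c' K : (p'.+1 < p) || (p.+1 < p') ->
  heq ((p, c) :: (p', c') :: K) ((p', c') :: (p, c) :: K).
Proof. by case/orP=> h; [apply/heq_sym/heq_swap | apply: heq_swap]. Qed.

Lemma del_swap_far z p c p' c' K : (p'.+1 < p) || (p.+1 < p') ->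
  heq (del_strand z ((p, c) :: (p', c') :: K)) (del_strand z ((p', c') :: (p, c) :: K)).
Proof. by case/orP=> h; [apply/heq_sym/del_swap | apply: del_swap]. Qed.

Lemma eqn_near k :
  ((k == k.+1) = false) * ((k == k.+2) = false) * ((k.+1 == k.+2) = false) *
  ((k.+1 == k) = false) * ((k.+2 == k) = false) * ((k.+1 < k) = false) *
  (k < k.+2) * (k < k.+1).
Proof. by do !split; lia. Qed.

Lemma braid_beta m c :
  (m, (c, Some Cbeta, None)) \in braid_table -> m = (Some Cbeta, None, c).
Proof.
have : all (fun e => (e.2.1.2 == Some Cbeta) && (e.2.2 == None) ==>
  (e.1 == (Some Cbeta, None, e.2.1.1))) braid_table by [].
by move=> /allP h /h /= /eqP.
Qed.

Lemma braid_alpha m c :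
  ((c, Some Calpha, None), m) \in braid_table -> m = (Some Calpha, None, c).
Proof.
have : all (fun e => (e.1.1.2 == Some Calpha) && (e.1.2 == None) ==>
  (e.2 == (Some Calpha, None, e.1.1.1))) braid_table by [].
by move=> /allP h /h /= /eqP.
Qed.

(** If the first crossing of a strand is by its killer in one history, then so
    it is in all equivalent histories which start with a crossing of this
    strand: writing b for the killing symbol, only the entries (c, b, -) <->
    (b, -, c) of the table, or their mirror images, can apply when its first
    crossing is overlapped. *)
Lemma pull_inert X x Y H u p : letter_of x != La -> inert x (size X) H ->
  run (X ++ x :: Y) H = Some u -> final u -> corner p (X ++ x :: Y) ->
  (p == size X) || (p.+1 == size X) ->
  exists K, heq H ((p, killer x) :: K) /\
    heq (del_strand (size X) ((p, killer x) :: K)) (del_strand (size X) H).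
Proof.
have [dx la hi r fu cp tp|ndx la] := boolP (dead x).
  have [c [K hK]] := pull_corner r fu cp; have rK := r; rewrite (heq_run hK) in rK.
  have [w' s _] := run_cons rK; have [X1 [Y1 [_ _ h2 h3]]] := sweep_dead dx s.
  have -> : killer x = c.
    have -> : killer x = None by case: x dx {la hi r cp rK s h2 h3}.
    by case/orP: tp => /eqP e; [case: (h2 e) | case: (h3 e)] => ->.
  by exists K; split=> //; apply/heq_sym/(heq_del dx hK r).
elim: H X Y => [|[p0 c] H IH] X Y.
  by move=> _ [<-] /(_ p) ->.
rewrite inert_cons => hi r fu cp tp; have [w' s r'] := run_cons r.
have [_ cp0 _] := sweep_rk s.
have rkx : rank_at (X ++ x :: Y) (size X) = rank x by rewrite /rank_at nth_cat ltnn subnn.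
have rx1 : rank x <> 1 by clear -la; case: x la.
have rx02 : rank x = 0 \/ rank x = 2 by have := rank_le x; lia.
have [ep|np] := eqVneq p0 p.
  subst p0; move: hi; rewrite tp => /eqP ec; subst c.
  by exists H; split; apply: heq_refl.
have nt : (p0 != size X) && (p0.+1 != size X).
  rewrite -negb_or; apply/negP => tp0.
  case/andP: cp => _ h1; case/andP: cp0 => _ h2.
  case/orP: tp => /eqP ep; case/orP: tp0 => /eqP ep0; try lia.
    by have := rank_at_le (X ++ x :: Y) p0; rewrite ep rkx in h1; rewrite ep0 rkx in h2; lia.
  by have := rank_at_le (X ++ x :: Y) p; rewrite ep rkx in h1; rewrite ep0 rkx in h2; lia.
have [n1 n2] := andP nt.
have [[_ _ [X1 [Y1 [ew sX _]]]]|[e1]|[e1]] := sweep_inert la s; try by rewrite e1 eqxx ?andbF in nt.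
rewrite (negbTE n1) (negbTE n2) /= -sX in hi; rewrite ew in r'.
have tp1 : (p == size X1) || (p.+1 == size X1) by rewrite sX.
have [far|nfar] := boolP ((p0.+1 < p) || (p.+1 < p0)).
  have cp1 : corner p (X1 ++ x :: Y1) by rewrite -ew; apply: corner_far s far cp.
  have [K [hK dK]] := IH _ _ hi r' fu cp1 tp1; rewrite sX in dK.
  exists ((p0, c) :: K); split.
    by apply: heq_trans (heq_cons _ hK) (heq_swap_far _ _ _ _); rewrite orbC.
  apply: heq_trans (del_swap_far _ _ _ _ far) _; exact: del_cons.
have [ep|np'] := eqVneq p0 p.+1.
- have [cp1 next] : corner p w' /\ forall c' w'', sweep w' p c' = Some w'' -> corner p.+1 w''.
    by subst p0; apply: corner_overlap s.
  rewrite ew in cp1; have [K [hK dK]] := IH _ _ hi r' fu cp1 tp1.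
  have epz : p = size X by case/orP: tp => /eqP // e; move: n1; rewrite ep e eqxx.
  have rK := r'; rewrite (heq_run hK) in rK; have [w2 s2 r2] := run_cons rK.
  have := next _ _ _; rewrite ew => /(_ _ _ s2) cp2.
  have [[e _]|[_ lD /(_ erefl) [X2 [Y2 [ew2 sX2 _]]]]|[e]] := sweep_inert la s2.
  + by rewrite sX epz eqxx in e.
  + rewrite ew2 in r2 cp2.
    have [c2 [K2 hK2]] := pull_corner r2 fu cp2.
    have rK2 := r2; rewrite (heq_run hK2) in rK2; have [w3 s3 r3] := run_cons rK2.
    have [X3 [Y3 [_ _ h3 _]]] := sweep_dead (dead_kill la) s3.
    have [ec2 sX3 _ _] := h3 (esym sX2); subst c2.
    have r4 : run (X ++ x :: Y) [:: (p.+1, c); (p, killer x); (p.+1, None)] = Some w3.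
      by rewrite /= -ep s /= ew s2 /= ew2 ep s3.
    have [b1 [b2 [b3 hb]]] := braid_exists' r4.
    have ek : killer x = Some Cbeta by clear -lD ndx; case: x lD ndx.
    rewrite ek in hb; have [eb1 eb2 eb3] := braid_beta hb; subst b1 b2 b3.
    exists ((p.+1, None) :: (p, c) :: K2); split.
      rewrite ep; apply: heq_trans (heq_cons _ (heq_trans hK (heq_cons _ hK2))) _.
      by rewrite ek; apply/heq_sym/heq_braid.
    have e5 : heq (del_strand (size X) ((p, killer x) :: K)) (del_strand p.+2 K2).
      rewrite /= -epz eqxx -sX2; apply: heq_trans (heq_del (dead_kill la) hK2 r2) _.
      by rewrite sX2 /= eqxx; apply: heq_refl.
    have e6 : heq ((p, c) :: del_strand p.+2 K2) ((p, c) :: del_strand (size X) H).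
      by apply/heq_cons/(heq_trans (heq_sym e5)); rewrite -sX in dK *.
    move: e6; rewrite /= -epz eqxx /= ep eqxx.
    by rewrite !eqn_near.
  + by rewrite sX -epz in e; lia.
have ep : p = p0.+1 by lia.
have [cp1 next] : corner p w' /\ forall c' w'', sweep w' p c' = Some w'' -> corner p0 w''.
  by subst p; apply: corner_overlap' s.
rewrite ew in cp1; have [K [hK dK]] := IH _ _ hi r' fu cp1 tp1.
have epz : p.+1 = size X by case/orP: tp => /eqP // e; move: n2; rewrite -ep e eqxx.
have rK := r'; rewrite (heq_run hK) in rK; have [w2 s2 r2] := run_cons rK.
have := next _ _ _; rewrite ew => /(_ _ _ s2) cp2.
have [[_ e _]|[e]|[_ lE /(_ erefl) [X2 [Y2 [ew2 sX2 _]]]]] := sweep_inert la s2.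
+ by rewrite sX epz eqxx in e.
+ by rewrite sX -epz in e; lia.
rewrite ew2 in r2 cp2.
have [c2 [K2 hK2]] := pull_corner r2 fu cp2.
have rK2 := r2; rewrite (heq_run hK2) in rK2; have [w3 s3 r3] := run_cons rK2.
have [X3 [Y3 [_ _ _ h3]]] := sweep_dead (dead_kill la) s3.
have [ec2 sX3 _ _] : [/\ c2 = None, size X3 = p0, X3 ++ Y3 = X2 ++ Y2 & letter_of (kill x) = Le].
  by apply: h3; rewrite sX2.
subst c2.
have r4 : run (X ++ x :: Y) [:: (p0, c); (p0.+1, killer x); (p0, None)] = Some w3.
  by rewrite /= s /= ew -ep s2 /= ew2 s3 .
have [b1 [b2 [b3 hb]]] := braid_exists r4.
have ek : killer x = Some Calpha by clear -lE ndx; case: x lE ndx.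
rewrite ek in hb; have [eb1 eb2 eb3] := braid_alpha hb; subst b1 b2 b3.
exists ((p0, None) :: (p, c) :: K2); split.
  apply: heq_trans (heq_cons _ (heq_trans hK (heq_cons _ hK2))) _.
  by rewrite ek; rewrite ep; apply: heq_braid.
have e5 : heq (del_strand (size X) ((p, killer x) :: K)) (del_strand p0 K2).
  rewrite /= -epz eqxx; rewrite eqn_near.
  rewrite -sX2; apply: heq_trans (heq_del (dead_kill la) hK2 r2) _.
  rewrite sX2 ep /= eqxx; rewrite eqn_near.
  exact: heq_refl.
have e6 : heq ((p0, c) :: del_strand p0 K2) ((p0, c) :: del_strand (size X) H).
  by apply/heq_cons/(heq_trans (heq_sym e5)); rewrite -sX in dK *.
move: e6; rewrite /= -epz ep eqxx /=.
by rewrite ?eqn_near /= ?eqxx ?eqn_near /= ?eqxx ?eqn_near.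
Qed.

Lemma run_untouched X x y Y H u : first_touch (size X) H = None ->
  run (X ++ x :: Y) H = Some u ->
  exists X' Y', u = X' ++ x :: Y' /\ run (X ++ y :: Y) H = Some (X' ++ y :: Y').
Proof.
elim: H X Y => [|[p c] H IH] X Y /=; first by move=> _ [<-]; exists X, Y.
case: ifP => // /norP[n1 n2] hf; case E: sweep => [w'|] //= r.
have [[hp [X' [e sX ew]]]|[hp]|[hp]|[hp [Y' [e ew]]]] := sweep_marked E;
  try by rewrite hp eqxx in n1 n2.
  rewrite ew in r; rewrite -sX in hf; have [X2 [Y2 [-> h]]] := IH _ _ hf r.
  by exists X2, Y2; rewrite sweep_catr // e.
rewrite ew in r; have [X2 [Y2 [-> h]]] := IH _ _ hf r.
exists X2, Y2; split=> //.
have ep : p = size (rcons X y) + (p - (size X).+1) by rewrite size_rcons subnKC.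
by rewrite -(cat_rcons y X Y) {1}ep sweep_catl e /= cat_rcons.
Qed.

(** A d followed by no letter, or an e preceded by none, makes no corner and
    keeps this property. *)
Lemma untouched_d X x H u : letter_of x = Ld -> run (X ++ [:: x]) H = Some u ->
  first_touch (size X) H = None.
Proof.
move=> lx; elim: H X => [|[p c] H IH] X //= r.
move: r; case E: sweep => [w'|] //= r.
have la : letter_of x != La by rewrite lx.
have [hp cp _] := sweep_rk E.
have [[hp' [X' [e sX ew]]]|[_ [X0 [y [x' [y' [_ e _]]]]]]|[_ [y [Y0 [? [? []]]]]]|[hp' [Y' []]]] := sweep_marked E => //.
- by rewrite (_ : _ || _ = false); [rewrite -sX; apply: IH; rewrite -ew | lia].
- by have [/= h _ _] := cross_rank e; move: h; rewrite /rank lx; have := rank_le y; rewrite /rank /=; lia.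
- by case: (p - _).
Qed.

Lemma untouched_e x Y H u : letter_of x = Le -> run (x :: Y) H = Some u ->
  first_touch 0 H = None.
Proof.
move=> lx; elim: H Y => [|[p c] H IH] Y //= r.
move: r; case E: sweep => [w'|] //= r.
have [[hp' _]|[hp' _]|[hp' [y [Y0 [? [? [_ e _]]]]]]|[hp' [Y' [e ew]]]] := @sweep_marked [::] x Y p c w' E => //.
- by have [/= h _ _] := cross_rank e; move: h; rewrite /rank lx.
- by rewrite (_ : _ || _ = false); [rewrite ew in r; apply: IH r | move: hp' => /=; lia].
Qed.

(** The strand [x] between [X] and [Y] is placed where a strip can be inserted:
    the next letter (or the previous one, for an e) is not the same as its own. *)
Definition exposed (X : seq strand) (x : strand) (Y : seq strand) : bool :=
  match letter_of x with
  | Ld => if Y is y :: _ then letter_of y != Ld else true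
  | Le => if rev X is y :: _ then letter_of y != Le else true
  | La => false
  end.

Lemma exposed_letter X x Y : exposed X x Y -> letter_of x != La.
Proof. by rewrite /exposed; case: letter_of. Qed.

Lemma exposed_cases X x Y : exposed X x Y ->
  (forall H u, run (X ++ x :: Y) H = Some u -> first_touch (size X) H = None) \/
  exists2 p, corner p (X ++ x :: Y) & (p == size X) || (p.+1 == size X).
Proof.
rewrite /exposed; case lx: letter_of => // ex.
- case: Y ex => [|y Y] ex; first by left=> H u; apply: untouched_d lx.
  right; exists (size X); last by rewrite eqxx.
  by rewrite corner_cat /rank lx; case: letter_of ex.
- case/lastP: X ex => [|X y] ex; first by left=> H u; apply: untouched_e lx.
  rewrite rev_rcons in ex; right; exists (size X); last by rewrite size_rcons eqxx orbT.
  by rewrite cat_rcons corner_cat /rank lx; case: letter_of ex.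
Qed.

(** [heq_del] and [heq_of_del] extend to strands which die at once. *)
Lemma heq_del_inert X x Y H H' u u' : exposed X x Y ->
  inert x (size X) H -> inert x (size X) H' ->
  run (X ++ x :: Y) H = Some u -> final u ->
  run (X ++ x :: Y) H' = Some u' -> final u' ->
  heq (del_strand (size X) H) (del_strand (size X) H') <-> heq H H'.
Proof.
move=> ex hi hi' r fu r' fu'; have la := exposed_letter ex.
have [t|[p cp tp]] := exposed_cases ex.
  have [X1 [Y1 [eu r1]]] := run_untouched (kill x) (t _ _ r) r.
  have [X2 [Y2 [eu' r2]]] := run_untouched (kill x) (t _ _ r') r'.
  have fk X0 Y0 : final (X0 ++ x :: Y0) -> final (X0 ++ kill x :: Y0).
    by move=> /finalP h; apply/finalP; move: h; rewrite !map_cat /= /rank letter_kill.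
  split=> [hd|h]; last exact: heq_del (dead_kill la) h r1.
  apply: (heq_of_del (dead_kill la) r1 _ r2 _ hd); apply: fk; by rewrite -?eu -?eu'.
have [K [hK dK]] := pull_inert la hi r fu cp tp.
have [K' [hK' dK']] := pull_inert la hi' r' fu' cp tp.
have rK := r; rewrite (heq_run hK) in rK; have rK' := r'; rewrite (heq_run hK') in rK'.
have [w1 s1 r1] := run_cons rK; have [w2 s2 r2] := run_cons rK'.
rewrite s1 in s2; case: s2 => e; subst w2.
have eH : heq K K' <-> heq H H'.
  split=> h.
    by apply: heq_trans hK _; apply: heq_trans _ (heq_sym hK'); apply: heq_cons.
  have h1 := heq_trans (heq_sym hK) (heq_trans h hK').
  by have [] := heq_cancel h1 rK fu.
suff e : heq (del_strand (size X) ((p, killer x) :: K)) (del_strand (size X) ((p, killer x) :: K')) <-> heq K K'.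
  split=> h.
    by apply/eH/e; apply: heq_trans dK (heq_trans h (heq_sym dK')).
  by apply: heq_trans (heq_sym dK) (heq_trans _ dK'); apply/e/eH.
have [[/negbTE n1 /negbTE n2 _]|[e1 _ /(_ erefl) [X1 [Y1 [ew sX _]]]]|[e1 _ /(_ erefl) [X1 [Y1 [ew sX _]]]]] := sweep_inert la s1.
- by rewrite n1 n2 in tp.
- rewrite ew in r1 r2; rewrite /= -e1 eqxx -sX; split=> h; last exact: heq_del (dead_kill la) h r1.
  exact: heq_of_del (dead_kill la) r1 fu r2 fu' h.
- have ne : (p == size X) = false by clear -e1; lia.
  rewrite ew in r1 r2; rewrite /= ne e1 eqxx -sX; split=> h; last exact: heq_del (dead_kill la) h r1.
  exact: heq_of_del (dead_kill la) r1 fu r2 fu' h.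
Qed.

(** * The tilings swept by histories *)

(** Tiles with unbounded coordinates, so that tilings of all sizes share a type. *)
Notation ltile := (kind * vertex)%type.

Definition has_letter (l : letter) (x : ltile) : bool := (l == kindB x.1) || (l == kindC x.1).
Definition se_of (l : letter) (x : ltile) : edge :=
  (if l == kindB x.1 then x.2 else step x.2 (kindB x.1), l).
Definition nw_of (l : letter) (x : ltile) : edge :=
  (if l == kindC x.1 then x.2 else step x.2 (kindC x.1), l).
Definition se_list (x : ltile) : seq edge := [:: se_of (kindB x.1) x; se_of (kindC x.1) x].
Definition nw_list (x : ltile) : seq edge := [:: nw_of (kindC x.1) x; nw_of (kindB x.1) x].

Definition tiled (W : seq letter) (L : seq ltile) : bool :=
  perm_eq (P1 W ++ flatten (map nw_list L)) (P2 W ++ flatten (map se_list L)).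

Definition sorted_word (W : seq letter) : seq letter :=
  nseq (count_mem Le W) Le ++ nseq (count_mem La W) La ++ nseq (count_mem Ld W) Ld.

Lemma is_tilingE n W (T : {set tile n}) : is_tiling W T = tiled W [seq loc t | t <- enum T].
Proof. by rewrite /is_tiling /tiled -!map_comp. Qed.

Lemma vertex_ofE X l : vertex_of X l = count_mem l X. Proof. by rewrite ffunE. Qed.

Lemma step_vertex X l : step (vertex_of X) l = vertex_of (rcons X l).
Proof. by apply/ffunP => m; rewrite !ffunE -cats1 count_cat /= addn0 eq_sym. Qed.

Lemma stepE (v : vertex) l m : step v l m = v m + (m == l). Proof. by rewrite ffunE. Qed.

Lemma eq_vertex_of X X' : perm_eq X X' -> vertex_of X = vertex_of X'.
Proof. by move=> /permP h; apply/ffunP => l; rewrite !ffunE h. Qed.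

Lemma path_edges_cat U X Y :
  path_edges (vertex_of U) (X ++ Y) =
  path_edges (vertex_of U) X ++ path_edges (vertex_of (U ++ X)) Y.
Proof.
elim: X U => [|l X IH] U /=; first by rewrite cats0.
by rewrite step_vertex IH cat_rcons.
Qed.

Lemma P1_cat X Y : P1 (X ++ Y) = P1 X ++ path_edges (vertex_of X) Y.
Proof. exact: path_edges_cat. Qed.

Lemma P1P W (e : edge) : reflect (exists X Y, W = X ++ e.2 :: Y /\ e.1 = vertex_of X) (e \in P1 W).
Proof.
case: e => v m; apply: (iffP idP) => /= [|[X [Y [-> ->]]]]; last first.
  by rewrite P1_cat mem_cat /= inE eqxx orbT.
elim/last_ind: W => // W l IH; rewrite -cats1 P1_cat mem_cat /= inE => /orP[/IH|/eqP[-> ->]].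
  by case=> X [Y [-> e1]]; exists X, (Y ++ [:: l]); rewrite -catA.
by exists W, [::].
Qed.

Lemma count_sorted_word l W : count_mem l (sorted_word W) = count_mem l W.
Proof. by rewrite /sorted_word !count_cat !count_nseq; case: l => /=; lia. Qed.

Lemma perm_sorted_word W : perm_eq W (sorted_word W).
Proof. by apply/allP => l _ /=; rewrite count_sorted_word. Qed.

Lemma P2E W : P2 W = P1 (sorted_word W). Proof. by []. Qed.

Lemma eq_sorted_word W W' : perm_eq W W' -> sorted_word W = sorted_word W'.
Proof. by move=> /permP h; rewrite /sorted_word !h. Qed.

Lemma lrank_inj : injective lrank. Proof. by case=> [] []. Qed.

Lemma sorted_sorted_word W : sorted leq (map lrank (sorted_word W)).
Proof.
rewrite /sorted_word; set i := count_mem _ _; set j := count_mem _ _; set k := count_mem _ _.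
have hk : sorted leq (map lrank (nseq k Ld)) by elim: {i j} k => [|[|k] IH] //=.
have hj : path leq 1 (map lrank (nseq j La ++ nseq k Ld)).
  by elim: {i} j => [|j IH] //=; case: k hk => //= k ->.
have hi : path leq 0 (map lrank (nseq i Le ++ nseq j La ++ nseq k Ld)).
  by elim: i => [|i IH] //=; case: (map _ _) hj => //= x s /andP[_ ->].
by case: (map _ _) hi => //= x s /andP[].
Qed.

Lemma sorted_wordE W : sorted leq (map lrank W) -> W = sorted_word W.
Proof.
move=> h; apply: (inj_map lrank_inj); apply: (sorted_eq leq_trans anti_leq) => //.
  exact: sorted_sorted_word.
exact/perm_map/perm_sorted_word.
Qed.

Lemma final_sorted w : final w -> map letter_of w = sorted_word (map letter_of w).
Proof. by move=> /finalP h; apply: sorted_wordE; rewrite -map_comp. Qed.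

Lemma kind_ofP B C K : kind_of B C = Some K -> kindB K = B /\ kindC K = C.
Proof. by case: B; case: C => //= -[<-]. Qed.

(** Sweeping a tile at a corner of the southeast boundary cancels its four edges
    in the sum of the boundaries of the tiles. *)
Lemma tiled_corner X B C Y K L : kind_of B C = Some K ->
  tiled (X ++ B :: C :: Y) ((K, vertex_of X) :: L) = tiled (X ++ C :: B :: Y) L.
Proof.
move=> /kind_ofP[eB eC]; rewrite /tiled !P2E.
have nBC : (C == B) = false by move: eB eC; case: K => <- <-.
have pXY : perm_eq (X ++ C :: B :: Y) (X ++ B :: C :: Y).
  by rewrite perm_cat2l -(cat1s C) -(cat1s B) perm_catCA.
rewrite (eq_sorted_word pXY) !P1_cat /= /nw_of /se_of /= eB eC !eqxx nBC (eq_sym B) nBC.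
rewrite !step_vertex (@eq_vertex_of (rcons (rcons X B) C) (rcons (rcons X C) B)); last first.
  by apply/permP => a; rewrite -!cats1 !count_cat /=; lia.
by apply/permP/permP => h a; move: (h a); rewrite !count_cat /= ?count_cat /=; lia.
Qed.

Definition tile_at (w : seq strand) (p : nat) : ltile :=
  (odflt DE (kind_of (letter_of (nth LiveA w p)) (letter_of (nth LiveA w p.+1))),
   vertex_of (take p (map letter_of w))).

(** The contents do not distinguish the empty tiles with a q from the others;
    these are recovered from the strands. *)
Fixpoint tiles (w : seq strand) (H : history) : seq (ltile * content) :=
  if H is (p, c) :: K then
    (tile_at w p, odflt Cempty c) :: tiles (odflt w (sweep w p c)) K
  else [::].

Lemma kind_of_rank x y : rank y < rank x -> exists K, kind_of (letter_of x) (letter_of y) = Some K.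
Proof. by case: x; case: y => //= _; eexists. Qed.

Lemma tile_at_cat X x y Y K : kind_of (letter_of x) (letter_of y) = Some K ->
  tile_at (X ++ x :: y :: Y) (size X) = (K, vertex_of (map letter_of X)).
Proof.
move=> e; rewrite /tile_at !nth_cat ltnn subnn ltnNge leqnSn /= subSnn /= e /=.
by rewrite map_cat take_size_cat ?size_map.
Qed.

Lemma tiles_tiled w H u : run w H = Some u -> final u ->
  tiled (map letter_of w) (map fst (tiles w H)).
Proof.
move=> + fu; elim: H w => [|[p c] H IH] w /=.
  by move=> [->]; rewrite /tiled P2E {1}final_sorted.
case E: sweep => [w'|] //= r; have := IH _ r.
have [X [x [y [Y [x' [y' [-> <- hc ->]]]]]]] := sweepP E.
have [lt /= ly lx] := cross_rank hc; have [K hK] := kind_of_rank lt.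
by rewrite (tile_at_cat _ _ hK) !map_cat /= ly lx tiled_corner.
Qed.

Lemma mem_se L (e : edge) : reflect (exists2 x, x \in L & has_letter e.2 x /\ e = se_of e.2 x)
  (e \in flatten (map se_list L)).
Proof.
apply: (iffP flatten_mapP) => [[x xL]|[x xL [hx ->]]].
  by rewrite !inE => /orP[]/eqP ->; exists x => //=; rewrite /has_letter eqxx ?orbT.
by exists x => //=; case/orP: hx => /eqP h; rewrite !inE -h eqxx ?orbT.
Qed.

Lemma mem_nw L (e : edge) : reflect (exists2 x, x \in L & has_letter e.2 x /\ e = nw_of e.2 x)
  (e \in flatten (map nw_list L)).
Proof.
apply: (iffP flatten_mapP) => [[x xL]|[x xL [hx ->]]].
  by rewrite !inE => /orP[]/eqP ->; exists x => //=; rewrite /has_letter eqxx ?orbT.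
by exists x => //=; case/orP: hx => /eqP h; rewrite !inE -h eqxx ?orbT.
Qed.

Lemma tiled_back W L x l : tiled W L -> x \in L -> has_letter l x ->
  se_of l x \in P1 W \/ exists2 y, y \in L & has_letter l y /\ nw_of l y = se_of l x.
Proof.
move=> /perm_mem h xL hx; have := h (se_of l x); rewrite !mem_cat.
have -> : se_of l x \in flatten (map se_list L) by apply/mem_se; exists x.
rewrite orbT => /orP[|/mem_nw[y yL [hy e]]]; [by left|right].
by exists y => //; split=> //; rewrite e.
Qed.

Definition bound (L : seq ltile) : nat := (\max_(x <- L) (x.2 Ld + x.2 La + x.2 Le)).+1.

(** Crossing edges of the tiles towards the southeast never leads back.  The
    first component below decreases unless an a is met, and the second one settles
    the steps at a constant first component: from ae tiles through at most one de
    tile to da tiles. *)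
Definition depth (B : nat) (x : ltile) : nat :=
  (B + x.2 Le - x.2 Ld) * (4 * B) +
  match x.1 with AE => 3 * B - x.2 La | DE => 2 * B | DA => x.2 La end.

Lemma bound_mem (L : seq ltile) x : x \in L -> x.2 Ld + x.2 La + x.2 Le < bound L.
Proof. by move=> xL; rewrite ltnS; apply: (leq_bigmax_seq _ xL). Qed.

Lemma depth_back (L : seq ltile) x y l : x \in L -> y \in L -> has_letter l x -> has_letter l y ->
  nw_of l y = se_of l x -> depth (bound L) y < depth (bound L) x.
Proof.
move=> /bound_mem; move: (bound L) => B hx /bound_mem hy.
case: x hx => Kx vx /= hx; case: y hy => Ky vy /= hy.
rewrite /has_letter /nw_of /se_of /= => hlx hly [e]; move: e hlx hly.
case: l; case: Kx; case: Ky => //= /ffunP e _ _; move: (e Ld) (e La) (e Le); rewrite ?stepE /= => e1 e2 e3;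
  rewrite /depth /=; nia.
Qed.

Lemma has_argmin (T : eqType) (L : seq T) (f : T -> nat) : L != [::] ->
  exists2 x, x \in L & forall y, y \in L -> f x <= f y.
Proof.
elim: L => // x [_ _|z L IH _].
  by exists x; rewrite ?mem_head // => y; rewrite inE => /eqP ->.
have [//|y yL ym] := IH.
have [le|gt] := leqP (f x) (f y).
  exists x; rewrite ?mem_head // => t; rewrite inE => /orP[/eqP->//|/ym]; exact: leq_trans.
by exists y; rewrite 1?inE ?yL ?orbT // => t; rewrite inE => /orP[/eqP->|/ym//]; apply: ltnW.
Qed.

Lemma size_vertex X X' l : vertex_of X' = step (vertex_of X) l -> size X' = (size X).+1.
Proof.
rewrite step_vertex => /ffunP h; rewrite -(size_rcons X l).
suff sE (s : seq letter) : size s = vertex_of s Ld + vertex_of s La + vertex_of s Le by rewrite !sE !h.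
by rewrite !ffunE; elim: s => //= -[] s ->; rewrite /=; lia.
Qed.

(** A tile of least depth has both its southeast sides on the boundary, where
    they are consecutive. *)
Lemma corner_tile W L : tiled W L -> L != [::] ->
  exists X B C Y K, [/\ W = X ++ B :: C :: Y, kind_of B C = Some K
                      & (K, vertex_of X) \in L].
Proof.
move=> hT /(@has_argmin _ _ (depth (bound L)))[x xL xm].
have bd l : has_letter l x -> se_of l x \in P1 W.
  move=> hl; have [//|[y yL [hy e]]] := tiled_back hT xL hl.
  by have := depth_back xL yL hl hy e; rewrite ltnNge xm.
have /P1P[X [Y /= [eW eX]]] : se_of (kindB x.1) x \in P1 W by apply: bd; rewrite /has_letter eqxx.
have /P1P[X' [Y' /= [eW' eX']]] : se_of (kindC x.1) x \in P1 W by apply: bd; rewrite /has_letter eqxx orbT.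
have nBC : (kindC x.1 == kindB x.1) = false by case: (x.1).
rewrite eqxx in eX; rewrite nBC eX in eX'.
have sX := size_vertex (esym eX').
have eXX : X' = rcons X (kindB x.1).
  have := congr1 (take (size X)) (esym eW); have := congr1 (take (size X').-1.+1) eW'.
  rewrite eW -cat_rcons sX /= => h _; move: h.
  by rewrite -{1}(size_rcons X (kindB x.1)) take_size_cat // -sX take_size_cat.
exists X, (kindB x.1), (kindC x.1), Y', x.1; split.
- by rewrite eW' eXX cat_rcons.
- by case: (x.1).
- by rewrite -eX -surjective_pairing.
Qed.

Lemma tiled_nil W : tiled W [::] -> W = sorted_word W.
Proof.
rewrite /tiled !cats0 P2E => /perm_mem h.
suff : final (map live W).
  by move/final_sorted; rewrite -map_comp (@eq_map _ _ _ id) ?map_id //; case.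
move=> p; apply/negbTE/negP => /corner_split[X0 [x [y [Y0 [eW _ lt]]]]].
have {}eW : W = map letter_of X0 ++ letter_of x :: letter_of y :: map letter_of Y0.
  by rewrite -[LHS]map_id -(@eq_map _ _ (letter_of \o live)) ?map_comp ?eW ?map_cat //; case.
set X := map letter_of X0 in eW.
have i1 : (vertex_of X, letter_of x) \in P1 W by apply/P1P; exists X, (letter_of y :: map letter_of Y0).
have i2 : (vertex_of (rcons X (letter_of x)), letter_of y) \in P1 W.
  by apply/P1P; exists (rcons X (letter_of x)), (map letter_of Y0); rewrite cat_rcons.
rewrite !h in i1 i2; case/P1P: i1 => X1 [Y1 /= [e1 v1]]; case/P1P: i2 => X2 [Y2 /= [e2 v2]].
have sX : size X2 = (size X1).+1 by apply: (@size_vertex _ _ (letter_of x)); rewrite -v2 -v1 step_vertex.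
have := sorted_sorted_word W => /(sortedP 0) /(_ (size X1)).
rewrite size_map {1}e2 size_cat /= sX => /(_ _); rewrite addnS ltnS leq_addr => /(_ isT).
rewrite {1}e1 {1}e2 !map_cat !nth_cat !size_map ltnn subnn sX ltnn subnn /=.
by move: lt; rewrite /rank; lia.
Qed.

(** * Strips *)

(** [lchain l L x y]: going away from the boundary along the l-strip of [x], one
    reaches [y] through tiles of [L]. *)
Inductive lchain (l : letter) (L : seq ltile) (x : ltile) : ltile -> Prop :=
| lchain_refl : x \in L -> has_letter l x -> lchain l L x x
| lchain_next y z : lchain l L x y -> z \in L -> has_letter l z ->
    nw_of l y = se_of l z -> lchain l L x z.

Lemma lchain_mem l L x y : lchain l L x y ->
  [/\ x \in L, y \in L, has_letter l x & has_letter l y].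
Proof. by elim=> [|y' z _ [? ? ? ?]]. Qed.

Lemma lchain_sub l L L' x y : {subset L <= L'} -> lchain l L x y -> lchain l L' x y.
Proof.
move=> s; elim=> [xL hx|y' z _ IH zL hz e]; first by apply: lchain_refl => //; apply: s.
by apply: lchain_next IH _ hz e; apply: s.
Qed.

Lemma lchain_head l L x y z : x \in L -> has_letter l x -> nw_of l x = se_of l y ->
  lchain l L y z -> lchain l L x z.
Proof.
move=> xL hx e; elim=> [yL hy|y' t _ IH tL ht et]; last exact: lchain_next IH tL ht et.
exact: lchain_next (lchain_refl xL hx) yL hy e.
Qed.

(** Following a strip towards the southeast, the depth decreases until the
    boundary is reached. *)
Lemma back_chain W L x l : tiled W L -> x \in L -> has_letter l x ->
  exists2 x0, se_of l x0 \in P1 W & lchain l L x0 x.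
Proof.
move=> hT; move: {2}(depth _ x) (leqnn (depth (bound L) x)) => N.
elim: N x => [|N IH] x hN xL hx; have [h|[y yL [hy e]]] := tiled_back hT xL hx;
  try by exists x => //; apply: lchain_refl.
- by have := depth_back xL yL hx hy e; lia.
have lt : depth (bound L) y <= N by have := depth_back xL yL hx hy e; lia.
have [x0 h0 c0] := IH y lt yL hy; exists x0 => //.
exact: lchain_next c0 xL hx e.
Qed.

(** [v] lies on the far side of [u], seen from the boundary along an l-strip. *)
Definition ahead (l : letter) (u v : vertex) : bool :=
  (u l == v l) && match l with
  | Ld => (u La <= v La) && (u Le <= v Le)
  | La => (v Ld <= u Ld) && (u Le <= v Le)
  | Le => (v Ld <= u Ld) && (v La <= u La)
  end.

Lemma ahead_refl l v : ahead l v v. Proof. by rewrite /ahead eqxx; case: l; rewrite !leqnn. Qed.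

Lemma ahead_trans l u v w : ahead l u v -> ahead l v w -> ahead l u w.
Proof. by rewrite /ahead; case: l => /andP[/eqP -> h1] /andP[/eqP <- h2]; rewrite eqxx /=; lia. Qed.

Lemma ahead_tile l x : has_letter l x -> ahead l (se_of l x).1 (nw_of l x).1.
Proof.
case: x => [K v]; rewrite /has_letter /ahead /se_of /nw_of.
by case: l; case: K => //= _; rewrite !stepE /=; lia.
Qed.

Lemma lchain_ahead l L x y : lchain l L x y -> ahead l (se_of l x).1 (se_of l y).1.
Proof.
elim=> [_ _|y' z c IH _ _ <-]; first exact: ahead_refl.
by apply: ahead_trans IH (ahead_tile _); case: (lchain_mem c).
Qed.

Lemma back_P1 W L x l : tiled W L -> x \in L -> has_letter l x ->
  exists X Y, W = X ++ l :: Y /\ ahead l (vertex_of X) (se_of l x).1.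
Proof.
move=> hT xL hx; have [x0 /P1P[X [Y [eW e]]] c] := back_chain hT xL hx.
by exists X, Y; split=> //; rewrite -e; apply: lchain_ahead c.
Qed.

Lemma split_count_inj (l : letter) X Y X' Y' : X ++ l :: Y = X' ++ l :: Y' ->
  count_mem l X = count_mem l X' -> X = X'.
Proof.
elim: X X' => [|m X IH] [|m' X'] //=; first by move=> [->]; rewrite eqxx.
  by move=> [<-]; rewrite eqxx.
by move=> [<- /IH h] /addnI /h ->.
Qed.

(** [beyond l y x]: [y] comes after [x] in the same l-strip, for l = d or e. *)
Definition beyond (l : letter) (y x : ltile) : bool :=
  [&& has_letter l x, has_letter l y, y.2 l == x.2 l &
    match l with
    | Ld => x.2 La + x.2 Le < y.2 La + y.2 Le
    | Le => y.2 Ld + y.2 La < x.2 Ld + x.2 La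
    | La => false
    end].

(** The strand of the strip which starts at the (i+1)-st l-edge of the
    boundary. *)
Definition status (l : letter) (i : nat) (w : seq strand) : strand :=
  nth (live l) [seq s <- w | letter_of s == l] i.

Definition symbol (l : letter) : content :=
  match l with Ld => Cbeta | La => Cempty | Le => Calpha end.

Definition in_lstrip (l : letter) (i : nat) (x : ltile) : bool :=
  has_letter l x && (x.2 l == i).

Lemma sweep_tile w p c w' : sweep w p c = Some w' ->
  exists X x y Y K, [/\ w = X ++ x :: y :: Y, p = size X,
    kind_of (letter_of x) (letter_of y) = Some K,
    tile_at w p = (K, vertex_of (map letter_of X))
  & exists x' y', [/\ cross x y c = Some (y', x'), w' = X ++ y' :: x' :: Y,
      letter_of x' = letter_of x & letter_of y' = letter_of y]].
Proof.
move=> /sweepP[X [x [y [Y [x' [y' [ew <- hc ew']]]]]]].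
have [lt /= ly lx] := cross_rank hc; have [K hK] := kind_of_rank lt.
exists X, x, y, Y, K; split=> //; first by rewrite ew (tile_at_cat _ _ hK).
by exists x', y'.
Qed.

Lemma count_letter_of l X : count_mem l (map letter_of X) = count (fun s => letter_of s == l) X.
Proof. by rewrite count_map; apply: eq_count => s /=. Qed.

Lemma status_cat X x y Y l i : letter_of x != letter_of y ->
  status l i (X ++ x :: y :: Y) =
  if i == count (fun s => letter_of s == l) X then
    if letter_of x == l then x else if letter_of y == l then y
    else nth (live l) [seq s <- Y | letter_of s == l] 0
  else if i < count (fun s => letter_of s == l) X then
    nth (live l) [seq s <- X | letter_of s == l] i
  else nth (live l) [seq s <- Y | letter_of s == l]
         (i - count (fun s => letter_of s == l) X - ((letter_of x == l) || (letter_of y == l))).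
Proof.
move=> ne; rewrite /status filter_cat nth_cat size_filter /=.
case: ltngtP => [lt|gt|->] //; last first.
  rewrite subnn; case: eqP => // ex; case: eqP => // ey; by rewrite -ex -ey eqxx in ne.
case: eqP => ex; case: eqP => ey /=.
- by rewrite ex ey eqxx in ne.
- by case e : (i - _) => [|k]; [lia|rewrite /= subn1].
- by case e : (i - _) => [|k]; [lia|rewrite /= subn1].
- by rewrite subn0.
Qed.

(** A crossing changes the strand of its own two strips only: a strand dies
    exactly when its symbol is put into the tile. *)
Lemma status_sweep w p c w' l i : sweep w p c = Some w' -> l != La ->
  dead (status l i w') =
  dead (status l i w) || (in_lstrip l i (tile_at w p) && (c == Some (symbol l))).
Proof.
move=> /sweep_tile[X [x [y [Y [K [ew _ hK -> [x' [y' [hc ew' lx ly]]]]]]]]] la.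
have [eB eC] := kind_ofP hK.
have ne : letter_of x != letter_of y by rewrite -eB -eC; case: (K).
have ne' : letter_of y' != letter_of x' by rewrite lx ly eq_sym.
rewrite ew ew' !status_cat // lx ly /in_lstrip /has_letter /= eB eC vertex_ofE count_letter_of.
rewrite [l == letter_of x]eq_sym [l == letter_of y]eq_sym [count _ X == i]eq_sym.
have [_|ni] := eqVneq i; last by rewrite !andbF /= orbF [(letter_of y == l) || _]orbC.
rewrite andbT.
have [ex|nx] := eqVneq (letter_of x) l.
  have -> : (letter_of y == l) = false by rewrite -ex eq_sym; apply/negbTE.
  by move: la hc; rewrite -ex; clear; case: x; case: y => //; case: c => [[]|] //= _ [_ <-].
have [ey|ny] := eqVneq (letter_of y) l; last by rewrite /= orbF.
by move: la hc; rewrite -ey; clear; case: x; case: y => //; case: c => [[]|] //= _ [<- _].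
Qed.

Lemma status_live l i W : dead (status l i (map live W)) = false.
Proof.
rewrite /status filter_map; set s := [seq x <- W | _].
have [lt|ge] := ltnP i (size s); last by rewrite nth_default ?size_map //; clear; case: l.
by rewrite (nth_map La) //; case: nth.
Qed.

(** The tiles swept after a crossing lie beyond its tile, in its two strips. *)
Lemma later_beyond w p c w' L l y : sweep w p c = Some w' ->
  tiled (map letter_of w') L -> y \in L -> l != La ->
  in_lstrip l ((tile_at w p).2 l) y -> has_letter l (tile_at w p) ->
  beyond l y (tile_at w p).
Proof.
move=> /sweep_tile[X [x [y0 [Y [K [ew _ hK -> [x' [y' [hc ew' lx ly]]]]]]]]] hT yL la.
have [eB eC] := kind_ofP hK => /andP[hy /eqP ey] hx /=.
rewrite /beyond hx hy /= ey eqxx /=.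
have [X1 [Y1 [eW ah]]] := back_P1 hT yL hy.
rewrite ew' map_cat /= lx ly in eW; set X0 := map letter_of X in eW hx ey *.
have eX1 : X1 = if l == kindB K then rcons X0 (letter_of y0) else X0.
  have ec : vertex_of X1 l = vertex_of X0 l.
    rewrite -ey; move: ah hy; rewrite /ahead /se_of /has_letter => /andP[/eqP -> _].
    by clear; case: y => [[] v]; case: l => //=; rewrite ?stepE ?addn0.
  rewrite !vertex_ofE in ec.
  move: hx; rewrite /has_letter /= -eB -eC in eW *; case: eqP => [el|/eqP ne /= /eqP el].
    rewrite -el -cat_rcons in eW *; move=> _; apply: split_count_inj (esym eW) _.
    by rewrite ec -cats1 count_cat /= el; case: (K) => /=; rewrite ?addn0.
  by rewrite -el in eW; apply: split_count_inj (esym eW) _.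
move: ah hy hx ey; rewrite eX1 -eC /ahead /se_of /has_letter.
clear -la; case: l la => //= _; case: K => //=; case: y => [[] v] //=; rewrite -?step_vertex ?stepE /=; lia.
Qed.

Lemma beyond_irr l x : beyond l x x = false.
Proof. by rewrite /beyond; case: l; rewrite ?ltnn !andbF. Qed.

Lemma beyond_asym l x y : beyond l x y -> beyond l y x -> False.
Proof. by rewrite /beyond; case: l => /and4P[_ _ _ h1] /and4P[_ _ _ h2]; lia. Qed.

Lemma beyondW l x y : beyond l x y -> in_lstrip l (y.2 l) x && has_letter l y.
Proof. by rewrite /beyond /in_lstrip => /and4P[-> -> -> _]. Qed.

(** As the tile at a corner is the first one of both of its strips, the
    relative positions of this tile and any other tile depend on the strips
    only. *)
Lemma beyond_later w p c w' L l y : sweep w p c = Some w' ->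
  tiled (map letter_of w') L -> y \in L ->
  (beyond l y (tile_at w p) = [&& l != La, in_lstrip l ((tile_at w p).2 l) y
                                 & has_letter l (tile_at w p)])
  * (beyond l (tile_at w p) y = false).
Proof.
move=> s hT yL; have [->|la] := eqVneq l La; first by rewrite /beyond !andbF.
split.
  apply/idP/idP => [/beyondW//|/and3P[_ h1 h2]]; exact: later_beyond s hT yL la h1 h2.
apply/negP => h; have /andP[h1 h2] := beyondW h.
apply: (beyond_asym h); apply: later_beyond s hT yL la _ _; last by case/andP: h1.
by rewrite /in_lstrip h2 eq_sym; case/andP: h1.
Qed.

(** The conditions on the contents of a tableau, for a path in which some
    strands are dead from the start. *)
Record well_filled (w : seq strand) (M : seq (ltile * content)) : Prop := WellFilled {
  wf_allowed : forall x, x \in M -> allowed x.1.1 x.2;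
  wf_beyond : forall l x y, x \in M -> y \in M -> l != La -> x.2 = symbol l ->
    beyond l y.1 x.1 -> y.2 = Cempty;
  wf_dead : forall l x, x \in M -> l != La -> has_letter l x.1 ->
    dead (status l (x.1.2 l) w) -> x.2 = Cempty }.

Lemma status_first X x y Y K l : kind_of (letter_of x) (letter_of y) = Some K ->
  has_letter l (K, vertex_of (map letter_of X)) ->
  status l (vertex_of (map letter_of X) l) (X ++ x :: y :: Y) = if l == kindB K then x else y.
Proof.
move=> hK; have [eB eC] := kind_ofP hK.
have ne : letter_of x != letter_of y by rewrite -eB -eC; case: (K).
rewrite status_cat // vertex_ofE count_letter_of eqxx /has_letter /= eB eC.
rewrite [l == letter_of x]eq_sym [l == letter_of y]eq_sym; case: eqP => //= _.
by case: eqP.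
Qed.

Lemma tiles_well_filled w H u : run w H = Some u -> final u -> well_filled w (tiles w H).
Proof.
move=> + fu; elim: H w => [|[p c] H IH] w /=; first by split.
case E: sweep => [w'|] //= r; have [h1 h2 h3] := IH _ r; have hT := tiles_tiled r fu.
have mT x : x \in tiles w' H -> x.1 \in map fst (tiles w' H) by apply: map_f.
have [X [x0 [y0 [Y [K [ew _ hK et [x' [y' [hc _ _ _]]]]]]]]] := sweep_tile E.
have cA : allowed K (odflt Cempty c).
  by clear -hK hc; case: x0 hK hc; case: y0 => //= -[<-]; case: c => [[]|].
split.
- by move=> x; rewrite inE => /orP[/eqP->|/h1//]; rewrite et.
- move=> l x y; rewrite !inE => /orP[/eqP->|xM] /orP[/eqP->|yM] la /=.
  + by rewrite beyond_irr.
  + move=> es /beyondW /andP[hs hl]; apply: (h3 l) => //; first by case/andP: hs.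
    rewrite (status_sweep _ E) //; case/andP: (hs) => hy /eqP ->.
    rewrite /in_lstrip hl eqxx /=; apply/orP; right.
    by clear -es la; case: c es => [c /= ->|] //; case: l la.
  + by rewrite (beyond_later _ E hT (mT _ xM)).2.
  + exact: h2.
- move=> l x; rewrite inE => /orP[/eqP->|xM] la.
    move: et; move: (tile_at w p) => t -> /= hl; rewrite ew (status_first Y hK hl).
    by case: ifP => _ hd; [case: (cross_dead_l hd hc) => -> | case: (cross_dead_r hd hc) => ->].
  by move=> hl hd; apply: (h3 l x) => //; rewrite (status_sweep _ E) // hd.
Qed.

(** * The histories of a filling *)

Lemma uniq_fst_inj (T S : eqType) (M : seq (T * S)) : uniq (map fst M) ->
  forall a c c', (a, c) \in M -> (a, c') \in M -> c = c'.
Proof.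
elim: M => // t M IH /= /andP[nt uM] a c c'.
rewrite !inE => /orP[/eqP ea|ha] /orP[/eqP eb|hb]; last exact: IH ha hb.
- by rewrite -ea in eb; case: eb.
- by case/mapP: nt; exists (a, c'); rewrite // -ea.
- by case/mapP: nt; exists (a, c); rewrite // -eb.
Qed.

Lemma tiled_perm W L L' : perm_eq L L' -> tiled W L = tiled W L'.
Proof.
move=> h; rewrite /tiled.
have h1 := perm_flatten (perm_map nw_list h); have h2 := perm_flatten (perm_map se_list h).
by rewrite (permPl (perm_cat (perm_refl _) h1)) (permPr (perm_cat (perm_refl _) h2)).
Qed.

Lemma well_filled_perm w M M' : perm_eq M M' -> well_filled w M -> well_filled w M'.
Proof.
move=> /perm_mem h [h1 h2 h3]; split.
- by move=> x; rewrite -h; apply: h1.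
- by move=> l x y; rewrite -!h; apply: h2.
- by move=> l x; rewrite -h; apply: h3.
Qed.

Lemma sorted_final w : map letter_of w = sorted_word (map letter_of w) -> final w.
Proof.
move=> e; apply/finalP; have := sorted_sorted_word (map letter_of w).
by rewrite -e -map_comp.
Qed.

Lemma map_cat_split (T S : Type) (f : T -> S) w X b c Y : map f w = X ++ b :: c :: Y ->
  exists X0 x y Y0, [/\ w = X0 ++ x :: y :: Y0, map f X0 = X, f x = b, f y = c & map f Y0 = Y].
Proof.
elim: X w => [|a X IH] [|z w] //=.
  by case: w => [|y w] //= [<- <- <-]; exists [::], z, y, w.
by case=> ez /IH [X0 [x [y [Y0 [-> <- <- <- <-]]]]]; exists (z :: X0), x, y, Y0; rewrite /= ez.
Qed.

Lemma sweep_tiled w p c w' M : sweep w p c = Some w' ->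
  tiled (map letter_of w) (tile_at w p :: M) = tiled (map letter_of w') M.
Proof.
move=> /sweep_tile[X [x [y [Y [K [-> _ hK -> [x' [y' [_ -> lx ly]]]]]]]]].
by rewrite !map_cat /= lx ly tiled_corner.
Qed.

(** Every filling of a tiling is swept by some history: remove a tile at a
    corner of the boundary, which exists by [corner_tile]; its label is
    determined by its content and by the two strands. *)
Lemma history_of w M : tiled (map letter_of w) (map fst M) -> well_filled w M ->
  exists H u, [/\ run w H = Some u, final u & perm_eq (tiles w H) M].
Proof.
move: {2}(size M) (erefl (size M)) => N; elim: N w M => [|N IH] w M sM hT hM.
  case: M sM hT {hM} => // _ /tiled_nil /sorted_final fw.
  by exists [::], w.
have /(corner_tile hT)[X [B [C [Y [K [eW hK]]]]]] : map fst M != [::] by case: M sM {hT hM}.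
case/mapP=> -[t0 c0] /= tM et; subst t0.
have [X0 [x [y [Y0 [ew eX ex ey eY]]]]] := map_cat_split eW.
rewrite -ex -ey in hK; have [eB eC] := kind_ofP hK.
have pM := perm_to_rem tM; set M' := rem _ M in pM.
have [h1 h2 h3] := well_filled_perm pM hM; rewrite (tiled_perm _ (perm_map fst pM)) in hT.
set c := if dead x || dead y then None else Some c0.
have et : tile_at w (size X0) = (K, vertex_of X) by rewrite ew (tile_at_cat _ _ hK) eX.
have e0 : odflt Cempty c = c0.
  rewrite /c; case: ifP => //= hd; apply/esym.
  have hl l : l = kindB K \/ l = kindC K -> has_letter l (K, vertex_of X).
    by rewrite /has_letter; case=> -> /=; rewrite eqxx ?orbT.
  have la l : l = kindB K \/ l = kindC K -> dead (if l == kindB K then x else y) -> l != La.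
    clear -eB eC; case=> -> ; rewrite ?eqxx ?eB ?eC; clear; first by case: x.
    by case: eqP => [->|_]; [case: x | case: y].
  have ht : (K, vertex_of X, c0) \in (K, vertex_of X, c0) :: M' by rewrite mem_head.
  have st l : has_letter l (K, vertex_of X) ->
      status l (vertex_of X l) w = if l == kindB K then x else y.
    by rewrite ew -eX; apply: status_first.
  case/orP: hd => hd.
    by apply: (h3 (kindB K) _ ht); rewrite ?st ?eqxx ?hl ?la ?eqxx //; left.
  have nBC : (kindC K == kindB K) = false by case: (K).
  by apply: (h3 (kindC K) _ ht); rewrite ?st ?nBC ?hl ?la ?nBC //; right.
have [[y' x'] hc] : exists s, cross x y c = Some s.
  have := h1 _ (mem_head _ _); move: e0; rewrite /c; clear -hK.
  by case: x hK; case: y => //= -[<-]; case: c0 => //= _ _; eexists.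
have s : sweep w (size X0) c = Some (X0 ++ y' :: x' :: Y0) by rewrite ew sweep_cat hc.
set w' := X0 ++ _ in s.
rewrite /= -et (sweep_tiled _ s) in hT.
have sM' : size M' = N by have := perm_size pM; rewrite sM => -[].
have [|H [u [r fu pH]]] := IH w' M' sM' hT.
  split.
  - by move=> z zM; apply: h1; rewrite inE zM orbT.
  - by move=> l z1 z2 z1M z2M; apply: h2; rewrite inE ?z1M ?z2M orbT.
  - move=> l z zM la hl; rewrite (status_sweep _ s) // => /orP[|/andP[hs /eqP ec]].
      by apply: h3 => //; rewrite inE zM orbT.
    case/andP: hs => ht /eqP ei.
    apply: (h2 l (K, vertex_of X, c0) z); rewrite ?mem_head ?inE ?zM ?orbT //.
      by rewrite -e0 ec.
    rewrite /= -et; apply: later_beyond s hT (map_f _ zM) la _ ht.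
    by rewrite /in_lstrip hl ei eqxx.
exists ((size X0, c) :: H), u; split=> //=; first by rewrite s.
by rewrite s /= et e0 (permPr pM) perm_cons.
Qed.

Definition carries_q (w : seq strand) (M : seq (ltile * content)) (x : ltile * content) : bool :=
  (x.2 == Cempty) && all (fun l => has_letter l x.1 ==>
     ~~ dead (status l (x.1.2 l) w) &&
     ~~ has (fun y => (y.2 == symbol l) && beyond l x.1 y.1) M) [:: Ld; Le].

Lemma carries_q_head w p c H u : run w ((p, c) :: H) = Some u -> final u ->
  carries_q w (tiles w ((p, c) :: H)) (tile_at w p, odflt Cempty c) = (c == Some Cempty).
Proof.
move=> r0 fu; have [w' E r] := run_cons r0; have hT := tiles_tiled r fu.
have mT x : x \in tiles w' H -> x.1 \in map fst (tiles w' H) by apply: map_f.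
rewrite /= E /=; set M := tiles w' H in hT mT *.
have [X [x0 [y0 [Y [K [ew _ hK et [x' [y' [hc _ _ _]]]]]]]]] := sweep_tile E.
have nh l : has (fun y => (y.2 == symbol l) && beyond l (tile_at w p) y.1)
              ((tile_at w p, odflt Cempty c) :: M) = false.
  apply/hasPn => y; rewrite inE => /orP[/eqP->|yM] /=; first by rewrite beyond_irr andbF.
  by rewrite (beyond_later _ E hT (mT _ yM)).2 andbF.
have hs l : has_letter l (K, vertex_of (map letter_of X)) ->
    status l (vertex_of (map letter_of X) l) w = if l == kindB K then x0 else y0.
  by rewrite ew; apply: status_first.
rewrite /carries_q; under eq_all => l do rewrite nh andbT.
rewrite et /= !andbT.
have := hs Ld; have := hs Le; rewrite /has_letter /=; clear -hK hc.
by case: x0 hK hc; case: y0 => //= -[<-]; case: c => [[]|] //= _; do ?[move=> /(_ isT) -> | move=> _].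
Qed.

(** The q's of a filling are the crossings of two live strands which leave both
    alive. *)
Lemma count_q w H u : run w H = Some u -> final u ->
  count (carries_q w (tiles w H)) (tiles w H) = count (fun s => s.2 == Some Cempty) H.
Proof.
move=> + fu; elim: H w => [|[p c] H IH] w // r0.
have := carries_q_head r0 fu; have [w' E r] := run_cons r0.
rewrite /= E /= => ->; have hT := tiles_tiled r fu; rewrite -(IH _ r).
have mT x : x \in tiles w' H -> x.1 \in map fst (tiles w' H) by apply: map_f.
set M := tiles w' H in hT mT *; congr (_ + _).
apply: eq_in_count => x xM; rewrite /carries_q; congr (_ && _).
have hx := mT _ xM; rewrite /= !andbT.
have hl l : l != La -> (has_letter l x.1 ==> ~~ dead (status l (x.1.2 l) w) && ~~
    (((odflt Cempty c == symbol l) && beyond l x.1 (tile_at w p))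
      || has (fun y => (y.2 == symbol l) && beyond l x.1 y.1) M)) =
   (has_letter l x.1 ==> ~~ dead (status l (x.1.2 l) w') && ~~
     has (fun y => (y.2 == symbol l) && beyond l x.1 y.1) M).
  move=> la; case hx1: has_letter => //=.
  rewrite (status_sweep _ E) // (beyond_later _ E hT hx).1 la /in_lstrip hx1 /=.
  rewrite [(tile_at w p).2 l == _]eq_sym [has_letter l _ && _]andbC.
  have -> : (c == Some (symbol l)) = (odflt Cempty c == symbol l) by clear -la; case: c => [c'|] //; case: l la.
  rewrite -[vertex_of (take p _) l]/((tile_at w p).2 l).
  by case: (dead _); case: (_ == symbol l); case: (_ == (tile_at w p).2 l); case: (has_letter l _); case: has.
by rewrite !hl.
Qed.

Lemma tile_notin_later w p c w' L : sweep w p c = Some w' ->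
  tiled (map letter_of w') L -> tile_at w p \notin L.
Proof.
move=> s hT; apply/negP => hL.
have [l la hl] : exists2 l, l != La & has_letter l (tile_at w p).
  by case: (tile_at w p) => [[] v]; [exists Ld | exists Ld | exists Le].
have := beyond_later l s hT hL; rewrite beyond_irr la hl /in_lstrip hl eqxx /=.
by case.
Qed.

Lemma uniq_tiles w H u : run w H = Some u -> final u -> uniq (map fst (tiles w H)).
Proof.
move=> + fu; elim: H w => [|[p c] H IH] w //=.
case E: sweep => [w'|] //= r; rewrite (IH _ r) andbT.
exact: tile_notin_later E (tiles_tiled r fu).
Qed.

Lemma tile_at_far p q c w w' : sweep w q c = Some w' ->
  (q.+1 < p) || (p.+1 < q) -> tile_at w' p = tile_at w p.
Proof.
move=> /sweepP[X [x [y [Y [x' [y' [-> sX /cross_rank[_ /= ly lx] ->]]]]]]] far.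
have nE k : k < q \/ q.+1 < k ->
    nth LiveA (X ++ y' :: x' :: Y) k = nth LiveA (X ++ x :: y :: Y) k.
  move=> hk; rewrite !nth_cat sX; case: ltnP => // h.
  by have [j ->] : exists j, k - q = j.+2 by exists (k - q - 2); lia.
rewrite /tile_at !nE; try lia; congr (_, _); apply: eq_vertex_of.
case/orP: far => far; last first.
  by rewrite !map_cat !take_cat size_map sX; case: ltnP => //; lia.
rewrite !map_cat !take_cat size_map sX.
have -> : (p < q) = false by lia.
have [j ->] : exists j, p - q = j.+2 by exists (p - q - 2); lia.
by rewrite /= lx ly perm_cat2l -(cat1s (letter_of y)) -(cat1s (letter_of x)) perm_catCA.
Qed.

Lemma tile_at_inj w p q : p <= size w -> q <= size w -> tile_at w p = tile_at w q -> p = q.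
Proof.
move=> hp hq [_ /ffunP h].
have sE (s : seq letter) : size s = vertex_of s Ld + vertex_of s La + vertex_of s Le.
  by rewrite !ffunE; elim: s => //= -[] s ->; rewrite /=; lia.
have := sE (take p (map letter_of w)); rewrite !h -sE !size_takel ?size_map //.
Qed.

Lemma overlap_letters q w : corner q w -> corner q.+1 w ->
  exists X x y z Y, [/\ w = X ++ [:: x, y, z & Y], size X = q,
    letter_of x = Ld, letter_of y = La & letter_of z = Le].
Proof.
case/corner_split=> X [x [y [Y [-> <- lt]]]]; case: Y => [|z Y].
  by rewrite /corner size_cat /=; case: ltnP => //; lia.
rewrite -cat_rcons -(size_rcons X x) corner_cat cat_rcons => lt'.
exists X, x, y, z, Y; split=> //; clear -lt lt';
  by case: x lt; case: y lt' => //; case: z.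
Qed.

(** If the tile at a corner belongs to the tiling then it can be swept first,
    by commutations only: a crossing overlapping the corner would shift its
    tile to the wrong side of the a-strip of the hexagon. *)
Lemma pull_tile w H u p : run w H = Some u -> final u -> corner p w ->
  tile_at w p \in map fst (tiles w H) ->
  exists c K, heq H ((p, c) :: K) /\ perm_eq (tiles w H) (tiles w ((p, c) :: K)).
Proof.
move=> + fu; elim: H w => [|[q d] H IH] w //.
move=> r cp; have [w' s r'] := run_cons r; have hT := tiles_tiled r' fu.
have [sw cq rw'] := sweep_rk s.
have [<- _|npq] := eqVneq q p; first by exists d, H; split; [apply: heq_refl | apply: perm_refl].
rewrite /= s /= inE => /orP[/eqP e|hin].
  by case/eqP: npq; apply/esym/(tile_at_inj _ _ e); [case/andP: cp | case/andP: cq] => /ltnW/ltnW.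
have [far|nfar] := boolP ((q.+1 < p) || (p.+1 < q)).
  have cp' := corner_far s far cp.
  rewrite -(tile_at_far s far) in hin.
  have [c [K [hK pK]]] := IH _ r' cp' hin.
  have far' : (p.+1 < q) || (q.+1 < p) by rewrite orbC.
  have rK := r'; rewrite (heq_run hK) in rK; have [w2 s2 r2] := run_cons rK.
  have e2 := heq_run (heq_swap_far d c [::] far') w.
  rewrite /= s /= s2 /= in e2; case s1: sweep e2 => [w1|] //=.
  case s3: sweep => [w3|] //= [e3]; subst w3.
  exists c, ((q, d) :: K); split.
    exact: heq_trans (heq_cons (q, d) hK) (heq_swap_far d c K far').
  rewrite /= s1 /= s3 /= (tile_at_far s1 far').
  rewrite /= s2 /= (tile_at_far s far) in pK.
  apply: (perm_trans (y := (tile_at w q, odflt Cempty d) :: (tile_at w p, odflt Cempty c) :: tiles w2 K)).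
    by rewrite perm_cons.
  by rewrite -(cat1s (tile_at w q, _)) -(cat1s (tile_at w p, _)) perm_catCA.
exfalso; have [eqp|nqp] := eqVneq q p.+1.
  subst q; have [X [x [y [z [Y [ew eX lx ly lz]]]]]] := overlap_letters cp cq.
  have s0 := s; rewrite ew -eX -cat_rcons -(size_rcons X x) sweep_cat in s0.
  case hc: cross s0 => [[z' y']|] //= [ew']; have [_ /= lz' ly'] := cross_rank hc.
  have hK : kind_of (letter_of x) (letter_of y) = Some DA by rewrite lx ly.
  rewrite -eX ew (tile_at_cat _ _ hK) in hin.
  have [X1 [Y1 [eW /= ah]]] := back_P1 (l := La) hT hin isT.
  have eX1 : map letter_of (X ++ [:: x; z']) = X1.
    have e1 : map letter_of w' = map letter_of (X ++ [:: x; z']) ++ La :: map letter_of Y.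
      by rewrite -ew' cat_rcons -[[:: x, z', y' & Y]]/([:: x; z'] ++ y' :: Y) catA map_cat /= ly' ly.
    apply: split_count_inj (etrans (esym e1) eW) _.
    move: ah; rewrite /ahead /= => /andP[/eqP e _].
    rewrite !vertex_ofE stepE vertex_ofE /= in e.
    by rewrite e map_cat count_cat /= lz' lz lx /=.
  move: ah; rewrite -eX1 /ahead /= !stepE !vertex_ofE map_cat !count_cat /= lz' lz lx /=; lia.
have eqp : p = q.+1 by lia.
subst p; have [X [x [y [z [Y [ew eX lx ly lz]]]]]] := overlap_letters cq cp.
have s0 := s; rewrite ew -eX sweep_cat in s0.
case hc: cross s0 => [[y' x']|] //= [ew']; have [_ /= ly' lx'] := cross_rank hc.
have hK : kind_of (letter_of y) (letter_of z) = Some AE by rewrite ly lz.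
rewrite -eX ew -cat_rcons -(size_rcons X x) (tile_at_cat _ _ hK) in hin.
have [X1 [Y1 [eW /= ah]]] := back_P1 (l := La) hT hin isT.
have eX1 : map letter_of X = X1.
  rewrite -ew' map_cat /= ly' ly in eW; apply: split_count_inj eW _.
  move: ah; rewrite /ahead /= => /andP[/eqP e _].
  by rewrite !vertex_ofE in e; rewrite e map_rcons -cats1 count_cat /= lx /= !addn0.
move: ah; rewrite -eX1 /ahead /= !vertex_ofE map_rcons -cats1 !count_cat /= lx /=; lia.
Qed.

Lemma cross_label x y c c' s s' : cross x y c = Some s -> cross x y c' = Some s' ->
  odflt Cempty c = odflt Cempty c' -> c = c'.
Proof. by case: x; case: y; case: c => [[]|]; case: c' => [[]|]. Qed.

Lemma sweep_label w p c c' w1 w2 : sweep w p c = Some w1 -> sweep w p c' = Some w2 ->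
  odflt Cempty c = odflt Cempty c' -> c = c'.
Proof.
move=> /sweepP[X [x [y [Y [x' [y' [-> <- hc _]]]]]]]; rewrite sweep_cat.
by case hc': cross => //= _; apply: cross_label hc hc'.
Qed.

(** A filling determines its histories up to commutations: pull the first tile
    of one history to the front of the other. *)
Lemma heq_of_tiles w H H' u u' : run w H = Some u -> final u ->
  run w H' = Some u' -> final u' -> perm_eq (tiles w H) (tiles w H') -> heq H H'.
Proof.
move=> + fu + fu'; elim: H H' w => [|[p c] H IH] H' w.
  by move=> _ _ /perm_size; case: H' => [|[? ?] ?] // _; apply: heq_refl.
move=> r r' hp; have [w1 s1 r1] := run_cons r; have [_ cp _] := sweep_rk s1.
have hin : tile_at w p \in map fst (tiles w H').
  by rewrite -(perm_mem (perm_map fst hp)) /= mem_head.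
have [c' [K [hK pK]]] := pull_tile r' fu' cp hin.
have rK := r'; rewrite (heq_run hK) in rK; have [w2 s2 r2] := run_cons rK.
have {}hp := perm_trans hp pK.
have ec : c = c'.
  apply: (sweep_label s1 s2).
  have := uniq_tiles rK fu'; rewrite /= s2 /= => /andP[nin _].
  have : (tile_at w p, odflt Cempty c) \in tiles w ((p, c') :: K).
    by rewrite -(perm_mem hp) /= mem_head.
  rewrite /= s2 /= inE => /orP[/eqP[]//|hin2].
  by case/negP: nin; apply/mapP; exists (tile_at w p, odflt Cempty c).
subst c'; rewrite s1 in s2; case: s2 => e2; subst w2.
apply: heq_trans _ (heq_sym hK); apply: heq_cons; apply: (IH _ w1) => //.
by move: hp; rewrite /= s1 /= perm_cons.
Qed.

(** * Fillings as sets of tiles *)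

Lemma P1_inj W l u v : (u, l) \in P1 W -> (v, l) \in P1 W -> u l = v l -> u = v.
Proof.
move=> /P1P[X [Y /= [e ->]]] /P1P[X' [Y' /= [e' ->]]]; rewrite !vertex_ofE => h.
by rewrite e in e'; rewrite (split_count_inj e' h).
Qed.

Lemma se_of_coord l x : has_letter l x -> (se_of l x).1 l = x.2 l.
Proof. by case: x => [K v]; rewrite /has_letter /se_of; case: l; case: K => //= _; rewrite stepE addn0. Qed.

Lemma nw_of_coord l x : has_letter l x -> (nw_of l x).1 l = x.2 l.
Proof. by case: x => [K v]; rewrite /has_letter /nw_of; case: l; case: K => //= _; rewrite stepE addn0. Qed.

Lemma nw_of_P1 w p c w' l : sweep w p c = Some w' -> has_letter l (tile_at w p) ->
  nw_of l (tile_at w p) \in P1 (map letter_of w').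
Proof.
move=> /sweep_tile[X [x [y [Y [K [_ _ hK -> [x' [y' [_ -> lx ly]]]]]]]]].
have [eB eC] := kind_ofP hK; rewrite map_cat /= lx ly /has_letter /nw_of /= -eB -eC.
set X0 := map letter_of X; case: (l =P kindC K) => [->|_] /=.
  by move=> _; apply/P1P; exists X0, (kindB K :: map letter_of Y).
by rewrite orbF => /eqP ->; apply/P1P; exists (rcons X0 (kindC K)), (map letter_of Y); rewrite step_vertex cat_rcons.
Qed.

(** The strips of a tiling are connected: the last tile reached on the way
    back from a later tile to the path is adjacent to the tile just swept,
    since the path has only one edge in this strip. *)
Lemma beyond_chain w H u l x y : run w H = Some u -> final u ->
  x \in map fst (tiles w H) -> y \in map fst (tiles w H) -> beyond l y x ->
  lchain l (map fst (tiles w H)) x y.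
Proof.
move=> + fu; elim: H w => [|[p c] H IH] w //=.
case E: sweep => [w'|] //= r; have hT := tiles_tiled r fu.
rewrite !inE => /orP[/eqP->|xM] /orP[/eqP->|yM] hb.
- by rewrite beyond_irr in hb.
- rewrite (beyond_later _ E hT yM).1 in hb; case/and3P: hb => la hy hl.
  case/andP: hy => hy /eqP ey; have [x0 h0 c0] := back_chain hT yM hy.
  have [_ _ hx0 _] := lchain_mem c0.
  apply: (@lchain_head _ _ _ x0); rewrite ?mem_head //.
    have h1 := nw_of_P1 E hl; have := lchain_ahead c0.
    rewrite /ahead => /andP[/eqP + _]; rewrite !se_of_coord // ey -(nw_of_coord hl) => e.
    rewrite [LHS]surjective_pairing [RHS]surjective_pairing; congr (_, _).
    apply: (P1_inj h1 h0); rewrite -e -se_of_coord //.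
  by apply: lchain_sub c0 => z zM; rewrite inE zM orbT.
- by rewrite (beyond_later _ E hT xM).2 in hb.
- by apply: lchain_sub (IH _ r xM yM hb) => z zM; rewrite inE zM orbT.
Qed.

Definition fits (n : nat) (L : seq ltile) : Prop := forall x, x \in L -> forall l, x.2 l < n.

Definition fill_of (n : nat) (M : seq (ltile * content)) : filling n :=
  [set p : placed n | (loc p.1, p.2) \in M].

(** The filling as a list, in the coordinates of [ltile]; [fill_of] is the
    inverse. *)
Definition loc_list (n : nat) (F : filling n) : seq (ltile * content) :=
  [seq (loc p.1, p.2) | p <- enum F].

Lemma loc_surj n (x : ltile) : (forall l, x.2 l < n) -> exists t : tile n, loc t = x.
Proof.
move=> h; exists (x.1, [ffun l => Ordinal (h l)]); rewrite /loc [RHS]surjective_pairing.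
by congr (_, _); apply/ffunP => l; rewrite !ffunE.
Qed.

Lemma loc_inj n : injective (@loc n).
Proof.
move=> [K v] [K' v'] [-> /ffunP e]; congr (_, _); apply/ffunP => l; apply: val_inj.
by have := e l; rewrite !ffunE.
Qed.

Lemma locp_inj n : injective (fun p : placed n => (loc p.1, p.2)).
Proof.
move=> [t c] [t' c'] h; have /= h1 := congr1 fst h; have /= -> := congr1 snd h.
by congr (_, _); apply: loc_inj.
Qed.

Lemma loc_listE n (F : filling n) p : ((loc p.1, p.2) \in loc_list F) = (p \in F).
Proof. by rewrite /loc_list (mem_map (@locp_inj n)) mem_enum. Qed.

Lemma fill_of_loc_list n (F : filling n) : fill_of n (loc_list F) = F.
Proof. by apply/setP => p; rewrite inE loc_listE. Qed.

Lemma eq_fill_of n M M' : M =i M' -> fill_of n M = fill_of n M'.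
Proof. by move=> h; apply/setP => p; rewrite !inE h. Qed.

Lemma loc_list_fill_of n M : uniq M -> fits n (map fst M) -> perm_eq (loc_list (fill_of n M)) M.
Proof.
move=> uM fM; apply: uniq_perm => //; first by rewrite map_inj_uniq ?enum_uniq //; apply: locp_inj.
move=> x; apply/idP/idP => [/mapP[p]|xM]; first by rewrite mem_enum inE => h ->.
have [t et] := loc_surj (fM _ (map_f fst xM)).
by apply/mapP; exists (t, x.2); rewrite ?mem_enum ?inE /= et -?surjective_pairing.
Qed.

Lemma mem_tiles_of n (F : filling n) t : (t \in [set p.1 | p in F]) = (loc t \in map fst (loc_list F)).
Proof.
apply/imsetP/mapP => [[p pF ->]|[x /mapP[p pF ->] /= /loc_inj ->]].
  by exists (loc p.1, p.2) => //; rewrite loc_listE.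
by exists p => //; rewrite -mem_enum.
Qed.

Lemma tiling_loc_list n (F : filling n) : uniq (map fst (loc_list F)) ->
  perm_eq [seq loc t | t <- enum [set p.1 | p in F]] (map fst (loc_list F)).
Proof.
move=> uM; apply: uniq_perm => //; first by rewrite map_inj_uniq ?enum_uniq //; apply: loc_inj.
move=> x; apply/mapP/mapP => [[t]|[y /mapP[p pF ->] ->]].
  by rewrite mem_enum mem_tiles_of => /mapP[y yM e] ->; exists y.
by exists p.1 => //; rewrite mem_enum in pF; rewrite mem_enum imset_f.
Qed.

Lemma tiles_fit n w H u : run w H = Some u -> size w <= n -> fits n (map fst (tiles w H)).
Proof.
elim: H w => [|[p c] H IH] w //=.
case E: sweep => [w'|] //= r hn; have [sw /andP[cp _] _] := sweep_rk E.
move=> x; rewrite inE => /orP[/eqP->|xM]; last by apply: (IH _ r) => //; rewrite sw.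
move=> l; rewrite /tile_at /= vertex_ofE; apply: leq_ltn_trans (count_size _ _) _.
by rewrite size_take size_map; case: ifP; lia.
Qed.

Lemma beyond_next l x y : l != La -> has_letter l x -> has_letter l y ->
  nw_of l x = se_of l y -> beyond l y x.
Proof.
move=> la hx hs e; have e1 := congr1 fst e; rewrite /beyond hx hs /=.
have := nw_of_coord hx; rewrite e1 se_of_coord // => ->; rewrite eqxx /=.
move: e1 hx hs; case: x {e} => [Kx vx]; case: y => [Ks vs].
rewrite /nw_of /se_of /has_letter /=; clear -la.
by case: l la => //= _; case: Kx; case: Ks => //= /ffunP h _ _;
  move: (h Ld) (h La) (h Le); rewrite ?stepE /=; lia.
Qed.

(** In a tiling, connectedness along a strip amounts to a comparison of
    coordinates, along which the next tile always increases. *)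
Lemma further_beyond n (F : filling n) w H u l t s :
  run w H = Some u -> final u -> size w <= n ->
  map fst (loc_list F) =i map fst (tiles w H) ->
  t \in [set p.1 | p in F] -> s \in [set p.1 | p in F] -> l != La ->
  further l F t s = beyond l (loc s) (loc t).
Proof.
move=> r fu hn eM tF sF la; apply/idP/idP.
  case/andP=> nts /connectP[q]; elim/last_ind: q s {sF} nts => [|q z IH] s nts /=.
    by move=> _ e; rewrite e eqxx in nts.
  rewrite rcons_path last_rcons => /andP[hq hz] es; subst z.
  have hn1 x : next_in_strip l F x s -> beyond l (loc s) (loc x).
    case/and5P=> _ _ hx hs /eqP e; clear -hx hs e la; move: hx hs e.
    change (has_letter l (loc x) -> has_letter l (loc s) -> nw_of l (loc x) = se_of l (loc s) ->
      beyond l (loc s) (loc x)).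
    by move=> hx hs; apply: beyond_next.
  have [elast|nlast] := eqVneq t (last t q); first by apply: hn1; rewrite {1}elast.
  have h1 := IH _ nlast hq erefl; have h2 := hn1 _ hz.
  move: h1 h2; rewrite /beyond => /and4P[-> _ /eqP <- h1] /and4P[_ -> /eqP <- h2].
  by rewrite eqxx /=; clear -la h1 h2; case: l la h1 h2 => //=; lia.
move=> hb; rewrite mem_tiles_of eM in tF; rewrite mem_tiles_of eM in sF.
have nts : t != s by apply/eqP => e; rewrite e beyond_irr in hb.
rewrite /further nts /=; have := beyond_chain r fu tF sF hb.
move ex : (loc t) => x; move ey : (loc s) => y h.
elim: h s ey {sF nts hb} => [_ _|y' z c IH zM hz e] s es.
  by have -> : t = s by apply: loc_inj; rewrite ex es.
have [_ y'M _ hy'] := lchain_mem c.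
have [t' et'] := loc_surj (tiles_fit r hn y'M).
apply: connect_trans (IH _ et') (connect1 _).
apply/and5P; split; rewrite ?mem_tiles_of ?eM ?et' ?es //.
- by rewrite -[has_edge l t']/(has_letter l (loc t')) et'.
- by rewrite -[has_edge l s]/(has_letter l (loc s)) es.
- by rewrite -[nw_edge l t']/(nw_of l (loc t')) -[se_edge l s]/(se_of l (loc s)) et' es e.
Qed.

(** * The histories of a tableau *)

(** All the strands are alive at first. *)
Definition swept (n : nat) (W : seq letter) (H : history) (F : filling n) : Prop :=
  exists u, [/\ run (map live W) H = Some u, final u & F = fill_of n (tiles (map live W) H)].

Lemma map_letter_live W : map letter_of (map live W) = W.
Proof. by rewrite -map_comp (@eq_map _ _ _ id) ?map_id //; case. Qed.

Lemma uniq_tilesP w H u : run w H = Some u -> final u -> uniq (tiles w H).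
Proof. by move=> r fu; apply: map_uniq (uniq_tiles r fu). Qed.

Lemma swept_loc_list n W H (F : filling n) : swept W H F -> size W <= n ->
  perm_eq (loc_list F) (tiles (map live W) H).
Proof.
move=> [u [r fu ->]] hn; apply: loc_list_fill_of; first exact: uniq_tilesP r fu.
by apply: tiles_fit r _; rewrite size_map.
Qed.

Lemma swept_uniq n W H (F : filling n) : swept W H F -> size W <= n ->
  uniq (map fst (loc_list F)).
Proof.
move=> h hn; rewrite (perm_uniq (perm_map fst (swept_loc_list h hn))).
by case: h => u [r fu _]; apply: uniq_tiles r fu.
Qed.

Lemma placed_tile n (F : filling n) (p : placed n) : p \in F -> p.1 \in [set p.1 | p in F].
Proof. exact: imset_f. Qed.

Lemma swept_further n W H (F : filling n) l (p s : placed n) : swept W H F -> size W <= n ->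
  p \in F -> s \in F -> l != La -> further l F p.1 s.1 = beyond l (loc s.1) (loc p.1).
Proof.
move=> h hn pF sF la; have hp := swept_loc_list h hn; case: h => u [r fu _].
apply: (further_beyond r fu) la; rewrite ?size_map ?placed_tile //.
exact/perm_mem/perm_map.
Qed.

Lemma swept_is_tiling n W H (F : filling n) : swept W H F -> size W <= n ->
  is_tiling W [set p.1 | p in F].
Proof.
move=> h hn; rewrite is_tilingE (tiled_perm _ (tiling_loc_list (swept_uniq h hn))).
rewrite (tiled_perm _ (perm_map fst (swept_loc_list h hn))).
by case: h => u [r fu _]; have := tiles_tiled r fu; rewrite map_letter_live.
Qed.

Lemma swept_is_filling n W H (F : filling n) : swept W H F -> size W <= n -> is_filling F.
Proof.
move=> h hn; have uF := swept_uniq h hn; have hF := swept_further h hn.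
have pF := perm_mem (swept_loc_list h hn); case: h => u [r fu _].
have [h1 h2 _] := tiles_well_filled r fu.
have mF (p : placed n) : p \in F -> (loc p.1, p.2) \in tiles (map live W) H.
  by rewrite -pF loc_listE.
apply/and4P; split; apply/forall_inP => p pin.
- apply/forall_inP => s sin; apply/implyP => /eqP e.
  have ep : (loc p.1, p.2) \in loc_list F by rewrite loc_listE.
  have es : (loc s.1, s.2) \in loc_list F by rewrite loc_listE.
  rewrite e in ep; apply/eqP/locp_inj; rewrite e.
  by congr (_, _); apply: (uniq_fst_inj uF ep es).
- exact: (h1 _ (mF _ pin)).
- apply/forall_inP => s sin; apply/implyP => /andP[/eqP ep].
  rewrite /above hF // => hb; apply/eqP.
  exact: (h2 Le _ _ (mF _ pin) (mF _ sin) isT ep hb).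
- apply/forall_inP => s sin; apply/implyP => /andP[/eqP ep].
  rewrite /left_of hF // => hb; apply/eqP.
  exact: (h2 Ld _ _ (mF _ pin) (mF _ sin) isT ep hb).
Qed.

(** All strands of d and e dead: every tiling can then be swept, with empty
    tiles. *)
Definition dead_of (l : letter) : strand :=
  match l with Ld => DeadD | La => LiveA | Le => DeadE end.

(** Any filling of a tiling has a history.  Sweeping the bare tiling, as if all
    strands were dead, shows first that its strips are as they should be. *)
Lemma is_filling_swept n W (F : filling n) : size W <= n ->
  is_tiling W [set p.1 | p in F] -> is_filling F -> exists H, swept W H F.
Proof.
move=> hn hT /and4P[/forall_inP f1 /forall_inP f2 /forall_inP f3 /forall_inP f4].
have uF : uniq (map fst (loc_list F)).
  rewrite -map_comp map_inj_in_uniq ?enum_uniq // => p s.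
  rewrite !mem_enum => pF sF /= /loc_inj e.
  by have /forall_inP/(_ s sF) := f1 p pF; rewrite e eqxx => /eqP.
rewrite is_tilingE (tiled_perm _ (tiling_loc_list uF)) in hT.
pose M0 := [seq (x.1, Cempty) | x <- loc_list F].
have eM0 : map fst M0 = map fst (loc_list F) by rewrite -map_comp.
have ed : map letter_of (map dead_of W) = W by rewrite -map_comp (@eq_map _ _ _ id) ?map_id //; case.
have [||H0 [u0 [r0 fu0 p0]]] := @history_of (map dead_of W) M0; first by rewrite ed eM0.
  split.
  - by move=> x /mapP[y _ ->] /=; case: (y.1.1).
  - by move=> l x y _ /mapP[z _ ->].
  - by move=> l x /mapP[z _ ->].
have hF l (p s : placed n) : p \in F -> s \in F -> l != La ->
    further l F p.1 s.1 = beyond l (loc s.1) (loc p.1).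
  move=> pF sF la; apply: (further_beyond r0 fu0) la; rewrite ?size_map ?placed_tile //.
  by rewrite -eM0; apply: perm_mem; rewrite perm_sym; apply: perm_map.
have [||H [u [r fu pH]]] := @history_of (map live W) (loc_list F); first by rewrite map_letter_live.
  split.
  - by move=> x /mapP[p]; rewrite mem_enum => pF ->; apply: f2.
  - move=> l x y /mapP[p pF ->] /mapP[s sF ->]; rewrite !mem_enum in pF sF.
    move=> la /= ep hb; rewrite -hF // in hb; apply/eqP.
    case: l la ep hb => // _ ep hb.
      by have /forall_inP/(_ s sF) := f4 p pF; rewrite ep eqxx /= /left_of hb.
    by have /forall_inP/(_ s sF) := f3 p pF; rewrite ep eqxx /= /above hb.
  - by move=> l x _ _ _; rewrite status_live.
exists H, u; split=> //; rewrite -[LHS]fill_of_loc_list; apply: eq_fill_of.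
by apply: perm_mem; rewrite perm_sym.
Qed.

Lemma card_loc_list n (F : filling n) (Q : pred (ltile * content)) :
  #|[set p in F | Q (loc p.1, p.2)]| = count Q (loc_list F).
Proof.
rewrite /loc_list count_map -size_filter cardE; apply/perm_size/uniq_perm.
- exact: enum_uniq.
- exact/filter_uniq/enum_uniq.
by move=> p; rewrite mem_enum mem_filter mem_enum !inE andbC.
Qed.

Lemma count_tiles (Q : pred content) w H u : run w H = Some u ->
  count (fun x => Q x.2) (tiles w H) = count (fun s => Q (odflt Cempty s.2)) H.
Proof.
by elim: H w => [|[p c] H IH] w //=; case E: sweep => [w'|] //= r; rewrite (IH _ r).
Qed.

Definition nb_label (c : content) (H : history) : nat := count (fun s => s.2 == Some c) H.

Lemma swept_nb_alpha n W H (F : filling n) : swept W H F -> size W <= n ->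
  nb_alpha F = nb_label Calpha H.
Proof.
move=> h hn; rewrite /nb_alpha (card_loc_list F (fun x => x.2 == Calpha)).
rewrite (permP (swept_loc_list h hn)); case: h => u [r _ _].
by rewrite (count_tiles (pred1 Calpha) r); apply: eq_count => -[p [[]|]].
Qed.

Lemma swept_nb_beta n W H (F : filling n) : swept W H F -> size W <= n ->
  nb_beta F = nb_label Cbeta H.
Proof.
move=> h hn; rewrite /nb_beta (card_loc_list F (fun x => x.2 == Cbeta)).
rewrite (permP (swept_loc_list h hn)); case: h => u [r _ _].
by rewrite (count_tiles (pred1 Cbeta) r); apply: eq_count => -[p [[]|]].
Qed.

Lemma swept_has_q n W H (F : filling n) p : swept W H F -> size W <= n -> p \in F ->
  has_q F p = carries_q (map live W) (tiles (map live W) H) (loc p.1, p.2).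
Proof.
move=> h hn pF; have hF := swept_further h hn; have hp := perm_mem (swept_loc_list h hn).
rewrite /has_q /carries_q pF /= !status_live /= andbT; congr (_ && _).
have hE (l : letter) : l != La ->
    [exists s in F, (s.2 == symbol l) && further l F s.1 p.1] =
    has (fun y => (y.2 == symbol l) && beyond l (loc p.1) y.1) (tiles (map live W) H).
  move=> la; apply/exists_inP/hasP => [[s sF /andP[h1 h2]]|[y]].
    exists (loc s.1, s.2); first by rewrite -hp loc_listE.
    by rewrite /= h1 -hF.
  rewrite -hp => /mapP[s]; rewrite mem_enum => sF -> /= /andP[h1 h2].
  by exists s; rewrite // h1 hF.
have aE : [exists s in F, (s.2 == Calpha) && above F p.1 s.1] =
    [exists s in F, (s.2 == symbol Le) && further Le F s.1 p.1] by [].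
have bE : [exists s in F, (s.2 == Cbeta) && left_of F p.1 s.1] =
    [exists s in F, (s.2 == symbol Ld) && further Ld F s.1 p.1] by [].
rewrite aE bE !hE // andbC; congr (_ && _).
  case hl: has_letter => //=; apply/hasPn => y _; by rewrite /beyond hl andbF andbF.
by case hl: has_letter => //=; apply/hasPn => y _; rewrite /beyond hl andbF andbF.
Qed.

Lemma swept_nb_q n W H (F : filling n) : swept W H F -> size W <= n ->
  nb_q F = nb_label Cempty H.
Proof.
move=> h hn; rewrite /nb_q.
have -> : [set p in F | has_q F p] =
    [set p in F | carries_q (map live W) (tiles (map live W) H) (loc p.1, p.2)].
  by apply/setP => p; rewrite !inE; case pF: (p \in F) => //=; rewrite (swept_has_q h hn pF).
rewrite card_loc_list (permP (swept_loc_list h hn)); case: h => u [r fu _].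
exact: count_q r fu.
Qed.

Definition hist_of (n r : nat) (F : RAT n r) (H : history) : Prop := swept (word F) H (fil F).

Lemma hist_exists n r (F : RAT n r) : exists H, hist_of F H.
Proof.
case: F => -[W F] /= hF; have /and3P[_ hT hf] := hF.
by apply: is_filling_swept hT hf; rewrite size_tuple.
Qed.

Lemma RAT_exists n r (W : n.-tuple letter) H u : count_mem La W = r ->
  run (map live W) H = Some u -> final u ->
  exists F : RAT n r, word F = W /\ hist_of F H.
Proof.
move=> hr rH fu; have h : swept W H (fill_of n (tiles (map live W) H)) by exists u.
have hn : size W <= n by rewrite size_tuple.
have hF : is_RAT r (W, fill_of n (tiles (map live W) H)).
  by rewrite /is_RAT /= hr eqxx (swept_is_tiling h hn) (swept_is_filling h hn).
by exists (exist (fun x : n.-tuple letter * filling n => is_true (is_RAT r x)) _ hF).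
Qed.

Lemma hist_fil n r (F G : RAT n r) H : word F = word G -> hist_of F H -> hist_of G H -> F = G.
Proof.
move=> eW [u [_ _ eF]] [u' [_ _ eG]]; apply: val_inj.
rewrite [LHS]surjective_pairing [RHS]surjective_pairing -/(word F) -/(fil F) -/(word G) -/(fil G).
by rewrite eF eG eW.
Qed.

(** * Hexagons *)

(** Equivalence preserves the number of each symbol, and hence the weight:
    this is a property of the table. *)
Lemma heq_nb_label c H H' : heq H H' -> nb_label c H = nb_label c H'.
Proof.
rewrite /nb_label; elim=> {H H'} //=.
- by move=> H H' H'' _ -> _ ->.
- by move=> x H H' _ ->.
- by move=> *; lia.
move=> p c1 c2 c3 c1' c2' c3' K hm.
have : all (fun e => all (fun c : content =>
    (e.1.1.1 == Some c) + (e.1.1.2 == Some c) + (e.1.2 == Some c) ==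
    (e.2.1.1 == Some c) + (e.2.1.2 == Some c) + (e.2.2 == Some c))
  [:: Cempty; Calpha; Cbeta]) braid_table by [].
move=> /allP/(_ _ hm)/allP/(_ c) /= h.
have /eqP {}h := h (ltac:(by case: c {h})).
by rewrite !addnA h.
Qed.

Lemma tiles_cat w A w1 B : run w A = Some w1 -> tiles w (A ++ B) = tiles w A ++ tiles w1 B.
Proof.
elim: A w => [|[p c] A IH] w /=; first by case=> ->.
by case: sweep => //= w' /IH ->.
Qed.

Definition max_hex (v : vertex) (c1 c2 c3 : content) : seq (ltile * content) :=
  [:: ((DA, v), c1); ((DE, step v La), c2); ((AE, v), c3)].
Definition min_hex (v : vertex) (c1 c2 c3 : content) : seq (ltile * content) :=
  [:: ((AE, step v Ld), c1); ((DE, v), c2); ((DA, step v Le), c3)].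

Lemma tiles_max_hex X x y z Y c1 c2 c3 K u :
  letter_of x = Ld -> letter_of y = La -> letter_of z = Le ->
  run (X ++ [:: x, y, z & Y]) [:: (size X, c1), ((size X).+1, c2), (size X, c3) & K] = Some u ->
  exists2 w, run (X ++ [:: x, y, z & Y]) [:: (size X, c1); ((size X).+1, c2); (size X, c3)] = Some w
  & tiles (X ++ [:: x, y, z & Y]) [:: (size X, c1), ((size X).+1, c2), (size X, c3) & K] =
    max_hex (vertex_of (map letter_of X)) (odflt Cempty c1) (odflt Cempty c2) (odflt Cempty c3)
    ++ tiles w K.
Proof.
move=> lx ly lz r; have [w1 s1 r1] := run_cons r; have [w2 s2 r2] := run_cons r1.
have [w3 s3 r3] := run_cons r2; exists w3; first by rewrite /= s1 /= s2 /= s3.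
rewrite /= s1 /= s2 /= s3 /=.
rewrite sweep_cat in s1; case h1: cross s1 => [[y' x']|] //= [e1].
have [_ /= ly' lx'] := cross_rank h1.
rewrite -e1 -cat_rcons -(size_rcons X y') sweep_cat in s2; case h2: cross s2 => [[z' x'']|] //= [e2].
have [_ /= lz' lx''] := cross_rank h2.
rewrite (@tile_at_cat _ _ _ _ DA); last by rewrite lx ly.
have -> : tile_at w1 (size X).+1 = (DE, vertex_of (map letter_of (rcons X y'))).
  by rewrite -e1 -cat_rcons -(size_rcons X y') (@tile_at_cat _ _ _ _ DE) // lx' lx lz.
have -> : tile_at w2 (size X) = (AE, vertex_of (map letter_of X)).
  by rewrite -e2 cat_rcons (@tile_at_cat _ _ _ _ AE) // ly' ly lz' lz.
by rewrite map_rcons ly' ly -step_vertex.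
Qed.

Lemma tiles_min_hex X x y z Y c1 c2 c3 K u :
  letter_of x = Ld -> letter_of y = La -> letter_of z = Le ->
  run (X ++ [:: x, y, z & Y]) [:: ((size X).+1, c1), (size X, c2), ((size X).+1, c3) & K] = Some u ->
  exists2 w, run (X ++ [:: x, y, z & Y]) [:: ((size X).+1, c1); (size X, c2); ((size X).+1, c3)] = Some w
  & tiles (X ++ [:: x, y, z & Y]) [:: ((size X).+1, c1), (size X, c2), ((size X).+1, c3) & K] =
    min_hex (vertex_of (map letter_of X)) (odflt Cempty c1) (odflt Cempty c2) (odflt Cempty c3)
    ++ tiles w K.
Proof.
move=> lx ly lz r; have [w1 s1 r1] := run_cons r; have [w2 s2 r2] := run_cons r1.
have [w3 s3 r3] := run_cons r2; exists w3; first by rewrite /= s1 /= s2 /= s3.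
rewrite /= s1 /= s2 /= s3 /=.
have es := size_rcons X.
rewrite -cat_rcons -(es x) sweep_cat in s1; case h1: cross s1 => [[z' y']|] //= [e1].
have [_ /= lz' ly'] := cross_rank h1.
rewrite -e1 cat_rcons sweep_cat in s2; case h2: cross s2 => [[z'' x']|] //= [e2].
have [_ /= lz'' lx'] := cross_rank h2.
have -> : tile_at (X ++ [:: x, y, z & Y]) (size X).+1 = (AE, vertex_of (map letter_of (rcons X x))).
  by rewrite -cat_rcons -(es x) (@tile_at_cat _ _ _ _ AE) // ly lz.
have -> : tile_at w1 (size X) = (DE, vertex_of (map letter_of X)).
  by rewrite -e1 cat_rcons (@tile_at_cat _ _ _ _ DE) // lx lz' lz.
have -> : tile_at w2 (size X).+1 = (DA, vertex_of (map letter_of (rcons X z''))).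
  by rewrite -e2 -cat_rcons -(es z'') (@tile_at_cat _ _ _ _ DA) // lx' lx ly' ly.
by rewrite !map_rcons lx lz'' lz' lz -!step_vertex.
Qed.

(** A finite check: the labels of a swept hexagon are determined by the
    symbols which they contain and by the strands which were dead before. *)
Lemma min_hex_unique3 x y z Y m m' u u' :
  m \in unzip2 braid_table -> m' \in unzip2 braid_table ->
  run [:: x, y, z & Y] [:: (1, m.1.1); (0, m.1.2); (1, m.2)] = Some u ->
  run [:: x, y, z & Y] [:: (1, m'.1.1); (0, m'.1.2); (1, m'.2)] = Some u' ->
  let nb c (m : label * label * label) := (m.1.1 == Some c) + (m.1.2 == Some c) + (m.2 == Some c) in
  nb Calpha m = nb Calpha m' -> nb Cbeta m = nb Cbeta m' ->
  u = u' /\ (nb Cempty m = nb Cempty m' -> m = m').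
Proof.
have [fx|nx] := boolP ((letter_of x == Ld) && (letter_of y == La) && (letter_of z == Le)); last first.
  move=> _ _ r _; case/negP: nx; move: r => /=.
  by case h1: cross => [[z' y']|] //=; case h2: cross => [[z'' x']|] //=; case h3: cross => [s|] //= _;
    move: h1 h2 h3; case: y => //; case: z => //; case: (m.1.1) => [[]|] //= [<- <-];
    case: x => //; case: (m.1.2) => [[]|] //= [_ <-]; case: (m.2) => [[]|].
move: fx => /andP[/andP[/eqP lx /eqP ly] /eqP lz] hm hm' + + /=.
rewrite /= !inE in hm hm'.
case: x lx => // _; case: y ly => // _; case: z lz => // _;
by repeat (case/orP: hm => hm); move/eqP: hm => -> //=;
   repeat (case/orP: hm' => hm'); move/eqP: hm' => -> //= [<-] [<-].
Qed.

Lemma min_hex_unique X w m m' u u' :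
  m \in unzip2 braid_table -> m' \in unzip2 braid_table ->
  run (X ++ w) [:: ((size X).+1, m.1.1); (size X, m.1.2); ((size X).+1, m.2)] = Some u ->
  run (X ++ w) [:: ((size X).+1, m'.1.1); (size X, m'.1.2); ((size X).+1, m'.2)] = Some u' ->
  let nb c (m : label * label * label) := (m.1.1 == Some c) + (m.1.2 == Some c) + (m.2 == Some c) in
  nb Calpha m = nb Calpha m' -> nb Cbeta m = nb Cbeta m' ->
  u = u' /\ (nb Cempty m = nb Cempty m' -> m = m').
Proof.
move=> hm hm'.
have e (t : label * label * label) : [:: ((size X).+1, t.1.1); (size X, t.1.2); ((size X).+1, t.2)] =
    shift_history (size X) [:: (1, t.1.1); (0, t.1.2); (1, t.2)].
  by rewrite /shift_history /= addn0 addn1.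
rewrite !e !run_catl; case: w => [|x [|y [|z w]]] //.
case r1: run => [v|] // [<-]; case r2: run => [v'|] // [<-] nb ha hb.
by have [-> ?] := min_hex_unique3 hm hm' r1 r2 ha hb.
Qed.

(** The first step of sweeping a given list of tiles. *)
Lemma pull_head w H u p t c M : run w H = Some u -> final u -> corner p w ->
  tile_at w p = t -> perm_eq (tiles w H) ((t, c) :: M) ->
  exists d K w', [/\ heq H ((p, d) :: K), sweep w p d = Some w', run w' K = Some u,
    perm_eq (tiles w' K) M & c = odflt Cempty d].
Proof.
move=> r fu cp et pH.
have tH : tile_at w p \in map fst (tiles w H).
  by rewrite (perm_mem (perm_map fst pH)) et mem_head.
have [d [K [h p1]]] := pull_tile r fu cp tH.
have r1 := r; rewrite (heq_run h) in r1; have [w' s r'] := run_cons r1.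
have ec : c = odflt Cempty d.
  apply: (@uniq_fst_inj _ _ _ (uniq_tiles r fu) t); first by rewrite (perm_mem pH) mem_head.
  by rewrite (perm_mem p1) /= s et mem_head.
exists d, K, w'; split=> //.
by move: p1; rewrite (permPl pH) /= s et ec perm_cons perm_sym.
Qed.

(** The three tiles of a hexagon can be swept one after the other by
    [pull_head], because each crossing leaves the next tile at a corner. *)
Lemma pull_max_hex X x y z Y H u c1 c2 c3 S :
  letter_of x = Ld -> letter_of y = La -> letter_of z = Le ->
  run (X ++ [:: x, y, z & Y]) H = Some u -> final u ->
  perm_eq (tiles (X ++ [:: x, y, z & Y]) H) (max_hex (vertex_of (map letter_of X)) c1 c2 c3 ++ S) ->
  exists d1 d2 d3 K w, [/\ heq H [:: (size X, d1), ((size X).+1, d2), (size X, d3) & K],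
    run (X ++ [:: x, y, z & Y]) [:: (size X, d1); ((size X).+1, d2); (size X, d3)] = Some w,
    run w K = Some u, perm_eq (tiles w K) S
    & [/\ c1 = odflt Cempty d1, c2 = odflt Cempty d2 & c3 = odflt Cempty d3]].
Proof.
move=> lx ly lz r fu; set v := vertex_of _; set w := _ ++ _ in r * => hS.
have cp : corner (size X) w by rewrite corner_cat /rank lx ly.
have cq : corner (size X).+1 w by rewrite /w -cat_rcons -(size_rcons X x) corner_cat /rank ly lz.
have et : tile_at w (size X) = (DA, v) by rewrite (@tile_at_cat _ _ _ _ DA) // lx ly.
have [d1 [K1 [w1 [h1 s1 r1 p1 e1]]]] := pull_head r fu cp et hS.
have [cp1 next] := corner_overlap' cp cq s1.
have := s1; rewrite /w sweep_cat; case hc1: cross => [[y' x']|] //= [ew1].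
have [_ /= ly' lx'] := cross_rank hc1; rewrite -cat_rcons in ew1.
have et1 : tile_at w1 (size X).+1 = (DE, step v La).
  by rewrite -ew1 -(size_rcons X y') (@tile_at_cat _ _ _ _ DE) ?lx' ?lz ?lx // map_rcons ly' ly -step_vertex.
have [d2 [K2 [w2 [h2 s2 r2 p2 e2]]]] := pull_head r1 fu cp1 et1 p1.
have s2' := s2; rewrite -ew1 -(size_rcons X y') sweep_cat in s2'.
case hc2: cross s2' => [[z' x'']|] //= [ew2].
have [_ /= lz' lx''] := cross_rank hc2; rewrite cat_rcons in ew2.
have et2 : tile_at w2 (size X) = (AE, v) by rewrite -ew2 (@tile_at_cat _ _ _ _ AE) // ly' ly lz' lz.
have [d3 [K3 [w3 [h3 s3 r3 p3 e3]]]] := pull_head r2 fu (next _ _ s2) et2 p2.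
exists d1, d2, d3, K3, w3; split=> //; last by rewrite /= s1 /= s2 /= s3.
exact: heq_trans h1 (heq_cons _ (heq_trans h2 (heq_cons _ h3))).
Qed.

Lemma pull_min_hex X x y z Y H u c1 c2 c3 S :
  letter_of x = Ld -> letter_of y = La -> letter_of z = Le ->
  run (X ++ [:: x, y, z & Y]) H = Some u -> final u ->
  perm_eq (tiles (X ++ [:: x, y, z & Y]) H) (min_hex (vertex_of (map letter_of X)) c1 c2 c3 ++ S) ->
  exists d1 d2 d3 K w, [/\ heq H [:: ((size X).+1, d1), (size X, d2), ((size X).+1, d3) & K],
    run (X ++ [:: x, y, z & Y]) [:: ((size X).+1, d1); (size X, d2); ((size X).+1, d3)] = Some w,
    run w K = Some u, perm_eq (tiles w K) S
    & [/\ c1 = odflt Cempty d1, c2 = odflt Cempty d2 & c3 = odflt Cempty d3]].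
Proof.
move=> lx ly lz r fu; set v := vertex_of _; set w := _ ++ _ in r * => hS.
have cq : corner (size X) w by rewrite corner_cat /rank lx ly.
have cp : corner (size X).+1 w by rewrite /w -cat_rcons -(size_rcons X x) corner_cat /rank ly lz.
have et : tile_at w (size X).+1 = (AE, step v Ld).
  by rewrite /w -cat_rcons -(size_rcons X x) (@tile_at_cat _ _ _ _ AE) ?ly ?lz // map_rcons lx -step_vertex.
have [d1 [K1 [w1 [h1 s1 r1 p1 e1]]]] := pull_head r fu cp et hS.
have [cp1 next] := corner_overlap cq cp s1.
have s1' := s1; rewrite /w -cat_rcons -(size_rcons X x) sweep_cat in s1'.
case hc1: cross s1' => [[z' y']|] //= [ew1].
have [_ /= lz' ly'] := cross_rank hc1; rewrite cat_rcons in ew1.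
have et1 : tile_at w1 (size X) = (DE, v) by rewrite -ew1 (@tile_at_cat _ _ _ _ DE) // ?lx ?lz' ?lz.
have [d2 [K2 [w2 [h2 s2 r2 p2 e2]]]] := pull_head r1 fu cp1 et1 p1.
have := s2; rewrite -ew1 sweep_cat; case hc2: cross => [[z'' x']|] //= [ew2].
have [_ /= lz'' lx'] := cross_rank hc2.
have et2 : tile_at w2 (size X).+1 = (DA, step v Le).
  by rewrite -ew2 -cat_rcons -(size_rcons X z'') (@tile_at_cat _ _ _ _ DA) ?lx' ?lx ?ly' ?ly // map_rcons lz'' lz' lz -step_vertex.
have [d3 [K3 [w3 [h3 s3 r3 p3 e3]]]] := pull_head r2 fu (next _ _ s2) et2 p2.
exists d1, d2, d3, K3, w3; split=> //; last by rewrite /= s1 /= s2 /= s3.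
exact: heq_trans h1 (heq_cons _ (heq_trans h2 (heq_cons _ h3))).
Qed.

Lemma in_later_beyond w H u p x l : run w H = Some u -> final u -> corner p w ->
  x \in map fst (tiles w H) -> tile_at w p \in map fst (tiles w H) -> x != tile_at w p ->
  l != La -> has_letter l x -> has_letter l (tile_at w p) -> x.2 l = (tile_at w p).2 l ->
  beyond l x (tile_at w p).
Proof.
move=> r fu cp xM tM nx la hx ht e; have [c [K [h p1]]] := pull_tile r fu cp tM.
have rK := r; rewrite (heq_run h) in rK; have [w1 s1 r1] := run_cons rK.
move: xM; rewrite (perm_mem (perm_map fst p1)) /= s1 inE (negbTE nx) /= => xM.
by apply: later_beyond s1 (tiles_tiled r1 fu) xM la _ ht; rewrite /in_lstrip hx e eqxx.
Qed.

(** Used to see that the tile of a hexagon which is swept first is not one of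
    the two others, each of which comes later in a strip of the hexagon. *)
Lemma beyond_hex v :
  [/\ beyond Ld (DA, v) (DE, step v La) = false, beyond Le (DE, step v La) (AE, v) = false,
      beyond Le (AE, step v Ld) (DE, v) = false & beyond Ld (DE, v) (DA, step v Le) = false].
Proof. by rewrite /beyond /= !stepE /=; split; lia. Qed.

(** Two fillings which differ by the flip of a hexagon have equivalent histories:
    common tiles at corners are swept first, until the hexagon comes to the
    boundary. *)
Lemma hexagon_heq w H H' u u' v c1 c2 c3 c1' c2' c3' S :
  run w H = Some u -> final u -> run w H' = Some u' -> final u' ->
  perm_eq (tiles w H) (max_hex v c1 c2 c3 ++ S) ->
  perm_eq (tiles w H') (min_hex v c1' c2' c3' ++ S) ->
  (c1 == Calpha) + (c2 == Calpha) + (c3 == Calpha) =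
    (c1' == Calpha) + (c2' == Calpha) + (c3' == Calpha) ->
  (c1 == Cbeta) + (c2 == Cbeta) + (c3 == Cbeta) =
    (c1' == Cbeta) + (c2' == Cbeta) + (c3' == Cbeta) ->
  nb_label Cempty H = nb_label Cempty H' -> heq H H'.
Proof.
move: {2}(size H) (leqnn (size H)) => N.
elim: N w H H' u u' S => [|N IH] w H H' u u' S sH r fu r' fu' pT pT' ea eb eq.
  by case: H sH pT {r eq} => // _ /perm_size.
have common p : corner p w -> tile_at w p \in map fst S -> heq H H'.
  move=> cp /mapP[[t d] tS /= et]; have pS := perm_to_rem tS; set S' := rem _ S in pS.
  have front M h : perm_eq M (h ++ S) -> perm_eq M ((t, d) :: h ++ S').
    move/permPl=> ->; rewrite -cat1s perm_sym perm_catCA perm_cat2l perm_sym.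
    exact: pS.
  have [c [K [w1 [h s1 r1 p1 ec]]]] := pull_head r fu cp et (front _ _ pT).
  have [c' [K' [w1' [h' s1' r1' p1' ec']]]] := pull_head r' fu' cp et (front _ _ pT').
  have e : c = c' by apply: (sweep_label s1 s1'); rewrite -ec.
  subst c'; rewrite s1 in s1'; case: s1' => ew; subst w1'.
  apply: (heq_trans h (heq_trans (heq_cons _ _) (heq_sym h'))).
  apply: (IH w1 K K' u u' S') => //.
    by rewrite -ltnS -[(size K).+1]/(size ((p, c) :: K)) -(heq_size h).
  move: eq; rewrite (heq_nb_label _ h) (heq_nb_label _ h').
  by rewrite /nb_label /= => /addnI.
have inF t c : (t, c) \in max_hex v c1 c2 c3 -> t \in map fst (tiles w H).
  by move=> ht; rewrite (perm_mem (perm_map fst pT)) map_cat mem_cat (map_f fst ht).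
have inF' t c : (t, c) \in min_hex v c1' c2' c3' -> t \in map fst (tiles w H').
  by move=> ht; rewrite (perm_mem (perm_map fst pT')) map_cat mem_cat (map_f fst ht).
have first (G : history) u0 : run w G = Some u0 -> final u0 -> tiles w G != [::] ->
    exists2 p, corner p w & tile_at w p \in map fst (tiles w G).
  case: G => [|[p c] G] // rG _ _; have [w1 s1 _] := run_cons rG; have [_ cp _] := sweep_rk s1.
  by exists p => //=; rewrite mem_head.
have [|p cp tp] := first H u r fu.
  by rewrite -size_eq0 (perm_size pT).
have [|p' cp' tp'] := first H' u' r' fu'.
  by rewrite -size_eq0 (perm_size pT').
have := tp; rewrite (perm_mem (perm_map fst pT)) map_cat mem_cat => /orP[tm|]; last exact: common.
have := tp'; rewrite (perm_mem (perm_map fst pT')) map_cat mem_cat => /orP[tm'|]; last exact: common.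
(* Both histories start inside the hexagon, hence with its first tile. *)
have [nb1 nb2 nb3 nb4] := beyond_hex v.
have et : tile_at w p = (DA, v).
  move: tm; rewrite !inE /= => /or3P[/eqP//|/eqP et|/eqP et]; exfalso.
    move/negP: nb1; apply; rewrite -et; apply: (in_later_beyond r fu cp _ tp);
      by rewrite ?et ?stepE ?addn0 // (inF _ c1) // !inE eqxx.
  move/negP: nb2; apply; rewrite -et; apply: (in_later_beyond r fu cp _ tp);
    by rewrite ?et ?stepE ?addn0 // (inF _ c2) // !inE eqxx ?orbT.
have et' : tile_at w p' = (AE, step v Ld).
  move: tm'; rewrite !inE /= => /or3P[/eqP//|/eqP et'|/eqP et']; exfalso.
    move/negP: nb3; apply; rewrite -et'; apply: (in_later_beyond r' fu' cp' _ tp');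
      by rewrite ?et' ?stepE ?addn0 // (inF' _ c1') // !inE eqxx.
  move/negP: nb4; apply; rewrite -et'; apply: (in_later_beyond r' fu' cp' _ tp');
    by rewrite ?et' ?stepE ?addn0 // (inF' _ c2') // !inE eqxx ?orbT.
case/corner_split: (cp) => X [x [y [Y0 [ew ep lt]]]].
have [K hK] := kind_of_rank lt; have [eB eC] := kind_ofP hK.
have := et; rewrite ew -ep (tile_at_cat _ _ hK) => -[eK ev].
case/corner_split: (cp') => X' [y1 [z [Y [ew' ep' lt']]]].
have [K' hK'] := kind_of_rank lt'; have [eB' eC'] := kind_ofP hK'.
have := et'; rewrite ew' -ep' (tile_at_cat _ _ hK') => -[eK' ev'].
rewrite eK /= in eB eC; rewrite eK' /= in eB' eC'.
have eX : X' = rcons X x.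
  have := size_vertex (etrans ev' (congr1 (fun t => step t Ld) (esym ev))); rewrite !size_map => sX.
  have := congr1 (take (size X')) (etrans (esym ew') ew).
  by rewrite take_size_cat // sX -cat_rcons -(size_rcons X x) take_size_cat.
have {ew'}ew2 : w = X ++ [:: x, y1, z & Y] by rewrite ew' eX cat_rcons.
have := congr1 (drop (size X)) (etrans (esym ew) ew2); rewrite !drop_size_cat // => -[ey _]; subst y1.
clear et et' tm tm' tp tp' cp cp' ew.
rewrite ew2 -ev in r r' pT pT'.
have [d1 [d2 [d3 [G [wG [hG rG rG' pG [f1 f2 f3]]]]]]] := pull_max_hex (esym eB) (esym eC) (esym eC') r fu pT.
have [d1' [d2' [d3' [G' [wG' [hG' sG sG' pG' [f1' f2' f3']]]]]]] :=
  pull_min_hex (esym eB) (esym eC) (esym eC') r' fu' pT'.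
have [b1 [b2 [b3 hb]]] := braid_exists rG.
have rG2 : run (X ++ [:: x, y, z & Y]) [:: ((size X).+1, b1); (size X, b2); ((size X).+1, b3)] = Some wG.
  by rewrite -rG; apply/esym/(run_braid _ _ hb).
have [b1' [b2' [b3' hb']]] := braid_exists' sG.
have tab a : (d1 == Some a) + (d2 == Some a) + (d3 == Some a) = (b1 == Some a) + (b2 == Some a) + (b3 == Some a).
  have := heq_nb_label a (heq_braid 0 [::] hb); rewrite /nb_label /= !addn0; clear; lia.
have lab a d : a != Cempty -> (odflt Cempty d == a) = (d == Some a).
  by clear; case: d => // /negbTE; rewrite eq_sym.
have cnt a : a != Cempty ->
    (c1 == a) + (c2 == a) + (c3 == a) = (c1' == a) + (c2' == a) + (c3' == a) ->
    (b1 == Some a) + (b2 == Some a) + (b3 == Some a) =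
    (d1' == Some a) + (d2' == Some a) + (d3' == Some a).
  by move=> na; rewrite f1 f2 f3 f1' f2' f3' !lab // tab.
have [ewG eqm] := min_hex_unique (m := (b1, b2, b3)) (m' := (d1', d2', d3'))
  (map_f snd hb) (map_f snd hb') rG2 sG (cnt Calpha isT ea) (cnt Cbeta isT eb).
subst wG'; have hGG : heq G G'.
  by apply: heq_of_tiles rG' fu sG' fu' _; rewrite (permPl pG) perm_sym.
have eqq : (b1 == Some Cempty) + (b2 == Some Cempty) + (b3 == Some Cempty) =
    (d1' == Some Cempty) + (d2' == Some Cempty) + (d3' == Some Cempty).
  move: eq; rewrite (heq_nb_label _ hG) (heq_nb_label _ hG') -tab.
  have := heq_nb_label Cempty hGG; rewrite /nb_label /=; clear; lia.
have [e1 e2 e3] := eqm eqq.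
apply: (heq_trans hG (heq_trans (heq_braid _ _ hb) _)); rewrite e1 e2 e3.
by apply: (heq_trans _ (heq_sym hG')); do 3 apply: heq_cons.
Qed.

(** * Flips and the equivalence of histories *)

Lemma perm_split_fst (T S : eqType) (M h : seq (T * S)) : uniq (map fst M) ->
  uniq (map fst h) -> {subset h <= M} ->
  perm_eq M (h ++ [seq x <- M | x.1 \notin map fst h]).
Proof.
move=> uM uh sub; rewrite -(perm_filterC (fun x => x.1 \in map fst h)) perm_cat2r.
apply: uniq_perm; [exact/filter_uniq/(map_uniq uM) | exact: map_uniq uh |].
move=> [a c]; rewrite mem_filter /=; apply/andP/idP => [[/mapP[[a' c'] hin /= ->]]|hin].
  by move=> cM; rewrite (uniq_fst_inj uM cM (sub _ hin)).
by rewrite (map_f fst hin) sub.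
Qed.

Lemma contains_max_hex n r v (F : RAT n r) : contains_tiles (max_hexagon v) F ->
  exists c1 c2 c3, {subset max_hex v c1 c2 c3 <= loc_list (fil F)}.
Proof.
case/and4P=> /exists_inP[p1 h1 /eqP e1] /exists_inP[p2 h2 /eqP e2] /exists_inP[p3 h3 /eqP e3] _.
exists p1.2, p2.2, p3.2 => x; rewrite !inE => /or3P[]/eqP->;
  by rewrite -?e1 -?e2 -?e3 loc_listE.
Qed.

Lemma contains_min_hex n r v (F : RAT n r) : contains_tiles (min_hexagon v) F ->
  exists c1 c2 c3, {subset min_hex v c1 c2 c3 <= loc_list (fil F)}.
Proof.
case/and4P=> /exists_inP[p1 h1 /eqP e1] /exists_inP[p2 h2 /eqP e2] /exists_inP[p3 h3 /eqP e3] _.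
exists p1.2, p2.2, p3.2 => x; rewrite !inE => /or3P[]/eqP->;
  by rewrite -?e1 -?e2 -?e3 loc_listE.
Qed.

Lemma max_hex_uniq v c1 c2 c3 : uniq (map fst (max_hex v c1 c2 c3)).
Proof. by []. Qed.

Lemma min_hex_uniq v c1 c2 c3 : uniq (map fst (min_hex v c1 c2 c3)).
Proof. by []. Qed.

Lemma size_word n r (F : RAT n r) : size (word F) <= n. Proof. by rewrite size_tuple. Qed.

(** The two tableaux have the same tiles outside the hexagon and, by the
    equality of weights, as many symbols of each kind inside, so that
    [hexagon_heq] applies. *)
Lemma flip_heq n r v (F G : RAT n r) H H' : hist_of F H -> hist_of G H' ->
  flip_max_min v F G -> word F = word G /\ heq H H'.
Proof.
move=> hF hG /and5P[/eqP ew cF cG /eqP eFG /and5P[/eqP ea /eqP eb /eqP eq _ _]].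
split=> //.
have [c1 [c2 [c3 sF]]] := contains_max_hex cF; have [c1' [c2' [c3' sG]]] := contains_min_hex cG.
have uF := swept_uniq hF (size_word F); have uG := swept_uniq hG (size_word G).
have pF := perm_split_fst uF (max_hex_uniq v c1 c2 c3) sF.
have pG := perm_split_fst uG (min_hex_uniq v c1' c2' c3') sG.
set S := [seq x <- _ | _] in pF; set S' := [seq x <- _ | _] in pG.
have pS : perm_eq S S'.
  apply: uniq_perm; try exact/filter_uniq/(map_uniq uF); try exact/filter_uniq/(map_uniq uG).
  move=> x; rewrite !mem_filter; apply/andP/andP => -[nx /mapP[p]]; rewrite mem_enum => pin ex; subst x.
    have : p \in fil F :\: tiles_at (max_hexagon v) F.
      by rewrite in_setD in_set pin (nx : loc p.1 \notin max_hexagon v).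
    by rewrite eFG in_setD in_set loc_listE; case: (p \in fil G) => //; rewrite andbT.
  have : p \in fil G :\: tiles_at (min_hexagon v) G.
    by rewrite in_setD in_set pin (nx : loc p.1 \notin min_hexagon v).
  by rewrite -eFG in_setD in_set loc_listE; case: (p \in fil F) => //; rewrite andbT.
have qF := swept_loc_list hF (size_word F); have qG := swept_loc_list hG (size_word G).
have nF c : count (fun x => x.2 == c) (loc_list (fil F)) =
    (c1 == c) + (c2 == c) + (c3 == c) + count (fun x => x.2 == c) S.
  by rewrite (permP pF) count_cat /= addn0 !addnA.
have nG c : count (fun x => x.2 == c) (loc_list (fil G)) =
    (c1' == c) + (c2' == c) + (c3' == c) + count (fun x => x.2 == c) S.
  by rewrite (permP pG) count_cat /= addn0 !addnA (permP pS).
rewrite /nb_alpha !(card_loc_list _ (fun x => x.2 == Calpha)) nF nG in ea.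
rewrite /nb_beta !(card_loc_list _ (fun x => x.2 == Cbeta)) nF nG in eb.
rewrite (swept_nb_q hF (size_word F)) (swept_nb_q hG (size_word G)) in eq.
case: hF => u [r1 fu _]; case: hG => u' [r2 fu' _]; rewrite -ew in r2 qG.
apply: (@hexagon_heq (map live (word F)) H H' u u' v c1 c2 c3 c1' c2' c3' S) => //.
- by rewrite perm_sym -(permPl pF).
- by rewrite perm_sym in qG; apply: (perm_trans qG (perm_trans pG _)); rewrite perm_cat2l perm_sym.
- exact: (addIn ea).
- exact: (addIn eb).
Qed.

Lemma hist_heq n r (F : RAT n r) H H' : hist_of F H -> hist_of F H' -> heq H H'.
Proof.
move=> h h'; have p := swept_loc_list h (size_word F); have p' := swept_loc_list h' (size_word F).
case: h => u [r1 fu _]; case: h' => u' [r2 fu' _].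
by apply: heq_of_tiles r1 fu r2 fu' _; rewrite -(permPl p).
Qed.

Lemma equivalent_heq n r (F G : RAT n r) H H' : hist_of F H -> hist_of G H' ->
  equivalent F G -> word F = word G /\ heq H H'.
Proof.
move=> hF hG /connectP[s]; elim: s F H hF => [|E s IH] F H hF /=.
  by move=> _ e; subst G; split=> //; apply: hist_heq hF hG.
case/andP=> /existsP[t ht] hs eG; have [K hE] := hist_exists E.
have [eW hK] := IH E K hE hs eG; case/orP: ht => hf.
  by have [-> h] := flip_heq hF hE hf; split=> //; apply: heq_trans h hK.
have [e h] := flip_heq hE hF hf; split; first by rewrite -e.
by apply: heq_trans (heq_sym h) hK.
Qed.

Lemma equivalent_sym n r (F G : RAT n r) : equivalent F G = equivalent G F.
Proof.
apply: sym_connect_sym => {}F {}G; apply/existsP/existsP => -[t ht]; exists t; by rewrite orbC.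
Qed.

Lemma fill_of_split n (A h Z M : seq (ltile * content)) : uniq (map fst M) ->
  perm_eq M (A ++ h ++ Z) ->
  [set p in fill_of n M | loc p.1 \in map fst h] = fill_of n h /\
  fill_of n M :\: [set p in fill_of n M | loc p.1 \in map fst h] = fill_of n (A ++ Z).
Proof.
move=> uM pM; have mM x : x \in M = [|| x \in A, x \in h | x \in Z].
  by rewrite (perm_mem pM) !mem_cat.
have sep x y : x \in M -> y \in h -> x.1 = y.1 -> x \in h.
  move=> xM yh e; have yM : y \in M by rewrite mM yh orbT.
  case: x y xM yM yh e => [a c] [a' c'] xM yM yh /= e; subst a'.
  by rewrite (uniq_fst_inj uM xM yM).
have dis x : x \in A \/ x \in Z -> x.1 \notin map fst h.
  move=> hx; apply/mapP => -[y yh e]; have xM : x \in M by rewrite mM; case: hx => ->; rewrite ?orbT.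
  have xh := sep _ _ xM yh e.
  have := map_uniq uM; rewrite (perm_uniq pM) cat_uniq => /and3P[_ /hasPn d1].
  rewrite cat_uniq => /and3P[_ /hasPn d2 _]; case: hx => hx.
    by have := d1 x; rewrite mem_cat xh /= hx => /(_ isT).
  by have := d2 x hx; rewrite /= xh.
split; apply/setP => p; rewrite !inE.
  apply/andP/idP => [[pM' /mapP[y yh e]]|hp]; first exact: sep pM' yh e.
  by rewrite mM hp orbT (map_f fst hp).
rewrite mem_cat; case pM': (_ \in M) => /=; last first.
  by rewrite ?andbF; move: pM'; rewrite mM; do 2 case: (_ \in _) => //=; move=> ->.
rewrite andbT; apply/idP/idP => [nh|/orP hx]; last exact: dis hx.
move: pM'; rewrite mM => /or3P[->//|hp|->]; last by rewrite orbT.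
by rewrite (map_f fst hp) in nh.
Qed.

Lemma exists_fill_of n (h : seq (ltile * content)) c : fits n (map fst h) ->
  [exists p in fill_of n h, p.2 == c] = has (fun x => x.2 == c) h.
Proof.
move=> fh; apply/exists_inP/hasP => [[p]|[x xh e]].
  by rewrite inE => ph e; exists (loc p.1, p.2).
have [t et] := loc_surj (fh _ (map_f fst xh)).
by exists (t, x.2) => //=; rewrite inE /= et -surjective_pairing.
Qed.

(** Commutations do not change the tableau and a move of the table is a flip;
    the common beginning [A] of the histories allows the induction to pass
    under the first crossings. *)
Lemma heq_equivalent n r H H' : heq H H' -> forall A (F G : RAT n r), word F = word G ->
  hist_of F (A ++ H) -> hist_of G (A ++ H') -> equivalent F G.
Proof.
elim=> {H H'}.
- by move=> H A F G eW hF hG; rewrite (hist_fil eW hF hG); apply: connect0.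
- by move=> H H' _ IH A F G eW hF hG; rewrite equivalent_sym; apply: IH hG hF.
- move=> H H' H'' h IH h' IH' A F G eW hF hG.
  have [u [r1 fu _]] := hF; have r2 := r1; rewrite (heq_run (heq_catl A h)) in r2.
  have hr : count_mem La (word F) = r.
    by case: (F) => -[W f] /= hf; have /and3P[/eqP] := hf.
  have [E [eE hE]] := RAT_exists hr r2 fu.
  by apply: connect_trans (IH A F E (esym eE) hF hE) (IH' A E G (etrans eE eW) hE hG).
- by move=> x H H' _ IH A F G eW; rewrite -!cat_rcons; apply: IH.
- move=> p c p' c' K hp A F G eW hF hG.
  suff -> : F = G by apply: connect0.
  apply: (hist_fil eW hF); have [u [r1 fu eF]] := hF; have [u' [r2 fu' eG]] := hG.
  rewrite -eW in r2 eG; exists u; split=> //; rewrite -?eW; first by [].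
  rewrite eG; apply: eq_fill_of; rewrite !(run_cat _ A) in r1 r2.
  case r0: run r1 r2 => [w0|] //= r1 r2; rewrite !(tiles_cat _ r0) => x; rewrite !mem_cat; congr (_ || _).
  move: r1 r2; case s1: sweep => [w1|] //=; case s2: sweep => [w2|] //= r1.
  case s3: sweep => [w3|] //=; case s4: sweep => [w4|] //= r2.
  have far : (p'.+1 < p) || (p.+1 < p') by rewrite hp orbT.
  have far' : (p.+1 < p') || (p'.+1 < p) by rewrite orbC.
  rewrite /= ?s1 /= ?s2 ?s3 /= ?s4 ?s2 /= (tile_at_far s1 far') (tile_at_far s3 far).
  have := sweep_comm w0 c c' hp; rewrite s1 s3 /= s2 s4 => -[->].
  by rewrite !inE orbCA.
move=> p c1 c2 c3 c1' c2' c3' K hm A F G eW hF hG.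
have [u [r1 fu eF]] := hF; have [u' [r2 fu' eG]] := hG; rewrite -eW in r2 eG.
have mF := r1; have mG := r2; rewrite !(run_cat _ A) in mF mG.
case r0: run mF mG => [w0|] //.
change (run w0 [:: (p, c1), (p.+1, c2), (p, c3) & K] = Some u ->
  run w0 [:: (p.+1, c1'), (p, c2'), (p.+1, c3') & K] = Some u' -> equivalent F G) => mF mG.
have [w1 s1 _] := run_cons mF; have [_ cp _] := sweep_rk s1.
have [w2 s2 _] := run_cons mG; have [_ cq _] := sweep_rk s2.
have [X [x [y [z [Y [ew eX lx ly lz]]]]]] := overlap_letters cp cq.
rewrite ew -eX in mF mG; subst w0.
have [w3 m3 tF] := tiles_max_hex lx ly lz mF; have [w4 m4 tG] := tiles_min_hex lx ly lz mG.
have ew34 : w3 = w4.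
  have := run_braid (X ++ [:: x, y, z & Y]) (size X) hm; rewrite m3 m4; by case.
subst w4; set v := vertex_of _ in tF tG.
set h := max_hex _ _ _ _ in tF; set h' := min_hex _ _ _ _ in tG.
have eM : tiles (map live (word F)) (A ++ [:: (p, c1), (p.+1, c2), (p, c3) & K]) = tiles (map live (word F)) A ++ h ++ tiles w3 K.
  by rewrite (tiles_cat _ r0) -eX tF.
have eM' : tiles (map live (word F)) (A ++ [:: (p.+1, c1'), (p, c2'), (p.+1, c3') & K]) = tiles (map live (word F)) A ++ h' ++ tiles w3 K.
  by rewrite (tiles_cat _ r0) -eX tG.
have hn : size (map live (word F)) <= n by rewrite size_map size_word.
have uF := uniq_tiles r1 fu; have uG := uniq_tiles r2 fu'.
have fF := tiles_fit r1 hn; have fG := tiles_fit r2 hn.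
rewrite eM in eF uF fF; rewrite eM' in eG uG fG.
have [tF1 tF2] := fill_of_split n uF (perm_refl _).
have [tG1 tG2] := fill_of_split n uG (perm_refl _).
have [t0 et0] : exists t : tile n, loc t = (DA, v).
  by apply/loc_surj/fF; rewrite !map_cat !mem_cat /= inE eqxx orbT.
have fh : fits n (map fst h) by move=> a ah; apply: fF; rewrite !map_cat !mem_cat ah orbT.
have fh' : fits n (map fst h') by move=> a ah; apply: fG; rewrite !map_cat !mem_cat ah orbT.
apply: connect1; apply/existsP; exists t0; apply/orP; left.
have -> : anchor t0 = v by have := congr1 snd et0.
have cont (E : RAT n r) M (g : seq (ltile * content)) : fil E = fill_of n M ->
    fits n (map fst g) -> {subset g <= M} -> contains_tiles (map fst g) E.
  move=> eE fg sg; apply/allP => a ag; case/mapP: (ag) => b bg ea.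
  have [t et] := loc_surj (fg _ ag).
  apply/exists_inP; exists (t, b.2); rewrite /= ?et // eE inE /= et ea -surjective_pairing.
  exact: sg.
have tblq : [/\ (c1 == Some Calpha) || (c2 == Some Calpha) || (c3 == Some Calpha) =
    (c1' == Some Calpha) || (c2' == Some Calpha) || (c3' == Some Calpha)
  & (c1 == Some Cbeta) || (c2 == Some Cbeta) || (c3 == Some Cbeta) =
    (c1' == Some Cbeta) || (c2' == Some Cbeta) || (c3' == Some Cbeta)].
  have := heq_nb_label Calpha (heq_braid 0 [::] hm); have := heq_nb_label Cbeta (heq_braid 0 [::] hm).
  rewrite /nb_label /= !addn0; clear.
  by do 12 case: (_ == _).
have lab a d : a != Cempty -> (odflt Cempty d == a) = (d == Some a).
  by clear; case: d => // /negbTE; rewrite eq_sym.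
have hq := heq_catl A (heq_braid p K hm).
apply/and5P; split; first by apply/eqP.
- by apply: (cont F _ h eF fh) => a ah; rewrite !mem_cat ah orbT.
- by apply: (cont G _ h' eG fh') => a ah; rewrite !mem_cat ah orbT.
- by rewrite /tiles_at eF eG -[max_hexagon v]/(map fst h) -[min_hexagon v]/(map fst h') tF2 tG2.
apply/and5P; split.
- by rewrite (swept_nb_alpha hF (size_word F)) (swept_nb_alpha hG (size_word G)) (heq_nb_label _ hq).
- by rewrite (swept_nb_beta hF (size_word F)) (swept_nb_beta hG (size_word G)) (heq_nb_label _ hq).
- by rewrite (swept_nb_q hF (size_word F)) (swept_nb_q hG (size_word G)) (heq_nb_label _ hq).
- rewrite /tiles_at eF eG -[max_hexagon v]/(map fst h) -[min_hexagon v]/(map fst h') tF1 tG1.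
  by rewrite !exists_fill_of //= !lab // !orbF !orbA; case: tblq => ->.
- rewrite /tiles_at eF eG -[max_hexagon v]/(map fst h) -[min_hexagon v]/(map fst h') tF1 tG1.
  by rewrite !exists_fill_of //= !lab // !orbF !orbA; case: tblq => _ ->.
Qed.

(** The equivalence classes of tableaux are the equivalence classes of
    histories. *)
Lemma equivalentP n r (F G : RAT n r) H H' : hist_of F H -> hist_of G H' ->
  equivalent F G <-> word F = word G /\ heq H H'.
Proof.
move=> hF hG; split=> [|[eW h]]; first exact: equivalent_heq.
exact: (heq_equivalent h (A := [::])).
Qed.

(** * Compressing a strip *)

(** [shift] in the coordinates of [ltile]. *)
Definition lshift (l : letter) (i : nat) (x : ltile) : ltile :=
  (x.1, [ffun m => if (m == l) && (i < x.2 m) then (x.2 m).-1 else x.2 m]).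

Lemma loc_shift n l i (t : tile n) : loc (shift l i t) = lshift l i (loc t).
Proof.
congr (_, _); apply/ffunP => m; rewrite !ffunE /=.
by case: ifP.
Qed.

Lemma in_stripE n l i (t : tile n) : in_strip l i t = in_lstrip l i (loc t).
Proof. by rewrite /in_lstrip /= ffunE. Qed.

Lemma compress_fill_of n l i M : fits n (map fst M) ->
  compress l i (fill_of n M) =
  fill_of n [seq (lshift l i a.1, a.2) | a <- M & ~~ in_lstrip l i a.1].
Proof.
move=> fM; apply/setP => p; rewrite [RHS]inE; apply/imsetP/mapP => [[s]|[a]].
  rewrite !inE in_stripE => /andP[sM ns] ->; exists (loc s.1, s.2); rewrite ?mem_filter ?ns //.
  by rewrite loc_shift.
rewrite mem_filter => /andP[na aM] e; have [t et] := loc_surj (fM _ (map_f fst aM)).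
exists (t, a.2); first by rewrite !inE /= in_stripE et na -surjective_pairing aM.
have /= e1 := congr1 fst e; have /= e2 := congr1 snd e.
rewrite [p]surjective_pairing e2; congr (_, _).
by apply: loc_inj; rewrite loc_shift et.
Qed.

Lemma count_take_lt (T : eqType) (x0 : T) (s : seq T) k j : k < j -> j <= size s ->
  count_mem (nth x0 s k) (take k s) < count_mem (nth x0 s k) (take j s).
Proof.
move=> kj js; have ks : k < size s by apply: leq_trans kj js.
have -> : take j s = take k s ++ nth x0 s k :: take (j - k.+1) (drop k.+1 s).
  rewrite -{1}(cat_take_drop k s) take_cat size_takel ?(ltnW ks) // ltnNge (ltnW kj) /=.
  by rewrite (drop_nth x0) // -[j - k](subnSK kj).
by rewrite count_cat /= eqxx; lia.
Qed.

(** Removing the strand at position [z] from the word translates the tile of a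
    crossing away from this strand as [compress] does. *)
Lemma tile_at_del X x Y p c w' : sweep (X ++ x :: Y) p c = Some w' ->
  let l := letter_of x in let i := count_mem l (map letter_of X) in
  in_lstrip l i (tile_at (X ++ x :: Y) p) = (p == size X) || (p.+1 == size X) /\
  (p != size X -> p.+1 != size X ->
   tile_at (X ++ Y) (if p < size X then p else p.-1) = lshift l i (tile_at (X ++ x :: Y) p)).
Proof.
move=> s l i; set w := X ++ x :: Y in s *.
have [A [a [b [B [K [ew ep hK et _]]]]]] := sweep_tile s; have [eB eC] := kind_ofP hK.
have [/= lw _ _] := sweep_rk s; have hp : p.+1 < size w by have [_ /andP[]] := sweep_rk s.
set v := vertex_of _ in et.
have ev m : v m = count_mem m (take p (map letter_of w)).
  by rewrite ew map_cat take_size_cat ?size_map // vertex_ofE.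
have nthp : nth La (map letter_of w) p = kindB K.
  by rewrite (nth_map LiveA) ?(ltnW hp) // ew ep nth_cat ltnn subnn eB.
have nthp1 : nth La (map letter_of w) p.+1 = kindC K.
  by rewrite (nth_map LiveA) // ew ep nth_cat ltnNge leqnSn /= subSnn eC.
have nBC : kindB K != kindC K by case: (K).
have ei : i = count_mem l (take (size X) (map letter_of w)).
  by rewrite map_cat take_size_cat // size_map.
have nthz : nth La (map letter_of w) (size X) = l.
  by rewrite (nth_map LiveA) /w ?nth_cat ?ltnn ?subnn ?size_cat //= addnS ltnS leq_addr.
have sX : (size X).+1 <= size (map letter_of w) by rewrite size_map size_cat /= addnS ltnS leq_addr.
have hp' : p.+1 < size (map letter_of w) by rewrite size_map.
have gtz k : size X < k -> k <= size (map letter_of w) -> i < count_mem l (take k (map letter_of w)).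
  by move=> h1 h2; rewrite ei -{1 2}nthz; apply: count_take_lt.
split.
  rewrite et /in_lstrip /has_letter /= ev; apply/andP/orP => [[hl /eqP e]|].
    have zp : p <= size X.
      by rewrite leqNgt; apply/negP => /gtz h; have := h (ltnW (ltnW hp')); rewrite e ltnn.
    case/orP: hl => /eqP el.
      left; rewrite eqn_leq zp leqNgt; apply/negP => h.
      have := count_take_lt La h (ltnW sX); rewrite nthp -el -ei e ltnn //.
    right; rewrite eqn_leq; have nz : p != size X.
      apply/eqP => epz; case/negP: nBC; rewrite -nthp epz nthz el //.
    rewrite ltn_neqAle nz zp /= leqNgt; apply/negP => h.
    have h1 := count_take_lt La h (ltnW sX); rewrite nthp1 -el -ei -e in h1.
    rewrite (take_nth La) ?(ltnW hp') // -cats1 count_cat in h1.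
    by move: h1; rewrite ltnNge leq_addr.
  case=> /eqP epz; split.
  - by rewrite -nthp epz nthz eqxx.
  - by rewrite epz -ei eqxx.
  - by rewrite -nthp1 epz nthz eqxx orbT.
  - rewrite ei -epz (take_nth La) ?(ltnW hp') // -cats1 count_cat /= addn0.
    have -> : (nth La (map letter_of w) p == l) = false.
      by rewrite nthp -nthz -epz nthp1; apply/negbTE.
    by rewrite addn0.
move=> n1 n2; rewrite et /lshift /=.
set p' := if _ then _ else _.
have nE k : k < size w -> k != size X ->
    nth LiveA (X ++ Y) (if k < size X then k else k.-1) = nth LiveA w k.
  move=> hk nk; rewrite /w !nth_cat; case: (ltnP k (size X)) => h; first by rewrite h.
  have hk1 : size X < k by rewrite ltn_neqAle eq_sym nk h.
  have -> : (k.-1 < size X) = false by lia.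
  by have -> : k - size X = (k.-1 - size X).+1 by lia.
have ep1 : p'.+1 = if p.+1 < size X then p.+1 else p.+1.-1 by rewrite /p'; case: (ltnP p (size X)); case: (ltnP p.+1 (size X)); lia.
have n1' : nth LiveA (X ++ Y) p' = a by rewrite nE ?(ltnW hp) // ew ep nth_cat ltnn subnn.
have n2' : nth LiveA (X ++ Y) p'.+1 = b.
  by rewrite ep1 nE // ew ep nth_cat ltnNge leqnSn /= subSnn.
rewrite /tile_at n1' n2' hK /=; congr (_, _); apply/ffunP => m; rewrite vertex_ofE !ffunE.
rewrite -[count_mem m _ in RHS]vertex_ofE -/v.
have [lt|ge] := ltnP p (size X).
  have -> : count_mem m (take p' (map letter_of (X ++ Y))) = v m.
    by rewrite ev /p' lt /w !map_cat !take_cat size_map lt.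
  case: eqP => //= em; have -> // : (i < v m) = false.
  apply/negbTE; rewrite -leqNgt em ev ei -(subnKC (ltnW lt)).
  by rewrite takeD count_cat leq_addr.
have gt : size X < p by rewrite ltn_neqAle eq_sym n1 ge.
have ec : v m = count_mem m (take p' (map letter_of (X ++ Y))) + (m == l).
  rewrite ev /p' ltnNge ge /= /w !map_cat !take_cat size_map ltnNge ge /=.
  have -> : (p.-1 < size X) = false by lia.
  have -> : p - size X = (p.-1 - size X).+1 by lia.
  by rewrite /= !count_cat /= /l [m == letter_of x]eq_sym; lia.
rewrite ec; case: eqP => [em|_] /=; last by rewrite addn0.
have -> : i < count_mem m (take p' (map letter_of (X ++ Y))) + 1.
  rewrite addn1 ltnS em /i /p' ltnNge ge /= map_cat take_cat size_map.
  have -> : (p.-1 < size X) = false by lia.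
  by rewrite count_cat leq_addr.
by rewrite addn1.
Qed.

(** A dead strand is crossed without labels. *)
Lemma inert_dead X x Y H u : dead x -> run (X ++ x :: Y) H = Some u -> inert x (size X) H.
Proof.
move=> dx; elim: H X Y => // -[p c] H IH X Y r; have [w' s r'] := run_cons r.
have kx : killer x = None by case: x dx {IH r s}.
rewrite inert_cons kx; have [X1 [Y1 [ew h1 h2 h3]]] := sweep_dead dx s.
case: eqP => [e|/eqP/negbTE e] /=; first by have [-> _ _ _] := h2 e.
case: eqP => [e'|/eqP/negbTE e']; first by have [-> _ _ _] := h3 e'.
by have [<- _] := h1 e e'; apply: (IH X1 Y1); rewrite -ew.
Qed.

Lemma sweep_perm_letters w p c w' : sweep w p c = Some w' -> perm_eq (map letter_of w') (map letter_of w).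
Proof.
move=> /sweepP[X [x [y [Y [x' [y' [-> _ /cross_rank[_ /= ly lx] ->]]]]]]].
by rewrite !map_cat /= ly lx perm_cat2l -(cat1s (letter_of y)) -(cat1s (letter_of x)) perm_catCA.
Qed.

Lemma cat_prefix (T : Type) (A A' B B' : seq T) : A ++ B = A' ++ B' -> size A = size A' -> A = A'.
Proof. by move=> e es; have := congr1 (take (size A)) e; rewrite take_size_cat // es take_size_cat. Qed.

(** Strands of the same letter do not cross. *)
Lemma index_sweep X x Y p c X1 x1 Y1 : sweep (X ++ x :: Y) p c = Some (X1 ++ x1 :: Y1) ->
  size X1 = (if p == size X then p.+1 else if p.+1 == size X then p else size X) ->
  count_mem (letter_of x) (map letter_of X1) = count_mem (letter_of x) (map letter_of X).
Proof.
move=> /sweep_marked [[hp [X' [s sX ew]]]|[hp [X0 [y [x' [y' [eX hc ew]]]]]]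
  |[hp [y [Y0 [x' [y' [eY hc ew]]]]]]|[hp [Y' [s ew]]]] e1.
- have e : size X1 = size X' by rewrite sX e1; case: eqP; [|case: eqP] => *; lia.
  by rewrite (cat_prefix ew e); have /permP-> := sweep_perm_letters s.
- have [lt /= lx ly] := cross_rank hc.
  have e : size X1 = size X0.
    by rewrite e1 -hp eqxx; case: eqP; [lia|]; move: hp; rewrite eX size_rcons => -[->].
  rewrite (cat_prefix ew e) eX map_rcons -cats1 count_cat /= addn0.
  by case: eqP => [el|_]; rewrite ?addn0 //; move: lt; rewrite /rank el ltnn.
- have [lt /= ly lx] := cross_rank hc.
  have e : size X1 = size (rcons X y') by rewrite e1 hp eqxx size_rcons.
  rewrite (cat_prefix ew e) map_rcons -cats1 count_cat /= addn0 ly.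
  by case: eqP => [el|_]; rewrite ?addn0 //; move: lt; rewrite /rank el ltnn.
- have e : size X1 = size X by rewrite e1; case: eqP; [|case: eqP] => *; lia.
  by rewrite (cat_prefix ew e).
Qed.

Lemma tiles_del X x Y H u : letter_of x != La -> inert x (size X) H ->
  run (X ++ x :: Y) H = Some u ->
  tiles (X ++ Y) (del_strand (size X) H) =
  [seq (lshift (letter_of x) (count_mem (letter_of x) (map letter_of X)) a.1, a.2)
     | a <- tiles (X ++ x :: Y) H
     & ~~ in_lstrip (letter_of x) (count_mem (letter_of x) (map letter_of X)) a.1].
Proof.
elim: H X x Y => // -[p c] H IH X x Y la; rewrite inert_cons => hi r.
have [w' s r'] := run_cons r; have [t1 t2] := tile_at_del s.
have kla : letter_of (kill x) != La by rewrite letter_kill.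
have ix X1 x1 Y1 : w' = X1 ++ x1 :: Y1 ->
   size X1 = (if p == size X then p.+1 else if p.+1 == size X then p else size X) ->
   count_mem (letter_of x) (map letter_of X1) = count_mem (letter_of x) (map letter_of X).
  by move=> ew; apply: (@index_sweep X x Y p c X1 x1 Y1); rewrite s ew.
have [[n1 n2 [X1 [Y1 [ew sX s1]]]]|[e1 lD h]|[e1 lE h]] := sweep_inert la s.
- have cX := ix _ _ _ ew; rewrite (negbTE n1) (negbTE n2) in cX hi.
  rewrite -sX in hi; rewrite ew in r'.
  have IHr := IH X1 x Y1 la hi r'; rewrite sX cX // -ew in IHr.
  by rewrite /= s /= t1 (negbTE n1) (negbTE n2) /= s1 /= t2 // IHr.
- have cX := ix _ (kill x) _ _; rewrite e1 eqxx [_ || _]/= in hi cX.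
  have [X1 [Y1 [ew sX eXY]]] := h (eqP hi).
  rewrite ew in r'; have hd := inert_dead (dead_kill la) r'.
  have IHr := IH X1 (kill x) Y1 kla hd r'.
  rewrite letter_kill (cX _ _ ew) // ?sX ?e1 // -ew eXY in IHr.
  by rewrite /= s /= t1 e1 eqxx /= IHr.
- have n1 : (p == size X) = false by lia.
  have cX := ix _ (kill x) _ _; rewrite n1 e1 eqxx [_ || _]/= in hi cX.
  have [X1 [Y1 [ew sX eXY]]] := h (eqP hi).
  rewrite ew in r'; have hd := inert_dead (dead_kill la) r'.
  have IHr := IH X1 (kill x) Y1 kla hd r'.
  rewrite letter_kill (cX _ _ ew) // ?sX // -ew eXY in IHr.
  by rewrite /= s /= t1 n1 e1 eqxx /= IHr.
Qed.

(** Compressing the strip of an inert strand deletes this strand from the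
    history. *)
Lemma compress_swept n U l V H (F : filling n) : l != La -> inert (live l) (size U) H ->
  swept (U ++ l :: V) H F -> size (U ++ l :: V) <= n ->
  swept (U ++ V) (del_strand (size U) H) (compress l (count_mem l U) F).
Proof.
move=> la hi [u [r fu eF]] hn; have hf := tiles_fit r; rewrite size_map in hf.
have ll : letter_of (live l) = l by case: l {hi eF r hf hn la}.
have sU : size (map live U) = size U by rewrite size_map.
rewrite map_cat /= in r eF hf; rewrite -sU in hi.
have [|X' [x' [Y' [eu lx rd]]]] := run_del _ hi r; first by rewrite ll.
exists (X' ++ Y'); rewrite map_cat -sU; split=> //.
  by apply: (@final_del _ x'); rewrite -eu.
rewrite eF compress_fill_of; last exact: hf.
by rewrite (tiles_del _ hi r) ?ll // map_letter_live.
Qed.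

(** * Inserting a strip *)

Lemma final_cat_le X x Y : final (X ++ x :: Y) ->
  (forall m, m \in map letter_of X -> lrank m <= rank x) /\
  (forall m, m \in map letter_of Y -> rank x <= lrank m).
Proof.
move=> /finalP; rewrite map_cat /= (sorted_pairwise leq_trans) pairwise_cat allrel_consr.
case/and3P=> /andP[/allP h1 _] _ /andP[/allP h2 _]; have e Z : map rank Z = map lrank (map letter_of Z).
  by rewrite -map_comp.
by split=> m hm; [apply: h1 | apply: h2]; rewrite e map_f.
Qed.

(** Each crossing brings one letter to the other side of the strand, and in
    the final path the letters are sorted. *)
Lemma count_strip X x Y H u : letter_of x != La -> run (X ++ x :: Y) H = Some u -> final u ->
  count (fun a => in_lstrip (letter_of x) (count_mem (letter_of x) (map letter_of X)) a.1)
    (tiles (X ++ x :: Y) H) =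
  if letter_of x == Ld then count (predC1 Ld) (map letter_of Y)
  else count (predC1 Le) (map letter_of X).
Proof.
move=> + + fu; elim: H X x Y => [|[p c] H IH] X x Y la r.
  case: r => eu; rewrite -eu in fu; have [h1 h2] := final_cat_le fu => /=.
  have [ld|nld] := eqVneq (letter_of x) Ld; apply/esym/eqP; rewrite -leqn0 leqNgt -has_count; apply/hasPn.
    by move=> m /h2; rewrite /rank ld; case: m.
  have le : letter_of x = Le by case: (letter_of x) la nld.
  by move=> m /h1; rewrite /rank le; case: m.
have [w' s r'] := run_cons r; have [t1 _] := tile_at_del s.
rewrite /= s /= t1.
case: (sweep_marked s) => [[hp [X' [sX' sX ew]]]|[hp [X0 [y [x' [y' [eX hc ew]]]]]]
  |[hp [y [Y0 [x' [y' [eY hc ew]]]]]]|[hp [Y' [sY' ew]]]].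
- have -> : (p == size X) = false by lia.
  have -> : (p.+1 == size X) = false by lia.
  have pX := sweep_perm_letters sX'; rewrite ew in r' *.
  by rewrite -(permP pX) (IH _ _ _ la r') (permP pX).
- have [lt /= lx' ly'] := cross_rank hc.
  have -> : (p == size X) = false by lia.
  have le : letter_of x = Le by move: la lt; rewrite /rank; clear; case: (letter_of x) => //; case: (letter_of y).
  have ny : letter_of y != Le by apply/eqP => e; move: lt; rewrite /rank le e.
  rewrite hp eqxx /= ew in r' *.
  have := IH X0 x' (y' :: Y) _ r'; rewrite lx' le /= => /(_ isT).
  have -> : count_mem Le (map letter_of X) = count_mem Le (map letter_of X0).
    by rewrite eX map_rcons -cats1 count_cat /= (negbTE ny) !addn0.
  by move=> ->; rewrite eX map_rcons -cats1 count_cat /= ny addn0 addnC.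
- have [lt /= ly' lx'] := cross_rank hc.
  have ld : letter_of x = Ld.
    by move: la lt; rewrite /rank; clear; case: (letter_of x) => //; case: (letter_of y).
  have ny : letter_of y != Ld by apply/eqP => e; move: lt; rewrite /rank ld e.
  rewrite hp eqxx /= ew in r' *.
  have := IH (rcons X y') x' Y0 _ r'; rewrite lx' ld /= => /(_ isT).
  have -> : count_mem Ld (map letter_of (rcons X y')) = count_mem Ld (map letter_of X).
    by rewrite map_rcons -cats1 count_cat /= ly' (negbTE ny) !addn0.
  by move=> ->; rewrite eY /= ny.
- have -> : (p == size X) = false by lia.
  have -> : (p.+1 == size X) = false by lia.
  have pY := sweep_perm_letters sY'; rewrite ew in r' *.
  by rewrite (IH _ _ _ la r') (permP pY).
Qed.

(** The contents required of an inserted strip say that its strand dies at its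
    first crossing. *)
Lemma inert_contents X x Y H u : letter_of x != La -> ~~ dead x ->
  run (X ++ x :: Y) H = Some u -> final u ->
  let l := letter_of x in let M := tiles (X ++ x :: Y) H in
  (forall a, a \in M -> in_lstrip l (count_mem l (map letter_of X)) a.1 ->
     a.2 = if has (fun b => beyond l a.1 b.1) M then Cempty else symbol l)
  <-> inert x (size X) H.
Proof.
move=> la nd + fu; elim: H X Y => [|[p c] H IH] X Y r //=.
have [w' s r'] := run_cons r; have [t1 _] := tile_at_del s; have hT := tiles_tiled r' fu.
have kx : killer x = Some (symbol (letter_of x)) by clear -la nd; case: x la nd.
have nE : symbol (letter_of x) != Cempty by clear -la; case: x la.
rewrite s inert_cons; set l := letter_of x in t1 kx nE *; set i := count_mem l _ in t1 *.
set t := tile_at _ p in t1 *; set M := tiles _ H in hT *.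
have mM a : a \in M -> a.1 \in map fst M by apply: map_f.
have nb : has (fun b => beyond l t b.1) ((t, odflt Cempty c) :: M) = false.
  apply/hasPn => b; rewrite inE => /orP[/eqP->|bM] /=; first by rewrite beyond_irr.
  by rewrite (beyond_later l s hT (mM _ bM)).2.
have [ht|ht] := boolP (in_lstrip l i t); last first.
  have [n1 n2] : (p == size X) = false /\ (p.+1 == size X) = false.
    by move: ht; rewrite t1 negb_or => /andP[/negbTE-> /negbTE->].
  have [[_ _ [X1 [Y1 [ew sX _]]]]|[e1]|[e1]] := sweep_inert la s; try by rewrite e1 eqxx in n1 n2.
  have cX : count_mem l (map letter_of X1) = i.
    apply: (@index_sweep X x Y p c X1 x Y1); first by rewrite s ew.
    by rewrite n1 n2.
  have hb (a : ltile * content) : in_lstrip l i a.1 -> beyond l a.1 t = false.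
    move=> /andP[_ /eqP ei]; apply/negP => hb; case/negP: ht.
    by move: hb; rewrite /beyond /in_lstrip ei => /and4P[-> _ /eqP -> _]; rewrite eqxx.
  rewrite n1 n2 /=; rewrite ew in r'; have /= := IH _ _ r'; rewrite sX -ew -/l cX -/i -/M => <-.
  split=> h a.
    move=> aM ha; have := h a _ ha; rewrite inE aM orbT (hb _ ha) => -> //.
  rewrite inE => /orP[/eqP->|aM] ha; first by rewrite ha in ht.
  by rewrite (hb _ ha); apply: h.
rewrite -t1 ht kx; split=> [h|/eqP ec].
  have := h (t, odflt Cempty c) _ ht; rewrite mem_head => /(_ isT).
  rewrite [X in if X then _ else _]nb /= => e; apply/eqP.
  by clear -nE e; case: c e => [c|] /= e; [rewrite e | rewrite -e eqxx in nE].
have hl : has_letter l t by case/andP: ht.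
move=> a; rewrite inE => /orP[/eqP->|aM] ha.
  by rewrite [X in if X then _ else _]nb /= ec.
have lb : beyond l a.1 t.
  apply: (later_beyond s hT (mM _ aM)) => //.
  by case/andP: ht => _ /eqP ->.
rewrite lb /=; have [_ _ h3] := tiles_well_filled r' fu.
case/andP: (ha) => hla /eqP ei; apply: (h3 l) => //.
by rewrite (status_sweep _ s) // ei ec eqxx andbT -/t ht orbT.
Qed.

(** [slot l m U V]: the point between [U] and [V] is where a strip of length [m]
    starting with the letter [l] is inserted. *)
Definition slot (l : letter) (m : nat) (U V : seq letter) : bool :=
  match l with
  | Ld => (count (predC1 Ld) V == m) && (ohead V != Some Ld)
  | Le => (count (predC1 Le) U == m) && (ohead (rev U) != Some Le)
  | La => false
  end.

Definition insert_strip (n : nat) (l : letter) (m : nat) (W : seq letter) (G : filling n)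
    (WT : seq letter) (T : filling n) : bool :=
  match l with
  | Ld => insert_beta m W G WT T
  | Le => insert_alpha m W G WT T
  | La => false
  end.

(** The condition on the contents in the definition of an insertion: the
    symbol is in the first tile. *)
Definition inserted_contents (n : nat) (l : letter) (i : nat) (T : filling n) : bool :=
  [forall p in T, in_strip l i p.1 ==>
     (p.2 == if [exists s in T, further l T s.1 p.1] then Cempty else symbol l)].

Lemma insert_stripP n l m W (G : filling n) WT T :
  insert_strip l m W G WT T <-> exists U V,
    [/\ W = U ++ V, slot l m U V, WT = U ++ l :: V & compress l (count_mem l U) T = G /\
        inserted_contents l (count_mem l U) T].
Proof.
have aux (P : seq letter -> seq letter -> bool) :
    (exists k : 'I_(size W).+1, P (take k W) (drop k W)) <->
    (exists U V, W = U ++ V /\ P U V).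
  split=> [[k h]|[U [V [eW h]]]]; first by exists (take k W), (drop k W); rewrite cat_take_drop.
  have hU : size U < (size W).+1 by rewrite eW size_cat ltnS leq_addr.
  by exists (Ordinal hU) => /=; rewrite eW take_size_cat // drop_size_cat.
case: l => //=; last first.
- rewrite /insert_alpha; split=> [/existsP[k h]|[U [V [eW /andP[h1 h2] eWT [h3 h4]]]]].
    exists (take k W), (drop k W); rewrite cat_take_drop.
    by case/and5P: h => -> -> /eqP -> /eqP -> h5.
  apply/existsP/(aux (fun U V => [&& count (predC1 Le) U == m, ohead (rev U) != Some Le,
    WT == U ++ Le :: V, compress Le (count_mem Le U) T == G & inserted_contents Le (count_mem Le U) T])).
  by exists U, V; rewrite h1 h2 eWT h3 !eqxx.
- by split=> // -[U [V []]].
rewrite /insert_beta; split=> [/existsP[k h]|[U [V [eW /andP[h1 h2] eWT [h3 h4]]]]].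
  exists (take k W), (drop k W); rewrite cat_take_drop.
  by case/and5P: h => -> -> /eqP -> /eqP -> h5.
apply/existsP/(aux (fun U V => [&& count (predC1 Ld) V == m, ohead V != Some Ld,
  WT == U ++ Ld :: V, compress Ld (count_mem Ld U) T == G & inserted_contents Ld (count_mem Ld U) T])).
by exists U, V; rewrite h1 h2 eWT h3 !eqxx.
Qed.

Lemma slot_letter l m U V : slot l m U V -> l != La. Proof. by case: l. Qed.

Lemma letter_of_live l : letter_of (live l) = l. Proof. by case: l. Qed.
Lemma live_not_dead l : ~~ dead (live l). Proof. by case: l. Qed.

(** This is where the choice of the southernmost or easternmost point matters:
    a strand inserted there makes a corner of the path, unless it is never
    crossed at all. *)
Lemma slot_exposed l m U V : slot l m U V -> exposed (map live U) (live l) (map live V).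
Proof.
case: l => //= /andP[_]; rewrite /exposed /=; first by case: V => // -[].
by rewrite -map_rev; case: (rev U) => // -[].
Qed.

Lemma suffix_slot_unique (l : letter) m U V U' V' : U ++ V = U' ++ V' ->
  (count (predC1 l) V == m) && (ohead V != Some l) ->
  (count (predC1 l) V' == m) && (ohead V' != Some l) -> U = U'.
Proof.
wlog le : U V U' V' / size U <= size U'.
  by move=> hw; case/orP: (leq_total (size U) (size U')) => h e s1 s2;
    [apply: (hw _ _ _ _ h e) | apply/esym/(hw _ _ _ _ h (esym e))].
move=> e /andP[/eqP c1 h1] /andP[/eqP c2 _].
have eU : U' = U ++ drop (size U) U'.
  have := congr1 (take (size U)) e; rewrite take_size_cat // takel_cat // => {1}->.
  by rewrite cat_take_drop.
move: e; rewrite eU -catA => /eqP; rewrite eqseq_cat // eqxx /= => /eqP eV.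
move: c1; rewrite eV count_cat c2; case eD: (drop _ _) eV => [|d D] eV; first by rewrite cats0.
move=> /eqP; rewrite -[X in _ == X]add0n eqn_add2r -leqn0 leqNgt -has_count /= negb_or => /andP[hd _].
by move: h1; rewrite eV /=; move/negPn/eqP: hd => ->; rewrite eqxx.
Qed.

Lemma slot_unique l m U V U' V' : U ++ V = U' ++ V' -> slot l m U V -> slot l m U' V' ->
  U = U' /\ V = V'.
Proof.
move=> e s1 s2.
have both : U = U' -> U = U' /\ V = V'.
  move=> eU; split=> //; move/eqP: e.
  by rewrite eU eqseq_cat // eqxx => /eqP.
case: l s1 s2 => // s1 s2; apply: both; first exact: suffix_slot_unique e s1 s2.
have eV : rev V = rev V'.
  apply: (@suffix_slot_unique Le m _ (rev U) _ (rev U')); rewrite -?rev_cat ?e ?count_rev //.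
have /(can_inj revK) eVV := eV; subst V'; apply: (can_inj revK).
by have /eqP := congr1 rev e; rewrite !rev_cat eqseq_cat // eqxx => /eqP.
Qed.

Lemma suffix_slot_exists (l : letter) m W : m <= count (predC1 l) W ->
  exists U V, W = U ++ V /\ (count (predC1 l) V == m) && (ohead V != Some l).
Proof.
elim: W => [|x W IH] /=; first by rewrite leqn0 => /eqP ->; exists [::], [::].
have [le _|gt hm] := leqP m (count (predC1 l) W).
  by have [U [V [-> h]]] := IH le; exists (x :: U), V.
exists [::], (x :: W); split=> //=; case: eqP hm => [_|/eqP nx] /= hm; first by rewrite leqNgt gt in hm.
by rewrite eqn_leq hm gt /=; apply: contra nx => /eqP[->].
Qed.

Lemma slot_exists l m W : l != La -> m <= count (predC1 l) W ->
  exists U V, W = U ++ V /\ slot l m U V.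
Proof.
case: l => // _; first exact: suffix_slot_exists.
rewrite -count_rev => /suffix_slot_exists[U [V [e h]]].
exists (rev V), (rev U); rewrite -rev_cat -e revK; split=> //.
by rewrite /slot revK count_rev.
Qed.

Lemma killer_live l : l != La -> killer (live l) = Some (symbol l). Proof. by case: l. Qed.

(** A strip can be inserted in every filling: its strand dies when it first meets
    another one, and the strands next to it are alive. *)
Lemma exists_inert U l V K u :
  exposed (map live U) (live l) (map live V) ->
  run (map live U ++ map live V) K = Some u -> final u ->
  exists H u', [/\ run (map live U ++ live l :: map live V) H = Some u', final u',
    inert (live l) (size U) H & del_strand (size U) H = K].
Proof.
rewrite -[size U](size_map live); move=> ex r fu.
move eX: (map live U) ex r => X ex r.
move eY: (map live V) ex r => Y ex r; set x := live l in ex *.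
have la : letter_of x != La by move: ex; rewrite /exposed; case: letter_of.
have viaC p : corner p (X ++ x :: Y) -> (p == size X) || (p.+1 == size X) ->
    (exists s, sweep (X ++ x :: Y) p (killer x) = Some s) ->
    exists H u', [/\ run (X ++ x :: Y) H = Some u', final u', inert x (size X) H & del_strand (size X) H = K].
  move=> cp tp [w s].
  have [[/negbTE n1 /negbTE n2 _]|[e1 _ /(_ erefl) [X1 [Y1 [ew sX eXY]]]]|[e1 _ /(_ erefl) [X1 [Y1 [ew sX eXY]]]]] := sweep_inert la s.
  - by rewrite n1 n2 in tp.
  - rewrite -eXY in r; have [H [u' [rH fu' dH]]] := insert_dead (dead_kill la) r fu.
    exists ((p, killer x) :: H), u'; split=> //; first by rewrite /= s /= ew.
      by rewrite inert_cons tp.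
    by rewrite /= e1 eqxx -e1 -sX.
  - rewrite -eXY in r; have [H [u' [rH fu' dH]]] := insert_dead (dead_kill la) r fu.
    exists ((p, killer x) :: H), u'; split=> //; first by rewrite /= s /= ew.
      by rewrite inert_cons tp.
    have ne : (p == size X) = false by clear -e1; lia.
    by rewrite /= ne e1 eqxx -sX.
have viaU H u' : run (X ++ kill x :: Y) H = Some u' -> final u' -> del_strand (size X) H = K ->
    first_touch (size X) H = None ->
    exists H u', [/\ run (X ++ x :: Y) H = Some u', final u', inert x (size X) H & del_strand (size X) H = K].
  move=> rH fu' dH t; have [X1 [Y1 [eu r1]]] := run_untouched x t rH.
  exists H, (X1 ++ x :: Y1); split=> //; last by rewrite /inert t inE eqxx.
  move: fu'; rewrite eu => /finalP h; apply/finalP; move: h.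
  by rewrite !map_cat /= /rank letter_kill.
have [H0 [u0 [r0 fu0 d0]]] := @insert_dead X (kill x) Y K u (dead_kill la) r fu.
move: ex; rewrite /exposed; case lx: (letter_of x) => // ex.
- have kx : x = LiveD by move: lx; rewrite /x; case: (l).
  case: V eY => [|y V] eY; subst Y.
    by apply: (viaU _ _ r0 fu0 d0); apply: untouched_d r0; rewrite letter_kill.
  rewrite /= in ex viaC viaU r0 *; apply: (viaC (size X)); rewrite ?eqxx //.
    by rewrite corner_cat /rank lx; case: letter_of ex.
  by rewrite sweep_cat kx; case: (y) ex => //; eexists.
- have kx : x = LiveE by move: lx; rewrite /x; case: (l).
  case/lastP: U eX => [|U y] eX; subst X.
    by apply: (viaU _ _ r0 fu0 d0); apply: untouched_e r0; rewrite letter_kill.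
  rewrite map_rcons in ex viaC viaU r0 d0 *.
  rewrite rev_rcons in ex; apply: (viaC (size (map live U))); rewrite ?size_rcons ?eqxx ?orbT //.
    by rewrite cat_rcons corner_cat /rank lx; case: letter_of ex.
  by rewrite cat_rcons sweep_cat kx; case: (y) ex => //; eexists.
Qed.

(** In terms of histories the inserted strip is an inert strand. *)
Lemma inserted_contentsP n U l V H (T : filling n) : l != La ->
  swept (U ++ l :: V) H T -> size (U ++ l :: V) <= n ->
  inserted_contents l (count_mem l U) T <-> inert (live l) (size U) H.
Proof.
move=> la hT hn; have hF := swept_further hT hn; have hp := perm_mem (swept_loc_list hT hn).
case: (hT) => u [r fu _]; rewrite map_cat /= in r.
have := inert_contents _ (live_not_dead l) r fu.
rewrite letter_of_live => /(_ la); rewrite map_letter_live size_map => <-.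
rewrite map_cat in hp; set M := tiles _ H in hp *.
have hE (p : placed n) : p \in T -> [exists s in T, further l T s.1 p.1] =
    has (fun b => beyond l (loc p.1) b.1) M.
  move=> pT; apply/exists_inP/hasP => [[s sT h]|[b]].
    by exists (loc s.1, s.2); rewrite -?hp ?loc_listE // -hF.
  by rewrite -hp => /mapP[s]; rewrite mem_enum => sT -> /= h; exists s => //; rewrite hF.
split=> [/forall_inP h a|h].
  rewrite -hp => /mapP[p]; rewrite mem_enum => pT -> /= hs.
  by have := h p pT; rewrite in_stripE hs hE // => /eqP.
apply/forall_inP => p pT; apply/implyP; rewrite in_stripE => hs; rewrite hE //; apply/eqP.
by apply: (h (loc p.1, p.2)) => //; rewrite -hp loc_listE.
Qed.

Lemma fill_of_heq n W H H' u u' : size W <= n ->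
  run (map live W) H = Some u -> final u -> run (map live W) H' = Some u' -> final u' ->
  fill_of n (tiles (map live W) H) = fill_of n (tiles (map live W) H') -> heq H H'.
Proof.
move=> hn r fu r' fu' e; apply: (heq_of_tiles r fu r' fu').
have h : swept W H (fill_of n (tiles (map live W) H)) by exists u.
have h' : swept W H' (fill_of n (tiles (map live W) H)) by exists u'; rewrite e.
by rewrite -(permPl (swept_loc_list h hn)); apply: swept_loc_list h' hn.
Qed.

(** The result of an insertion is determined up to equivalence; with
    [heq_del_inert] and [slot_unique] it does not depend on the path which is
    blown up. *)
Lemma insert_strip_heq n l m W K u (WT : seq letter) HT (T : filling n) :
  run (map live W) K = Some u -> final u -> swept WT HT T -> size WT <= n ->
  insert_strip l m W (fill_of n (tiles (map live W) K)) WT T ->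
  exists U V, [/\ W = U ++ V, slot l m U V, WT = U ++ l :: V, inert (live l) (size U) HT
    & heq (del_strand (size U) HT) K].
Proof.
move=> r fu hT hn /insert_stripP[U [V [eW hs eWT [eC hc]]]]; subst WT; have la := slot_letter hs.
have hi := (inserted_contentsP la hT hn).1 hc.
have [u' [r' fu' e']] := compress_swept la hi hT hn.
exists U, V; split=> //; rewrite eC eW in e'; rewrite eW in r.
apply: (@fill_of_heq n (U ++ V) _ _ _ _ _ r' fu' r fu (esym e')).
by apply: leq_trans hn; rewrite !size_cat /= addnS.
Qed.

Lemma insert_strip_exists n l m U V K u : slot l m U V -> size (U ++ l :: V) <= n ->
  run (map live (U ++ V)) K = Some u -> final u ->
  exists H u', [/\ run (map live (U ++ l :: V)) H = Some u', final u',
    inert (live l) (size U) H, del_strand (size U) H = K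
    & insert_strip l m (U ++ V) (fill_of n (tiles (map live (U ++ V)) K)) (U ++ l :: V)
        (fill_of n (tiles (map live (U ++ l :: V)) H))].
Proof.
move=> hs hn r fu; have la := slot_letter hs; have r0 := r; rewrite map_cat in r0.
have [H [u' [r' fu' hi hd]]] := exists_inert (slot_exposed hs) r0 fu.
exists H, u'; rewrite map_cat; split=> //.
have hT : swept (U ++ l :: V) H (fill_of n (tiles (map live (U ++ l :: V)) H)).
  by exists u'; rewrite map_cat.
rewrite -map_cat; apply/insert_stripP; exists U, V; split=> //; split.
  have [u1 [_ _ ->]] := compress_swept la hi hT hn.
  by rewrite hd.
exact/(inserted_contentsP la hT hn).
Qed.

(** * Classes of tableaux as classes of histories *)

Lemma mem_class n r (F G : RAT n r) : (F \in val (class G)) = (equivalent G F).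
Proof. by rewrite /= inE. Qed.

Lemma equivalent_trans n r : transitive (@equivalent n r).
Proof. exact: connect_trans. Qed.

Lemma class_eq n r (F G : RAT n r) : class F = class G <-> equivalent F G.
Proof.
split=> [e|e]; first by rewrite -mem_class e mem_class; apply: connect0.
apply/val_inj/setP => K /=; rewrite !inE; apply/idP/idP => h.
  by apply: equivalent_trans h; rewrite equivalent_sym.
exact: equivalent_trans e h.
Qed.

Lemma mem_Psi n r (psi : Psi n r) F : (F \in val psi) <-> psi = class F.
Proof.
case/existsP: (valP psi) => G /eqP e.
have {e}-> : psi = class G by apply: val_inj.
by rewrite mem_class class_eq.
Qed.

Definition in_class (n r : nat) (psi : Psi n r) (W : seq letter) (H : history) : Prop :=
  exists F, [/\ psi = class F, word F = W :> seq letter & hist_of F H].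

Lemma in_class_of_hist n r (F : RAT n r) H : hist_of F H -> in_class (class F) (word F) H.
Proof. by exists F. Qed.

Lemma in_class_exists n r (psi : Psi n r) : exists W H, in_class psi W H.
Proof.
case/existsP: (valP psi) => F /eqP e; have [H hF] := hist_exists F.
by exists (word F), H, F; split=> //; apply: val_inj.
Qed.

Lemma in_classP n r (psi : Psi n r) W H : in_class psi W H ->
  [/\ size W = n, count_mem La W = r & exists2 u, run (map live W) H = Some u & final u].
Proof.
case=> F [_ <- [u [r1 fu _]]]; split; [exact: size_tuple | | by exists u].
by have := valP F; rewrite /is_RAT => /and3P[/eqP].
Qed.

Lemma in_class_run n r (psi : Psi n r) W H : in_class psi W H ->
  exists2 u, run (map live W) H = Some u & final u.
Proof. by case/in_classP. Qed.

Lemma in_class_eq n r (psi phi : Psi n r) W H W' H' : in_class psi W H -> in_class phi W' H' ->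
  psi = phi <-> W = W' /\ heq H H'.
Proof.
move=> [F [-> <- hF]] [G [-> <- hG]].
by rewrite class_eq (equivalentP hF hG); split=> -[e h]; split=> //; [rewrite e | apply: val_inj].
Qed.

Lemma in_class_unique n r (psi : Psi n r) W H W' H' : in_class psi W H -> in_class psi W' H' ->
  W = W' /\ heq H H'.
Proof. by move=> h h'; apply/(in_class_eq h h'). Qed.

Lemma in_class_build n r W H u : size W = n -> count_mem La W = r ->
  run (map live W) H = Some u -> final u -> exists psi : Psi n r, in_class psi W H.
Proof.
move=> /eqP sW cW r1 fu; have [F [eF hF]] := @RAT_exists n r (Tuple sW) H u cW r1 fu.
by exists (class F), F; split=> //; rewrite eF.
Qed.

Lemma in_class_heq n r (psi : Psi n r) W H H' : in_class psi W H -> heq H H' -> in_class psi W H'.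
Proof.
move=> h e; have [sW cW [u r1 fu]] := in_classP h.
have r2 := r1; rewrite (heq_run e) in r2; have [phi h'] := in_class_build sW cW r2 fu.
by have -> : psi = phi by apply/(in_class_eq h h').
Qed.

Lemma in_class_type n r (psi : Psi n r) W H : in_class psi W H -> type_of psi = W :> seq letter.
Proof.
move=> h; have e : psi = class (Defs.repr psi).
  by apply: val_inj; apply/eqP; have := xchooseP (existsP (valP psi)).
have [H' hF] := hist_exists (Defs.repr psi).
have h' : in_class psi (word (Defs.repr psi)) H' by rewrite {1}e; apply: in_class_of_hist.
by have [-> _] := in_class_unique h h'.
Qed.

(** The corner or the end of the word at which the strand of the letter [l] after
    [z] letters can be crossed first, as an index of the transitions. *)
Definition position (l : letter) (z : nat) : nat := if l == Ld then z.+1 else z.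

Lemma slot_cases l m U V : slot l m U V ->
  if m == 0 then if l == Ld then V = [::] else U = [::]
  else exists2 p, p.+1 = position l (size U) & corner p (map live (U ++ l :: V)).
Proof.
case: l => //= /andP[/eqP <-].
- case: V => [|y V] //=; case: (y =P Ld) => [->|] //= ny _.
  exists (size U) => //; rewrite map_cat -[size U](size_map live) corner_cat.
  by case: y ny => // -[].
- case/lastP: U => [|U y] //=; rewrite -(count_rev _ (rcons _ _)) rev_rcons /=.
  case: (y =P Le) => [->|] //= ny _; exists (size U); first by rewrite /position size_rcons.
  rewrite cat_rcons map_cat -[size U](size_map live) corner_cat.
  by case: y ny => // -[].
Qed.

Lemma slot_size l m U V : slot l m U V -> m <= count (predC1 l) (U ++ V).
Proof. by case: l => //= /andP[/eqP <- _]; rewrite count_cat ?leq_addl ?leq_addr. Qed.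

Lemma slot_eq l m m' U V : slot l m U V -> slot l m' U V -> m = m'.
Proof. by case: l => //= /andP[/eqP <- _] /andP[/eqP <- _]. Qed.

Lemma slot_untouched l U V H u : slot l 0 U V -> run (map live (U ++ l :: V)) H = Some u ->
  first_touch (size U) H = None.
Proof.
move=> hs; have la := slot_letter hs; have := slot_cases hs.
case: l hs la => //= _ _ ->; last exact: untouched_e.
by rewrite map_cat -[size U](size_map live); apply: untouched_d.
Qed.

Lemma slot_pull l m U V H u : slot l m.+1 U V -> inert (live l) (size U) H ->
  run (map live (U ++ l :: V)) H = Some u -> final u ->
  exists p K, [/\ p.+1 = position l (size U), heq H ((p, Some (symbol l)) :: K),
    (p == size U) || (p.+1 == size U)
    & heq (del_strand (size U) ((p, Some (symbol l)) :: K)) (del_strand (size U) H)].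
Proof.
move=> hs hi r fu; have la := slot_letter hs; have [p ep cp] := slot_cases hs.
rewrite map_cat /= in r cp.
have tp : (p == size U) || (p.+1 == size U).
  by move: ep; rewrite /position; case: eqP => _ => [[->]|->]; rewrite eqxx ?orbT.
rewrite -[size U](size_map live) in hi tp *.
have la' : letter_of (live l) != La by rewrite letter_of_live.
have [K [h1 h2]] := pull_inert la' hi r fu cp tp.
by rewrite size_map in tp h2 *; exists p, K; rewrite -killer_live.
Qed.

(** [inserted l m W0 K psi i]: the class [psi] is obtained by inserting a strip of
    length [m] with letter [l] in the history [K] of the word [W0]; this strip can
    then be moved by a transition at position [i]. *)
Definition inserted (n r : nat) (l : letter) (m : nat) (W0 : seq letter) (K : history)
    (psi : Psi n r) (i : nat) : Prop :=
  exists U V H, [/\ W0 = U ++ V, slot l m U V, in_class psi (U ++ l :: V) H,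
    inert (live l) (size U) H /\ heq (del_strand (size U) H) K & i = position l (size U)].

Lemma inserted_bound n r l m W0 K (psi : Psi n r) i : inserted l m W0 K psi i ->
  l != La /\ m <= count (predC1 l) W0.
Proof. by case=> U [V [H [-> hs _ _ _]]]; split; [exact: slot_letter hs | exact: slot_size]. Qed.

(** Insertion is well defined on classes. *)
Lemma inserted_unique n r l m W0 K K' (psi phi : Psi n r) i j :
  inserted l m W0 K psi i -> inserted l m W0 K' phi j -> heq K K' -> psi = phi /\ i = j.
Proof.
move=> [U [V [H [-> hs h [hi hd] ->]]]] [U' [V' [H' [e hs' h' [hi' hd'] ->]]]] hK.
have [eU eV] := slot_unique e hs hs'; subst U' V'; split=> //; apply/(in_class_eq h h'); split=> //.
have [u r1 fu] := in_class_run h; have [u' r2 fu'] := in_class_run h'.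
rewrite map_cat /= in r1 r2; rewrite -[size U](size_map live) in hi hi' hd hd'.
apply/(heq_del_inert (slot_exposed hs) hi hi' r1 fu r2 fu').
exact: heq_trans hd (heq_trans hK (heq_sym hd')).
Qed.

(** A class cannot be moved at one position both by taking out a d-strip and
    by taking out an e-strip: the label of the corner is the killing symbol of
    either. *)
Lemma slots_disjoint U V U' V' m m' H H' u u' :
  slot Ld m U V -> slot Le m' U' V' -> U ++ Ld :: V = U' ++ Le :: V' ->
  position Ld (size U) = position Le (size U') ->
  inert LiveD (size U) H -> inert LiveE (size U') H' -> heq H H' ->
  run (map live (U ++ Ld :: V)) H = Some u -> final u ->
  run (map live (U' ++ Le :: V')) H' = Some u' -> final u' -> False.
Proof.
move=> hs hs' eW ep hi hi' hH r fu r' fu'; rewrite /position /= in ep.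
case: m hs => [|m] hs.
  have := slot_cases hs => /= eV; rewrite eV in eW.
  by have := congr1 size eW; rewrite !size_cat /= -ep; lia.
case: m' hs' => [|m'] hs'; first by have := slot_cases hs' => /= eU; rewrite eU in ep.
have [p [K [e1 h1 _ _]]] := slot_pull hs hi r fu.
have [p' [K' [e2 h2 _ _]]] := slot_pull hs' hi' r' fu'.
have {e1 e2} e : p' = p by move: e1 e2; rewrite /position /= -ep => <- [].
subst p'; rewrite (heq_run h1) in r.
by have [] := heq_cancel (heq_trans (heq_sym h1) (heq_trans hH h2)) r fu.
Qed.

(** The letter is determined by [slots_disjoint]; then the position determines
    the slot, and [heq_del_inert] the remaining history. *)
Lemma inserted_removal n r l m W0 K l' m' W0' K' (psi : Psi n r) i :
  inserted l m W0 K psi i -> inserted l' m' W0' K' psi i -> [/\ l = l', m = m', W0 = W0' & heq K K'].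
Proof.
move=> [U [V [H [-> hs h [hi hd] ei]]]] [U' [V' [H' [-> hs' h' [hi' hd'] ej]]]].
have [eW hH] := in_class_unique h h'; rewrite ei in ej.
have [u r1 fu] := in_class_run h; have [u' r2 fu'] := in_class_run h'.
have la := slot_letter hs; have la' := slot_letter hs'.
have el : l = l'.
  case: l l' la la' hs hs' h h' hi hi' eW ej r1 r2 {ei} => [] [] // _ _ hs hs' h h' hi hi' eW ej r1 r2.
    by case: (slots_disjoint hs hs' eW ej hi hi' hH r1 fu r2 fu').
  by case: (slots_disjoint hs' hs (esym eW) (esym ej) hi' hi (heq_sym hH) r2 fu' r1 fu).
subst l'; have sU : size U = size U' by move: ej; rewrite /position; case: eqP => _ // [].
have eU := cat_prefix eW sU; subst U'; move/eqP: eW; rewrite eqseq_cat // eqxx /= => /eqP[eV].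
subst V'; split=> //; first exact: slot_eq hs hs'.
rewrite map_cat /= in r1 r2; rewrite -[size U](size_map live) in hi hi' hd hd'.
have := (heq_del_inert (slot_exposed hs) hi hi' r1 fu r2 fu').2 hH => e.
exact: heq_trans (heq_sym hd) (heq_trans e hd').
Qed.

(** Removing a strip and inserting the next one goes through a cycle: all
    d-strips by decreasing length, then all e-strips by decreasing length, and
    back. *)
Definition next_strip (W0 : seq letter) (x : letter * nat) : letter * nat :=
  if x.2 is m.+1 then (x.1, m)
  else if x.1 == Ld then (Le, count (predC1 Le) W0) else (Ld, count (predC1 Ld) W0).

Lemma next_strip_bound W0 x : x.1 != La -> x.2 <= count (predC1 x.1) W0 ->
  (next_strip W0 x).1 != La /\
  (next_strip W0 x).2 <= count (predC1 (next_strip W0 x).1) W0.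
Proof. by case: x => l [|m] //= la h; [case: l la h | split=> //; apply: ltnW]. Qed.

Lemma next_strip_inj W0 x y : x.1 != La -> y.1 != La ->
  x.2 <= count (predC1 x.1) W0 -> y.2 <= count (predC1 y.1) W0 ->
  next_strip W0 x = next_strip W0 y -> x = y.
Proof.
case: x y => [l [|m]] [l' [|m']]; rewrite /next_strip /= => la la' h h'.
- by case: l la h => //; case: l' la' h'.
- case: l la h => // _ _ /= [e1 e2]; subst l';
  by rewrite e2 ltnn in h'.
- case: l' la' h' => // _ _ /= [e1 e2]; subst l;
  by rewrite -e2 ltnn in h.
- by case=> -> ->.
Qed.

(** The transitions at a corner whose tile carries a q. *)
Definition qlink (n r : nat) (i : nat) (psi phi : Psi n r) : Prop :=
  exists X B C Y K, [/\ i = (size X).+1, kind_of B C,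
    in_class psi (X ++ B :: C :: Y) ((size X, Some Cempty) :: K) & in_class phi (X ++ C :: B :: Y) K].

Lemma qlink_corner n r i (psi phi : Psi n r) : qlink i psi phi ->
  exists p W K, [/\ i = p.+1, corner p (map live W) & in_class psi W ((p, Some Cempty) :: K)].
Proof.
move=> [X [B [C [Y [K [-> hK h h']]]]]]; exists (size X), (X ++ B :: C :: Y), K; split=> //.
rewrite map_cat -[size X](size_map live) corner_cat /=.
by move: hK; case: B {h h'}; case: C.
Qed.

Lemma qlink_inner n r i (psi phi : Psi n r) : qlink i phi psi ->
  exists p W K, [/\ i = p.+1, ~~ corner p (map live W), p.+1 < size W & in_class psi W K].
Proof.
move=> [X [B [C [Y [K [-> hK h h']]]]]]; exists (size X), (X ++ C :: B :: Y), K; split=> //.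
  rewrite map_cat -[size X](size_map live) corner_cat /=.
  by move: hK; case: B {h h'}; case: C.
by rewrite size_cat /= !addnS !ltnS leq_addr.
Qed.

Lemma kind_of_sweep X B C Y : kind_of B C ->
  sweep (map live (X ++ B :: C :: Y)) (size X) (Some Cempty) = Some (map live (X ++ C :: B :: Y)).
Proof.
rewrite !map_cat -[size X](size_map live) sweep_cat.
by case: B; case: C.
Qed.

Lemma qlink_fun n r i (psi phi phi' : Psi n r) : qlink i psi phi -> qlink i psi phi' -> phi = phi'.
Proof.
move=> [X [B [C [Y [K [ei hK h h1]]]]]] [X' [B' [C' [Y' [K' [ei' hK' h' h1']]]]]].
rewrite ei in ei'; case: ei' => sX; have [eW hH] := in_class_unique h h'.
have eX := cat_prefix eW sX; subst X'; move/eqP: eW; rewrite eqseq_cat // eqxx /= => /eqP[eB eC eY].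
subst B' C' Y'; have [u r1 fu] := in_class_run h; apply/(in_class_eq h1 h1'); split=> //.
by have [] := heq_cancel hH r1 fu.
Qed.

Lemma qlink_inj n r i (psi psi' phi : Psi n r) : qlink i psi phi -> qlink i psi' phi -> psi = psi'.
Proof.
move=> [X [B [C [Y [K [ei hK h1 h]]]]]] [X' [B' [C' [Y' [K' [ei' hK' h1' h']]]]]].
rewrite ei in ei'; case: ei' => sX; have [eW hH] := in_class_unique h h'.
have eX := cat_prefix eW sX; subst X'; move/eqP: eW; rewrite eqseq_cat // eqxx /= => /eqP[eB eC eY].
by subst B' C' Y'; apply/(in_class_eq h1 h1'); split=> //; apply: heq_cons.
Qed.

(** A position of a word is not both a corner and an inner corner. *)
Lemma qlink_disjoint n r i (psi phi phi' : Psi n r) : qlink i psi phi -> qlink i phi' psi -> False.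
Proof.
move=> /qlink_corner[p [W [K [-> cp h]]]] /qlink_inner[p' [W' [K' [[<-] cp' _ h']]]].
by have [e _] := in_class_unique h h'; rewrite -e cp in cp'.
Qed.

Lemma qlink_not_inserted n r i (psi phi : Psi n r) l m W0 K : qlink i psi phi -> inserted l m W0 K psi i -> False.
Proof.
move=> /qlink_corner[p [W [K1 [-> cp h]]]] [U [V [H [_ hs h' [hi _] ep]]]].
have [eW hH] := in_class_unique h h'; have [u r1 fu] := in_class_run h; have [u' r2 fu'] := in_class_run h'.
have la := slot_letter hs; case: m hs => [|m] hs.
  have := slot_cases hs; move: ep; rewrite /position /=; case: (l =P Ld) => _ ep eU; last by rewrite eU in ep.
  by case: ep cp => ->; case/andP; rewrite eW eU size_map size_cat addn1 ltnn.
have [p' [K' [e1 h1 _ _]]] := slot_pull hs hi r2 fu'.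
rewrite -ep in e1; case: e1 => e1; subst p'.
have [[e] _] := heq_cancel (heq_trans hH h1) r1 fu.
by case: l la e {hs h' hi ep eW r2 h1}.
Qed.

Lemma qlink_inner_not_inserted n r i (psi phi : Psi n r) l m W0 K :
  qlink i phi psi -> inserted l m W0 K psi i -> False.
Proof.
move=> /qlink_inner[p [W [K1 [-> cp hp h]]]] [U [V [H [_ hs h' [hi _] ep]]]].
have [eW _] := in_class_unique h h'; subst W.
case: m hs => [|m] hs.
  have := slot_cases hs; move: ep; rewrite /position /=; case: (l =P Ld) => _ ep eU; last by rewrite eU in ep.
  by move: hp; rewrite ep eU size_cat addn1 ltnn.
by have [p' e1 cp'] := slot_cases hs; rewrite -ep in e1; case: e1 cp' => -> h2; rewrite h2 in cp.
Qed.

(** [link x y]: the transition from [x.1] at position [x.2] leads to [y.1];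
    the position [y.2], that of the inserted strip or of the modified corner,
    is chosen so as to make this relation a permutation. *)
Inductive link (n r : nat) : Psi n r * nat -> Psi n r * nat -> Prop :=
| link_remove i psi phi : qlink i psi phi -> link (psi, i) (phi, i)
| link_append i psi phi : qlink i phi psi -> link (psi, i) (phi, i)
| link_strip l m W0 K psi phi i j : inserted l m W0 K psi i ->
    inserted (next_strip W0 (l, m)).1 (next_strip W0 (l, m)).2 W0 K phi j ->
    link (psi, i) (phi, j).

Lemma linkE n r (x y : Psi n r * nat) : link x y ->
  [\/ x.2 = y.2 /\ qlink x.2 x.1 y.1, x.2 = y.2 /\ qlink x.2 y.1 x.1
    | exists l m W0 K, inserted l m W0 K x.1 x.2 /\
        inserted (next_strip W0 (l, m)).1 (next_strip W0 (l, m)).2 W0 K y.1 y.2].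
Proof.
case=> [i psi phi h|i psi phi h|l m W0 K psi phi i j h h'];
  [by constructor 1 | by constructor 2 | constructor 3].
by exists l, m, W0, K.
Qed.

Lemma link_fun n r (x y y' : Psi n r * nat) : link x y -> link x y' -> y = y'.
Proof.
rewrite (surjective_pairing y) (surjective_pairing y') => /linkE h /linkE h'; move: h h' => /=.
case=> [[e1 h1]|[e1 h1]|[l [m [W0 [K [h1 g1]]]]]]; case=> [[e2 h2]|[e2 h2]|[l' [m' [W0' [K' [h2 g2]]]]]].
- by rewrite -e1 -e2 (qlink_fun h1 h2).
- by case: (qlink_disjoint h1 h2).
- by case: (qlink_not_inserted h1 h2).
- by case: (qlink_disjoint h2 h1).
- by rewrite -e1 -e2 (qlink_inj h1 h2).
- by case: (qlink_inner_not_inserted h1 h2).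
- by case: (qlink_not_inserted h2 h1).
- by case: (qlink_inner_not_inserted h2 h1).
have [el em eW hK] := inserted_removal h1 h2; subst l' m' W0'.
by have [-> ->] := inserted_unique g1 g2 hK.
Qed.

Lemma link_inj n r (x x' y : Psi n r * nat) : link x y -> link x' y -> x = x'.
Proof.
rewrite (surjective_pairing x) (surjective_pairing x') => /linkE h /linkE h'; move: h h' => /=.
case=> [[e1 h1]|[e1 h1]|[l [m [W0 [K [h1 g1]]]]]]; case=> [[e2 h2]|[e2 h2]|[l' [m' [W0' [K' [h2 g2]]]]]].
- by rewrite e2 in h2 *; rewrite e1 in h1 *; rewrite (qlink_inj h1 h2).
- by rewrite e1 in h1; rewrite e2 in h2; case: (qlink_disjoint h2 h1).
- by rewrite e1 in h1; case: (qlink_inner_not_inserted h1 g2).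
- by rewrite e1 in h1; rewrite e2 in h2; case: (qlink_disjoint h1 h2).
- by rewrite e2 in h2 *; rewrite e1 in h1 *; rewrite (qlink_fun h1 h2).
- by rewrite e1 in h1; case: (qlink_not_inserted h1 g2).
- by rewrite e2 in h2; case: (qlink_inner_not_inserted h2 g1).
- by rewrite e2 in h2; case: (qlink_not_inserted h2 g1).
have [e1 e2 eW hK] := inserted_removal g1 g2; subst W0'.
have [la b] := inserted_bound h1; have [la' b'] := inserted_bound h2.
have e : (l, m) = (l', m').
  apply: (next_strip_inj (W0 := W0)) => //.
  by rewrite [LHS]surjective_pairing e1 e2 -surjective_pairing.
case: e => el em; subst l' m'.
by have [-> ->] := inserted_unique h1 h2 hK.
Qed.

(** * The rules of the chain *)

Lemma nseq_prefix (l : letter) W : exists k V, W = nseq k l ++ V /\ ohead V != Some l.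
Proof.
elim: W => [|x W [k [V [-> h]]]]; first by exists 0, [::].
case: (x =P l) => [->|/eqP nx]; first by exists k.+1, V.
by exists 0, (x :: nseq k l ++ V); split=> //=; apply: contra nx => /eqP[->].
Qed.

Lemma count_insert (a : pred letter) U x V : count a (U ++ x :: V) = a x + count a (U ++ V).
Proof. by rewrite !count_cat /= addnCA. Qed.

Lemma nseq_rcons (T : Type) k (x : T) V : nseq k x ++ x :: V = x :: nseq k x ++ V.
Proof. by elim: k => //= k ->. Qed.

Lemma count_nseq_C (l : letter) k : count (predC1 l) (nseq k l) = 0.
Proof. by rewrite count_nseq /= eqxx mul0n. Qed.

(** Moving a strip across equal letters does not change the word, so that the
    type of the result is the one announced by the rules even if the strip is
    inserted in another place than the corner. *)
Lemma slot_word l m U V A B : slot l m U V -> U ++ V = A ++ B ->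
  (if l == Ld then count (predC1 Ld) B else count (predC1 Le) A) = m ->
  U ++ l :: V = A ++ l :: B.
Proof.
move=> hs; have la := slot_letter hs; case: l hs la => // hs _ e /= hm.
- have [k [B' [eB h]]] := nseq_prefix Ld B; subst B.
  have hs' : slot Ld m (A ++ nseq k Ld) B'.
    by move: hm; rewrite count_cat count_nseq_C add0n /= => ->; rewrite eqxx.
  have [-> ->] : U = A ++ nseq k Ld /\ V = B' by apply: slot_unique hs hs'; rewrite e catA.
  by rewrite -catA nseq_rcons.
- have [k [A' [eA h]]] := nseq_prefix Le (rev A).
  have {}eA : A = rev A' ++ nseq k Le by rewrite -[A]revK eA rev_cat rev_nseq.
  have hs' : slot Le m (rev A') (nseq k Le ++ B).
    by move: hm; rewrite eA count_cat count_nseq_C addn0 /= revK h => ->; rewrite eqxx.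
  have [-> ->] : U = rev A' /\ V = nseq k Le ++ B.
    by apply: slot_unique hs hs'; rewrite e eA catA.
  by rewrite eA -nseq_rcons catA.
Qed.

Lemma swept_strip_length n U l V H (F : filling n) : l != La ->
  swept (U ++ l :: V) H F -> size (U ++ l :: V) <= n ->
  strip_length l (count_mem l U) F =
  if l == Ld then count (predC1 Ld) V else count (predC1 Le) U.
Proof.
move=> la hF hn; rewrite /strip_length.
have -> : [set p in F | in_strip l (count_mem l U) p.1] =
    [set p in F | in_lstrip l (count_mem l U) (loc p.1)].
  by apply/setP => p; rewrite !inE in_stripE.
rewrite (card_loc_list F (fun a => in_lstrip l (count_mem l U) a.1)).
rewrite (permP (swept_loc_list hF hn)); case: hF => u [r fu _].
have la' : letter_of (live l) != La by rewrite letter_of_live.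
rewrite map_cat /= in r *; have := count_strip la' r fu.
by rewrite letter_of_live !map_letter_live.
Qed.

Lemma slot_strip_length n U l m V H (F : filling n) : slot l m U V ->
  swept (U ++ l :: V) H F -> size (U ++ l :: V) <= n ->
  strip_length l (count_mem l U) F = m.
Proof.
move=> hs hF hn; have la := slot_letter hs; rewrite (swept_strip_length la hF hn).
by case: l hs {la hF hn} => //= /andP[/eqP].
Qed.

(** Compressing the strip of an inert strand and inserting the next strip is a
    transition by [link_strip]. *)
Lemma insert_link n r (F T : RAT n r) H U l m V :
  word F = U ++ l :: V :> seq letter -> hist_of F H -> inert (live l) (size U) H ->
  slot l m U V ->
  insert_strip (next_strip (U ++ V) (l, m)).1 (next_strip (U ++ V) (l, m)).2 (U ++ V)
    (compress l (count_mem l U) (fil F)) (word T) (fil T) ->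
  exists j, link (class F, position l (size U)) (class T, j).
Proof.
move=> eW hF hi hs hins; have la := slot_letter hs; have sW := size_word F.
have hF' : swept (U ++ l :: V) H (fil F) by rewrite -eW.
rewrite eW in sW; have [u [r1 fu e]] := compress_swept la hi hF' sW.
have [HT hT] := hist_exists T; rewrite e in hins.
have [U' [V' [e1 hs' e2 hi' hd]]] := insert_strip_heq r1 fu hT (size_word T) hins.
exists (position (next_strip (U ++ V) (l, m)).1 (size U')).
apply: (@link_strip _ _ l m (U ++ V) (del_strand (size U) H)).
  by exists U, V, H; split=> //; [rewrite -eW; apply: in_class_of_hist | split=> //; apply: heq_refl].
by exists U', V', HT; split=> //; rewrite -e2; apply: in_class_of_hist.
Qed.

Lemma insert_link_exists n r (F : RAT n r) H U l m V A B :
  word F = U ++ l :: V :> seq letter -> hist_of F H -> inert (live l) (size U) H ->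
  slot l m U V -> U ++ V = A ++ B ->
  let l' := (next_strip (U ++ V) (l, m)).1 in let m' := (next_strip (U ++ V) (l, m)).2 in
  (if l' == Ld then count (predC1 Ld) B else count (predC1 Le) A) = m' ->
  exists T : RAT n r, word T = A ++ l' :: B :> seq letter /\
    insert_strip l' m' (U ++ V) (compress l (count_mem l U) (fil F)) (word T) (fil T).
Proof.
move=> eW hF hi hs eAB l' m' hm; have la := slot_letter hs; have sW := size_word F.
have hF' : swept (U ++ l :: V) H (fil F) by rewrite -eW.
rewrite eW in sW; have [u [r1 fu e]] := compress_swept la hi hF' sW.
have [la' hb] := next_strip_bound (x := (l, m)) la (slot_size hs).
have [U' [V' [e1 hs']]] := slot_exists la' hb.
have [sn cn _] := in_classP (in_class_of_hist hF); rewrite eW in sn cn.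
have sn' : size (U' ++ l' :: V') = n.
  by rewrite -sn !size_cat /= !addnS -!size_cat e1.
have cn' : count_mem La (U' ++ l' :: V') = r.
  rewrite -cn !count_insert e1; congr (_ + _).
  have: l' != La := la'; by case: (l) (l') la => [] [].
rewrite e1 in r1; have [HT [u' [r2 fu' hi' _ hins]]] := insert_strip_exists hs' (eq_leq sn') r1 fu.
have /eqP sn'' := sn'; have [T [eT hT]] := RAT_exists (W := Tuple sn'') cn' r2 fu'.
exists T; rewrite eT /=; split; first exact: slot_word hs' (etrans (esym e1) eAB) hm.
by case: hT => _ [_ _ ->]; rewrite eT e1 e e1.
Qed.

Lemma tile_at_corner X B C Y K : kind_of B C = Some K ->
  tile_at (map live (X ++ B :: C :: Y)) (size X) = (K, vertex_of X).
Proof.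
move=> hK; rewrite map_cat -[size X](size_map live) /=.
rewrite (@tile_at_cat (map live X) (live B) (live C) (map live Y) K) ?letter_of_live //.
by rewrite map_letter_live.
Qed.

Lemma tiles_corner X B C Y K L : kind_of B C = Some K ->
  tiles (map live (X ++ B :: C :: Y)) ((size X, Some Cempty) :: L) =
  ((K, vertex_of X), Cempty) :: tiles (map live (X ++ C :: B :: Y)) L.
Proof.
move=> hK; rewrite [LHS]/= kind_of_sweep ?hK //=; congr (_ :: _); congr (_, _).
by rewrite (tile_at_corner _ _ hK).
Qed.

Lemma corner_live X B C Y K : kind_of B C = Some K ->
  corner (size X) (map live (X ++ B :: C :: Y)).
Proof.
move=> hK; rewrite map_cat -[size X](size_map live) corner_cat /=.
by move: hK; case: B; case: C.
Qed.

Lemma hist_mem n r (F : RAT n r) H p : hist_of F H ->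
  (p \in fil F) = ((loc p.1, p.2) \in tiles (map live (word F)) H).
Proof. by move=> hF; rewrite -(perm_mem (swept_loc_list hF (size_word F))) loc_listE. Qed.

(** By [pull_tile], the tile at the corner can be swept first. *)
Lemma hist_at_corner n r (F : RAT n r) X B C Y K p :
  word F = X ++ B :: C :: Y :> seq letter -> kind_of B C = Some K ->
  p \in fil F -> loc p.1 = (K, vertex_of X) ->
  exists L, hist_of F ((size X, Some p.2) :: L).
Proof.
move=> eW hK pF ep; have [H hF] := hist_exists F; have [u [r1 fu eF]] := hF.
have hp := pF; rewrite (hist_mem _ hF) ep eW in hp; rewrite eW in r1 eF.
have ht : tile_at (map live (X ++ B :: C :: Y)) (size X) \in
    map fst (tiles (map live (X ++ B :: C :: Y)) H).
  by rewrite (tile_at_corner _ _ hK); apply/mapP; exists ((K, vertex_of X), p.2).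
have [c [L [hL pL]]] := pull_tile r1 fu (corner_live X Y hK) ht.
have r2 := r1; rewrite (heq_run hL) in r2.
exists L; suff <- : c = Some p.2.
  by exists u; rewrite eW; split=> //; rewrite eF; apply/eq_fill_of/perm_mem.
have hc : odflt Cempty c = p.2.
  have U := uniq_tiles r2 fu; apply: (uniq_fst_inj U (a := (K, vertex_of X))).
    by rewrite /= (tile_at_corner _ _ hK) inE eqxx.
  by rewrite -(perm_mem pL).
have [w' s _] := run_cons r2; rewrite -hc.
move: s; rewrite map_cat -[size X](size_map live) sweep_cat.
by case: (c) => //=; case: B hK {eW r1 eF hp ht hL pL r2}; case: C.
Qed.

Lemma corner_tile_hist n r (F : RAT n r) X B C Y K c L :
  word F = X ++ B :: C :: Y :> seq letter -> kind_of B C = Some K ->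
  hist_of F ((size X, Some c) :: L) ->
  exists2 p, p \in fil F & loc p.1 = (K, vertex_of X) /\ p.2 = c.
Proof.
move=> eW hK hF; have := perm_mem (swept_loc_list hF (size_word F)) ((K, vertex_of X), c).
rewrite eW [tiles _ _]/= (tile_at_corner _ _ hK) inE eqxx /= => /mapP[p pF e].
exists p; first by rewrite mem_enum in pF.
by split; [have := congr1 fst e | have := congr1 snd e] => /= ->.
Qed.

(** A crossing of two live strands which leaves both alive is a tile with a q,
    and removing this tile is dropping the crossing. *)
Lemma fill_of_remove n r (F : RAT n r) X B C Y K L p :
  word F = X ++ B :: C :: Y :> seq letter -> kind_of B C = Some K ->
  hist_of F ((size X, Some Cempty) :: L) ->
  p \in fil F -> loc p.1 = (K, vertex_of X) ->
  [/\ p.2 = Cempty, has_q (fil F) p &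
      fil F :\ p = fill_of n (tiles (map live (X ++ C :: B :: Y)) L)].
Proof.
move=> eW hK hF pF ep; have hm := hist_mem _ hF; rewrite eW (tiles_corner _ _ _ hK) in hm.
have [u [r1 fu _]] := hF; rewrite eW in r1.
have U := uniq_tiles r1 fu; rewrite (tiles_corner _ _ _ hK) in U.
have ec : p.2 = Cempty.
  apply: (uniq_fst_inj U (a := (K, vertex_of X))); last by rewrite inE eqxx.
  by have := hm p; rewrite pF ep => /esym.
split=> //; last first.
  apply/setP => s; rewrite in_setD1 inE hm inE.
  have -> : ((loc s.1, s.2) == (K, vertex_of X, Cempty)) = (s == p).
    by rewrite -{1}ep -ec -(inj_eq (@locp_inj n)).
  case: (s =P p) => //= ->.
  rewrite ep ec; apply/esym/negbTE; move: U => /= /andP[U _].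
  by apply: contra U => h; apply/mapP; exists ((K, vertex_of X), Cempty).
rewrite (swept_has_q hF (size_word F) pF) ep ec eW -(tile_at_corner X Y hK).
by rewrite (carries_q_head r1 fu).
Qed.

(** The positions at which a transition has a rule, that is, a probability
    which is not zero by definition. *)
Definition active (W : seq letter) (i : nat) : bool :=
  match ohead (rev (take i W)), ohead (drop i W) with
  | None, Some Le => true
  | Some Ld, None => true
  | Some B, Some C => kind_of B C || kind_of C B
  | _, _ => false
  end.

Variant active_spec (W : seq letter) (i : nat) : Prop :=
| ActiveFirst X of W = Le :: X & i = 0
| ActiveLast X of W = rcons X Ld & i = (size X).+1
| ActiveCorner X B C Y K of W = X ++ B :: C :: Y & i = (size X).+1 & kind_of B C = Some K
| ActiveInner X B C Y K of W = X ++ C :: B :: Y & i = (size X).+1 & kind_of B C = Some K.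

Lemma activeP W i : i <= size W -> active W i -> active_spec W i.
Proof.
rewrite /active => hi; have := cat_take_drop i W; have := size_takel hi.
move: (take i W) (drop i W) => U V <- <-; case/lastP: U => [|U B]; case: V => [|C V] //=.
- by case: C => // _; apply: (@ActiveFirst _ _ V).
- by rewrite rev_rcons cats0 size_rcons; case: B => // _; apply: (@ActiveLast _ _ U).
rewrite rev_rcons cat_rcons size_rcons.
case: B; case: C => //= _; first [by eapply (@ActiveCorner _ _ U); reflexivity
  | by eapply (@ActiveInner _ _ U); reflexivity].
Qed.

Lemma moveE n r (i : 'I_n.+1) (F T : RAT n r) U V :
  word F = U ++ V :> seq letter -> i = size U :> nat ->
  move i F T =
  let k := count_mem Ld (word F) in
  match rev U, V with
  | [::], Le :: X =>
      (Ld :: X == word T) &&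
      insert_beta (n - k - 1) X (compress Le 0 (fil F)) (word T) (fil T)
  | Ld :: X', [::] =>
      let X := rev X' in
      (rcons X Le == word T) &&
      insert_alpha (r + k - 1) X (compress Ld (k - 1) (fil F)) (word T) (fil T)
  | B :: X', C :: Y =>
      match kind_of B C, kind_of C B with
      | Some K, _ => corner_move (rev X') B C Y K F T
      | None, Some K => inner_corner_move (rev X') B C Y K F T
      | None, None => false
      end
  | _, _ => false
  end.
Proof. by move=> eW ei; rewrite /move eW ei take_size_cat // drop_size_cat. Qed.

Lemma size_count_letter (l : letter) W : size W = count_mem l W + count (predC1 l) W.
Proof. by rewrite -(count_predC (pred1 l)). Qed.

Lemma word_size n r (F : RAT n r) : size (word F) = n. Proof. exact: size_tuple. Qed.
Lemma word_count n r (F : RAT n r) : count_mem La (word F) = r.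
Proof. by have := valP F; rewrite /is_RAT => /and3P[/eqP]. Qed.

Lemma move_first n r (i : 'I_n.+1) (F T : RAT n r) X :
  word F = Le :: X :> seq letter -> i = 0 :> nat ->
  move i F T = (Ld :: X == word T) &&
    insert_strip Ld (count (predC1 Ld) X) X (compress Le 0 (fil F)) (word T) (fil T).
Proof.
move=> eW ei; rewrite (@moveE _ _ _ _ _ [::] (Le :: X)) //=.
suff -> : n - count_mem Ld (word F) - 1 = count (predC1 Ld) X by [].
have := word_size F; rewrite eW /= (size_count_letter Ld). 
by move: (count_mem Ld X) (count (predC1 Ld) X) => a b; lia.
Qed.

Lemma move_last n r (i : 'I_n.+1) (F T : RAT n r) X :
  word F = rcons X Ld :> seq letter -> i = (size X).+1 :> nat ->
  move i F T = (rcons X Le == word T) &&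
    insert_strip Le (count (predC1 Le) X) X (compress Ld (count_mem Ld X) (fil F)) (word T) (fil T).
Proof.
move=> eW ei; rewrite (@moveE _ _ _ _ _ (rcons X Ld) [::]) ?cats0 ?size_rcons //= rev_rcons revK.
have ek : count_mem Ld (word F) = (count_mem Ld X).+1 by rewrite eW -cats1 count_cat /= addn1.
rewrite ek; suff -> : r + (count_mem Ld X).+1 - 1 = count (predC1 Le) X by rewrite subn1.
have := word_count F; rewrite eW -cats1 count_cat /= addn0 => <-.
by rewrite addnS subn1 /=; elim: (X) => //= -[] Z /= <-; rewrite ?add0n ?add1n ?addnS.
Qed.

Lemma move_corner n r (i : 'I_n.+1) (F T : RAT n r) X B C Y K :
  word F = X ++ B :: C :: Y :> seq letter -> i = (size X).+1 :> nat -> kind_of B C = Some K ->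
  move i F T = corner_move X B C Y K F T.
Proof.
move=> eW ei hK; rewrite (@moveE _ _ _ _ _ (rcons X B) (C :: Y)) ?cat_rcons ?size_rcons //=.
by rewrite rev_rcons revK hK; case: (B); case: (C).
Qed.

Lemma move_inner n r (i : 'I_n.+1) (F T : RAT n r) X B C Y K :
  word F = X ++ C :: B :: Y :> seq letter -> i = (size X).+1 :> nat -> kind_of B C = Some K ->
  move i F T = inner_corner_move X C B Y K F T.
Proof.
move=> eW ei hK; rewrite (@moveE _ _ _ _ _ (rcons X C) (B :: Y)) ?cat_rcons ?size_rcons //=.
rewrite rev_rcons revK.
by move: hK; case: (B); case: (C) => //= -[<-].
Qed.

(** The letters of the initial path are alive. *)
Lemma corner_letters X B C Y K c w : kind_of B C = Some K ->
  sweep (map live (X ++ B :: C :: Y)) (size X) c = Some w ->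
  [\/ c = Some Cempty, c = Some Cbeta /\ B = Ld | c = Some Calpha /\ C = Le].
Proof.
move=> hK; rewrite map_cat -[size X](size_map live) sweep_cat.
case: c => [[]|]; case: B hK => //; case: C => //= _ _; by [constructor 1 | constructor 2 | constructor 3].
Qed.

Lemma slot_corner_d X C Y : C != Ld -> slot Ld (count (predC1 Ld) Y).+1 X (C :: Y).
Proof. by move=> /negbTE nC; rewrite /= nC eqxx; case: C nC. Qed.

Lemma slot_corner_e X B Y : B != Le -> slot Le (count (predC1 Le) X).+1 (rcons X B) Y.
Proof. by move=> /negbTE nB; rewrite /= rev_rcons -cats1 count_cat /= nB addn1 eqxx; case: B nB. Qed.

Lemma hist_run n r (F : RAT n r) H : hist_of F H ->
  exists2 u, run (map live (word F)) H = Some u & final u.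
Proof. by case=> u [? ? _]; exists u. Qed.

(** What a corner move does, when the tile at the corner is swept first. *)
Lemma corner_moveE n r (F T : RAT n r) X B C Y K c L :
  word F = X ++ B :: C :: Y :> seq letter -> kind_of B C = Some K ->
  hist_of F ((size X, Some c) :: L) ->
  corner_move X B C Y K F T = (X ++ C :: B :: Y == word T) &&
    match c with
    | Cbeta => insert_strip Ld (count (predC1 Ld) Y) (X ++ C :: Y)
                 (compress Ld (count_mem Ld X) (fil F)) (word T) (fil T)
    | Calpha => insert_strip Le (count (predC1 Le) X) (X ++ B :: Y)
                 (compress Le (count_mem Le X) (fil F)) (word T) (fil T)
    | Cempty => fil T == fill_of n (tiles (map live (X ++ C :: B :: Y)) L)
    end.
Proof.
move=> eW hK hF; rewrite /corner_move; congr (_ && _).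
have [p pF [ep ec]] := corner_tile_hist eW hK hF.
have [u r1 fu] := hist_run hF; have sW := size_word F; rewrite eW in r1 sW.
have hF' : swept (X ++ B :: C :: Y) ((size X, Some c) :: L) (fil F) by rewrite -eW.
have [w s _] := run_cons r1; have hc := corner_letters hK s.
have only (Q : placed n -> bool) :
    [exists s in fil F, (loc s.1 == (K, vertex_of X)) && Q s] = Q p.
  apply/exists_inP/idP => [[s' sF /andP[/eqP es qs]]|qp]; last by exists p; rewrite ?ep ?eqxx.
  suff -> : p = s' by [].
  have e1 : p.1 = s'.1 by apply: (@loc_inj n); rewrite ep es.
  have := swept_is_filling hF (size_word F); case/and4P=> /forall_inP /(_ p pF).
  by move=> /forall_inP /(_ s' sF); rewrite e1 eqxx => /eqP.
rewrite only ec {only}; case: c hF ec s hc hF' r1 => hF ec s hc hF' r1.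
- have [_ hq e] := fill_of_remove eW hK hF pF ep.
  by rewrite hq e.
- have {hc}eC : C = Le by clear -hc; case: hc => [|[]|[]].
  subst C; rewrite vertex_ofE.
  have nB : B != Le by case: (B) hK.
  rewrite -cat_rcons in hF' sW.
  have e : count_mem Le (rcons X B) = count_mem Le X.
    by rewrite -cats1 count_cat /= (negbTE nB) !addn0.
  have := slot_strip_length (slot_corner_e X Y nB) hF' sW; rewrite e => -> /=.
  by [].
- have {hc}eB : B = Ld by clear -hc; case: hc => [|[]|[]].
  subst B; rewrite vertex_ofE.
  have nC : C != Ld by case: (C) hK.
  by rewrite (slot_strip_length (slot_corner_d X Y nC) hF' sW).
Qed.

Lemma inert_corner_d (X : seq letter) L : inert LiveD (size X) ((size X, Some Cbeta) :: L).
Proof. by rewrite inert_cons eqxx. Qed.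

Lemma inert_corner_e (X : seq letter) B L :
  inert LiveE (size (rcons X B)) ((size X, Some Calpha) :: L).
Proof. by rewrite inert_cons size_rcons eqxx orbT. Qed.

Lemma word_swap n r (F T : RAT n r) X B C Y :
  word F = X ++ B :: C :: Y :> seq letter -> exists sW : size (X ++ C :: B :: Y) == n,
  count_mem La (X ++ C :: B :: Y) = r.
Proof.
move=> eW; have := word_size F; have := word_count F; rewrite eW !size_cat /= => h1 h2.
exists (introT eqP h2); rewrite -h1 !count_cat /=; lia.
Qed.

Lemma corner_move_link n r (F T : RAT n r) X B C Y K :
  word F = X ++ B :: C :: Y :> seq letter -> kind_of B C = Some K ->
  corner_move X B C Y K F T -> exists j, link (class F, (size X).+1) (class T, j).
Proof.
move=> eW hK hm; have [p pF ep] : exists2 p, p \in fil F & loc p.1 = (K, vertex_of X).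
  by case/andP: hm => _ /exists_inP[p pF /andP[/eqP ep _]]; exists p.
have [L hF] := hist_at_corner eW hK pF ep.
rewrite (corner_moveE T eW hK hF) in hm; case/andP: hm => /eqP eT.
have [u r1 fu] := hist_run hF; rewrite eW in r1; have [w s r2] := run_cons r1.
have := corner_letters hK s; case ec: p.2 hF s r1 => hF s r1 hc.
- move=> /eqP hT; exists (size X).+1; apply: link_remove; exists X, B, C, Y, L; split=> //.
  + by rewrite hK.
  + by rewrite -eW; apply: in_class_of_hist.
  + rewrite eT; apply: in_class_of_hist; exists u; rewrite -eT; split=> //.
    by move: s r2; rewrite kind_of_sweep ?hK // => -[->].
- have {hc}eC : C = Le by clear -hc; case: hc => [|[]|[]].
  move=> hT; subst C.
  have nB : B != Le by case: (B) hK.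
  rewrite -cat_rcons in eW; rewrite -[(size X).+1](size_rcons X B).
  apply: (insert_link eW hF (inert_corner_e _ _ _) (slot_corner_e X Y nB)).
  by rewrite /next_strip /= cat_rcons -cats1 count_cat /= (negbTE nB) !addn0.
- have {hc}eB : B = Ld by clear -hc; case: hc => [|[]|[]].
  move=> hT; subst B.
  have nC : C != Ld by case: (C) hK.
  exact: (insert_link eW hF (inert_corner_d _ _) (slot_corner_d X Y nC)).
Qed.

Lemma corner_move_exists n r (F : RAT n r) X B C Y K c L :
  word F = X ++ B :: C :: Y :> seq letter -> kind_of B C = Some K ->
  hist_of F ((size X, Some c) :: L) -> exists T : RAT n r, corner_move X B C Y K F T.
Proof.
move=> eW hK hF; have [u r1 fu] := hist_run hF; rewrite eW in r1; have [w s r2] := run_cons r1.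
have := corner_letters hK s; case: c hF s r1 => hF s r1 hc.
- have [sW cW] := word_swap F eW.
  move: s r2; rewrite kind_of_sweep ?hK // => -[<-] r2.
  have [T [eT hT]] := RAT_exists (W := Tuple sW) cW r2 fu.
  exists T; rewrite (corner_moveE T eW hK hF) eT eqxx.
  by case: hT => _ [_ _ ->]; rewrite eT eqxx.
- have {hc}eC : C = Le by clear -hc; case: hc => [|[]|[]].
  subst C; have nB : B != Le by case: (B) hK.
  have eW' := eW; rewrite -cat_rcons in eW'.
  have [||T [eT hT]] := @insert_link_exists _ _ _ _ _ _ _ _ X (B :: Y) eW' hF (inert_corner_e _ _ _) (slot_corner_e X Y nB).
  + by rewrite cat_rcons.
  + by [].
  exists T; rewrite (corner_moveE T eW hK hF) eT eqxx /=.
  by move: hT; rewrite eT /= cat_rcons -cats1 count_cat /= (negbTE nB) !addn0.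
- have {hc}eB : B = Ld by clear -hc; case: hc => [|[]|[]].
  subst B; have nC : C != Ld by case: (C) hK.
  have [||T [eT hT]] := @insert_link_exists _ _ _ _ _ _ _ _ (rcons X C) Y eW hF (inert_corner_d _ _) (slot_corner_d X Y nC).
  + by rewrite cat_rcons.
  + by [].
  exists T; rewrite (corner_moveE T eW hK hF) eT cat_rcons eqxx /=.
  by move: hT; rewrite eT cat_rcons.
Qed.

Lemma inner_move_link n r (F T : RAT n r) X B C Y K :
  word F = X ++ C :: B :: Y :> seq letter -> kind_of B C = Some K ->
  inner_corner_move X C B Y K F T -> exists j, link (class F, (size X).+1) (class T, j).
Proof.
move=> eW hK /andP[/eqP eT /existsP[t /and3P[/eqP et /eqP eF _]]].
have [L hF] := hist_exists F; exists (size X).+1; apply: link_append.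
exists X, B, C, Y, L; split=> //; rewrite ?hK //; last by rewrite -eW; apply: in_class_of_hist.
rewrite eT; apply: in_class_of_hist; have [u [r1 fu eL]] := hF; rewrite eW in r1 eL.
exists u; rewrite -eT; split=> //; first by rewrite /= kind_of_sweep ?hK.
rewrite eF eL (tiles_corner _ _ _ hK); apply/setP => p; rewrite !inE; congr (_ || _).
by rewrite -(inj_eq (@locp_inj n)) /= et.
Qed.

Lemma inner_move_exists n r (F : RAT n r) X B C Y K :
  word F = X ++ C :: B :: Y :> seq letter -> kind_of B C = Some K ->
  exists T : RAT n r, inner_corner_move X C B Y K F T.
Proof.
move=> eW hK; have [L hF] := hist_exists F; have [u [r1 fu eL]] := hF; rewrite eW in r1 eL.
have [sW cW] := word_swap F eW.
have r2 : run (map live (X ++ B :: C :: Y)) ((size X, Some Cempty) :: L) = Some u.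
  by rewrite /= kind_of_sweep ?hK.
have [T [eT hT]] := RAT_exists (W := Tuple sW) cW r2 fu.
exists T; rewrite /inner_corner_move eT eqxx /=.
have {}eT : word T = X ++ B :: C :: Y :> seq letter by rewrite eT.
have [p pT [ep ec]] := corner_tile_hist eT hK hT.
have [_ hq e] := fill_of_remove eT hK hT pT ep.
have ep1 : (p.1, Cempty) = p by rewrite -ec -surjective_pairing.
apply/existsP; exists p.1; rewrite ep1 ep eqxx hq andbT /=.
by rewrite eL -e setD1K.
Qed.

(** Every transition of the chain is given by [link], whichever representative
    and whichever result are used. *)
Lemma class_move_link n r (psi phi : Psi n r) (i : 'I_n.+1) : active (type_of psi) i ->
  class_move i psi phi -> exists j, link (psi, i : nat) (phi, j).
Proof.
move=> ha /exists_inP[F /mem_Psi eF /exists_inP[T /mem_Psi eT hm]]; subst phi.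
have [H hF] := hist_exists F; have hi : i <= size (word F) by rewrite word_size -ltnS.
have eW : type_of psi = word F :> seq letter by rewrite eF; apply: in_class_type (in_class_of_hist hF).
rewrite eW in ha; rewrite eF; have sW := size_word F.
have [u r1 fu] := hist_run hF.
case: (activeP hi ha) => [X eX ei|X eX ei|X B C Y K eX ei hK|X B C Y K eX ei hK].
- move: hm; rewrite (move_first _ eX ei) ei => /andP[_ hm].
  rewrite eX in r1; 
  apply: (@insert_link _ _ F T H [::] Le 0 X eX hF) => //.
  by rewrite /inert (untouched_e _ r1).
- move: hm; rewrite (move_last _ eX ei) ei => /andP[_ hm]; rewrite -cats1 in eX.
  rewrite eX map_cat in r1; 
  apply: (@insert_link _ _ F T H X Ld 0 [::] eX hF) => //; last by rewrite /= cats0.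
  by rewrite /inert -[size X](size_map live) (untouched_d _ r1).
- by move: hm; rewrite (move_corner _ eX ei hK) ei; apply: corner_move_link.
- by move: hm; rewrite (move_inner _ eX ei hK) ei; apply: inner_move_link.
Qed.

Lemma class_move_exists n r (psi : Psi n r) (i : 'I_n.+1) : active (type_of psi) i ->
  exists phi, class_move i psi phi.
Proof.
move=> ha.
suff [F eF [T hm]] : exists2 F : RAT n r, psi = class F & exists T, move i F T.
  exists (class T); apply/exists_inP; exists F; first exact/mem_Psi.
  by apply/exists_inP; exists T; first exact/mem_Psi.
have [W [H hp]] := in_class_exists psi; rewrite (in_class_type hp) in ha.
have [sW cW [u r1 fu]] := in_classP hp.
have hi : i <= size W by rewrite sW -ltnS.
case: (activeP hi ha) => [X eX ei|X eX ei|X B C Y K eX ei hK|X B C Y K eX ei hK].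
- have [F [eF eW hF]] := hp; exists F => //; rewrite eX in eW r1.
  have hI : inert (live Le) (size (Nil letter)) H by rewrite /inert (untouched_e _ r1).
  have [//|//|T [eT hT]] := @insert_link_exists _ _ F H [::] Le 0 X [::] X eW hF hI isT.
  by exists T; rewrite (move_first _ eW ei) eT eqxx /=; rewrite eT in hT.
- have [F [eF eW hF]] := hp; exists F => //; rewrite eX -cats1 in eW; rewrite eX -cats1 map_cat in r1.
  have hI : inert (live Ld) (size X) H by rewrite /inert -[size X](size_map live) (untouched_d _ r1).
  have [//||T [eT hT]] := @insert_link_exists _ _ F H X Ld 0 [::] X [::] eW hF hI isT.
    by rewrite /= cats0.
  exists T; rewrite cats1 in eW; rewrite (move_last _ eW ei) eT -cats1 eqxx /=.
  by rewrite eT /= cats0 in hT.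
- rewrite eX in r1; have [c [L hL]] := pull_corner r1 fu (corner_live X Y hK).
  have [F [eF eW hF]] := in_class_heq hp hL; exists F => //; rewrite eX in eW.
  have [c0 ec] : exists c0, c = Some c0.
    have [w s _] := run_cons (etrans (esym (heq_run hL _)) r1).
    by case: (corner_letters hK s) => [->|[->]|[->]]; eexists.
  subst c; have [T hT] := corner_move_exists eW hK hF.
  by exists T; rewrite (move_corner _ eW ei hK).
- have [F [eF eW hF]] := hp; exists F => //; rewrite eX in eW.
  have [T hT] := inner_move_exists eW hK.
  by exists T; rewrite (move_inner _ eW ei hK).
Qed.

(** * The flow along the transitions *)

Lemma nb_label_cons c p d H : nb_label c ((p, d) :: H) = (d == Some c) + nb_label c H.
Proof. by []. Qed.

(** After its first crossing the strand is dead, and its crossings have no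
    label. *)
Lemma nb_label_del c X x Y H u : letter_of x != La -> inert x (size X) H ->
  run (X ++ x :: Y) H = Some u ->
  nb_label c H = (first_touch (size X) H == Some (Some c)) + nb_label c (del_strand (size X) H).
Proof.
elim: H X x Y => [|[p d] H IH] X x Y // la hi r; have [w' s r'] := run_cons r.
rewrite inert_cons in hi; have lk : letter_of (kill x) != La by rewrite letter_kill.
rewrite nb_label_cons.
have [[/negbTE n1 /negbTE n2 [X' [Y' [ew sX _]]]]|[e1 lx h]|[e1 lx h]] := sweep_inert la s.
- rewrite n1 n2 /= in hi; rewrite ew in r'; rewrite -sX in hi.
  rewrite [del_strand _ _]/= n1 n2 nb_label_cons [first_touch _ _]/= n1 n2 /= -sX.
  by rewrite (IH _ _ _ la hi r') addnCA.
- rewrite e1 eqxx /= in hi; have [X' [Y' [ew sX _]]] := h (eqP hi).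
  rewrite ew in r'; have hd := inert_dead (dead_kill la) r'.
  rewrite [del_strand _ _]/= [first_touch _ _]/= e1 eqxx /= (IH _ _ _ lk hd r') sX e1; congr (_ + _).
  by move: hd; rewrite /inert sX e1 !inE => /orP[]/eqP-> //; case: (x) lx.
- have ne : (p == size X) = false by clear -e1; lia.
  rewrite ne e1 eqxx /= in hi; have [X' [Y' [ew sX _]]] := h (eqP hi).
  rewrite ew in r'; have hd := inert_dead (dead_kill la) r'.
  rewrite [del_strand _ _]/= [first_touch _ _]/= ne e1 eqxx /= (IH _ _ _ lk hd r') sX; congr (_ + _).
  by move: hd; rewrite /inert sX !inE => /orP[]/eqP-> //; case: (x) lx.
Qed.

(** An inserted strip of positive length carries one symbol and no q, because
    its tiles beyond the first one are those of a dead strand. *)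
Lemma slot_nb_label c l m U V H u : slot l m U V -> inert (live l) (size U) H ->
  run (map live (U ++ l :: V)) H = Some u -> final u ->
  nb_label c H = (0 < m) && (c == symbol l) + nb_label c (del_strand (size U) H).
Proof.
move=> hs hi r fu; have la := slot_letter hs; have r' := r; rewrite map_cat /= in r'.
have la' : letter_of (live l) != La by rewrite letter_of_live.
have hi' := hi; rewrite -[size U](size_map live) in hi'.
case: m hs => [|m] hs; first by rewrite (nb_label_del c la' hi' r') size_map (slot_untouched hs r).
have [p [K [_ h1 tp h2]]] := slot_pull hs hi r fu.
rewrite (heq_nb_label c h1) -(heq_nb_label c h2).
have r1 := r'; rewrite (heq_run h1) in r1.
have hi1 : inert (live l) (size (map live U)) ((p, Some (symbol l)) :: K).
  by rewrite inert_cons size_map tp killer_live.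
rewrite (nb_label_del c la' hi1 r1) size_map; congr (_ + _).
by rewrite /= tp; congr (nat_of_bool _); apply/eqP/eqP => [[->]|->].
Qed.

Local Open Scope ring_scope.

Definition weight (R : realFieldType) (alpha beta q : R) (W : seq letter) (H : history) : R :=
  alpha ^+ nb_label Calpha H * beta ^+ nb_label Cbeta H * q ^+ nb_label Cempty H
  * (alpha ^+ count_mem Ld W * beta ^+ count_mem Le W).

Lemma wt_hist (R : realFieldType) (alpha beta q : R) n r (F : RAT n r) H : hist_of F H ->
  wt alpha beta q F = weight alpha beta q (word F) H.
Proof.
by move=> h; rewrite /wt (swept_nb_alpha h) ?(swept_nb_beta h) ?(swept_nb_q h) ?size_word.
Qed.

Lemma weight_heq (R : realFieldType) (alpha beta q : R) W H H' : heq H H' ->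
  weight alpha beta q W H = weight alpha beta q W H'.
Proof. by move=> h; rewrite /weight !(heq_nb_label _ h). Qed.

Lemma prob_cat (R : realFieldType) (alpha beta q : R) n U V :
  prob n alpha beta q (U ++ V) (size U) =
  match ohead (rev U), ohead V with
  | None, Some Le => alpha / n.+1%:R
  | Some Ld, None => beta / n.+1%:R
  | Some B, Some C =>
      if kind_of B C then 1 / n.+1%:R
      else if kind_of C B then q / n.+1%:R
      else 0
  | _, _ => 0
  end.
Proof. by rewrite /prob take_size_cat // drop_size_cat. Qed.

Lemma prob_mid (R : realFieldType) (alpha beta q : R) n X B C Y :
  prob n alpha beta q (X ++ B :: C :: Y) (size X).+1 =
  if kind_of B C then 1 / n.+1%:R else if kind_of C B then q / n.+1%:R else 0.
Proof.
rewrite -cat_rcons -(size_rcons X B) prob_cat rev_rcons /=.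
by case: B; case: C.
Qed.

Lemma active_cat U V :
  active (U ++ V) (size U) =
  match ohead (rev U), ohead V with
  | None, Some Le => true
  | Some Ld, None => true
  | Some B, Some C => kind_of B C || kind_of C B
  | _, _ => false
  end.
Proof. by rewrite /active take_size_cat // drop_size_cat. Qed.

Lemma active_mid X B C Y : active (X ++ B :: C :: Y) (size X).+1 = kind_of B C || kind_of C B.
Proof.
rewrite -cat_rcons -(size_rcons X B) active_cat rev_rcons /=.
by case: B; case: C.
Qed.

Lemma prob_inactive (R : realFieldType) (alpha beta q : R) n W i : ~~ active W i ->
  prob n alpha beta q W i = 0.
Proof.
rewrite /active /prob.
by case: (ohead (rev _)) => [[]|]; case: (ohead (drop _ _)) => [[]|].
Qed.

(** Empty strips are moved at the ends of the word, where the probability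
    makes up for the symbol missing in the weight. *)
Lemma slot_prob (R : realFieldType) (alpha beta q : R) n l m U V : slot l m U V ->
  active (U ++ l :: V) (position l (size U)) /\
  prob n alpha beta q (U ++ l :: V) (position l (size U)) =
  (if m == 0%N then if l == Ld then beta else alpha else 1) / n.+1%:R.
Proof.
case: l => //= /andP[/eqP <-].
- case: V => [|y V] /=.
    have := active_cat (rcons U Ld) [::]; have := prob_cat alpha beta q n (rcons U Ld) [::].
    by rewrite cats0 size_rcons rev_rcons cats1 => -> ->.
  by move=> ny; rewrite active_mid prob_mid; case: y ny => // -[].
- case/lastP: U => [|U y] /=; first by rewrite (active_cat [::]) (prob_cat _ _ _ _ [::]).
  rewrite rev_rcons cat_rcons /position size_rcons active_mid prob_mid -cats1 count_cat /=.
  by case: y => // _; rewrite addn1.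
Qed.

(** Detailed balance: the class with the tile at the corner has an extra
    factor q in its weight, the other one in its probability. *)
Lemma qlink_flow (R : realFieldType) (alpha beta q : R) n r i (psi phi : Psi n r) W H W' H' :
  qlink i psi phi -> in_class psi W H -> in_class phi W' H' ->
  [/\ active W i, active W' i &
   weight alpha beta q W H * prob n alpha beta q W i =
   weight alpha beta q W' H' * prob n alpha beta q W' i].
Proof.
move=> [X [B [C [Y [K [-> hK h h']]]]]] h1 h1'.
have [-> e] := in_class_unique h1 h; have [-> e'] := in_class_unique h1' h'.
rewrite !active_mid hK orbT; split=> //.
rewrite (weight_heq _ _ _ _ e) (weight_heq _ _ _ _ e') !prob_mid hK.
have -> : kind_of C B = None :> option kind by case: (B) hK; case: (C).
have ec x : count_mem x (X ++ C :: B :: Y) = count_mem x (X ++ B :: C :: Y).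
  by rewrite !count_cat /=; congr (_ + _)%N; rewrite addnCA.
rewrite /weight !nb_label_cons /= !add0n add1n exprS !ec.
ring.
Qed.

(** The flow does not depend on the strip: it has the weight alpha beta
    altogether, from its letter and its symbol, or its letter and the
    probability. *)
Lemma inserted_flow (R : realFieldType) (alpha beta q : R) n r l m W0 K i (psi : Psi n r) W H :
  inserted l m W0 K psi i -> in_class psi W H ->
  active W i /\
  weight alpha beta q W H * prob n alpha beta q W i =
   weight alpha beta q W0 K * (alpha * beta) / n.+1%:R.
Proof.
move=> [U [V [H0 [-> hs h [hi hd] ->]]]] h1; have [-> e] := in_class_unique h1 h.
have [ha hp] := slot_prob alpha beta q n hs; split=> //.
have [u r1 fu] := in_class_run h.
rewrite (weight_heq _ _ _ _ e) hp -(weight_heq _ _ _ _ hd) /weight !count_insert.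
rewrite !(slot_nb_label _ hs hi r1 fu).
case: l hs {hi hd hp ha h r1} (slot_letter hs) => // hs _; case: m hs => [|m] hs /=;
  rewrite ?add0n ?add1n ?exprS; ring.
Qed.

Lemma link_flow (R : realFieldType) (alpha beta q : R) n r i j (psi phi : Psi n r) W H W' H' :
  link (psi, i) (phi, j) -> in_class psi W H -> in_class phi W' H' ->
  [/\ active W i, active W' j &
   weight alpha beta q W H * prob n alpha beta q W i =
   weight alpha beta q W' H' * prob n alpha beta q W' j].
Proof.
move=> /linkE /= [[<- hq]|[<- hq]|[l [m [W0 [K [h1 h2]]]]]] h h'.
- exact: qlink_flow hq h h'.
- by have [a1 a2 ->] := qlink_flow alpha beta q hq h' h.
have [a1 ->] := inserted_flow alpha beta q h1 h; have [a2 ->] := inserted_flow alpha beta q h2 h'.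
by [].
Qed.

Lemma link_bound n r i j (psi phi : Psi n r) : link (psi, i) (phi, j) -> (i <= n)%N -> (j <= n)%N.
Proof.
move=> /linkE /= [[<- _]|[<- _]|[l [m [W0 [K [_ h]]]]]] // _.
case: h => U [V [H [_ _ /in_classP[<- _ _] _ ->]]].
by rewrite /position size_cat /=; case: eqP => _; lia.
Qed.

(** * The stationary distribution *)

(** If an invariant function is positive somewhere then so it is at all states
    reached from there, and in particular at [x0]. *)
Lemma invariant_pos (R : realFieldType) (S : finType) (P : S -> S -> R) (x0 : S) (M : S -> nat)
    (g : S -> R) :
  is_transition_matrix P ->
  (forall x, x != x0 -> exists2 y, 0 < P x y & (M y < M x)%N) ->
  (forall x, 0 <= g x) -> (forall y, \sum_x g x * P x y = g y) ->
  g x0 = 0 -> forall x, g x = 0.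
Proof.
move=> [P0 _] dec g0 gP g00 x; move: {2}(M x) (leqnn (M x)) => N.
elim: N x => [|N IH] x hN; have [->|/dec[y Py hM]] // := eqVneq x x0.
  by have := leq_trans hM hN.
have gy : g y = 0 by apply: IH; rewrite -ltnS; apply: leq_trans hM hN.
have := gP y; rewrite gy => /eqP; rewrite psumr_eq0 => [|z _]; last exact: mulr_ge0.
move=> /allP /(_ x); rewrite mem_index_enum => /(_ isT) /=.
by rewrite mulf_eq0 (gt_eqF Py) orbF => /eqP.
Qed.

(** The difference of two invariant distributions splits into two nonnegative
    invariant functions with disjoint supports; both would be positive at a state
    reached from everywhere. *)
Lemma steady_state_unique (R : realFieldType) (S : finType) (P : S -> S -> R) (x0 : S)
    (M : S -> nat) (pi pi' : {ffun S -> R}) :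
  is_transition_matrix P ->
  (forall x, x != x0 -> exists2 y, 0 < P x y & (M y < M x)%N) ->
  steady_state P pi -> steady_state P pi' -> pi' = pi.
Proof.
move=> hP dec; wlog le : pi pi' / pi x0 <= pi' x0.
  move=> hw s s'; have [le|/ltW le] := leP (pi x0) (pi' x0); first exact: (hw pi pi').
  by apply/esym/(hw pi' pi).
move=> [pi0 pi1 piP] [pi0' pi1' piP']; have [P0 P1] := hP.
pose d x := pi' x - pi x.
have dP y : \sum_x d x * P x y = d y.
  by under eq_bigr do rewrite mulrBl; rewrite big_split /= sumrN piP piP'.
have aP y : \sum_x `|d x| * P x y = `|d y|.
  have h z : `|d z| <= \sum_x `|d x| * P x z.
    rewrite -[X in `|X|]dP; apply: le_trans (ler_norm_sum _ _ _) _.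
    by apply: ler_sum => x _; rewrite normrM (ger0_norm (P0 _ _)).
  have e : \sum_z (\sum_x `|d x| * P x z - `|d z|) = 0.
    rewrite big_split /= sumrN exchange_big /=.
    by under eq_bigr do rewrite -mulr_sumr P1 mulr1; rewrite subrr.
  apply/eqP; rewrite -subr_eq0; apply/eqP; move: e => /eqP.
  rewrite psumr_eq0 => [|z _]; last by rewrite subr_ge0.
  by move=> /allP /(_ y); rewrite mem_index_enum => /(_ isT) /eqP.
pose g x := `|d x| - d x.
have g0 x : g x = 0.
  apply: (invariant_pos hP dec) => [z|y|]; first by rewrite subr_ge0 ler_norm.
    by under eq_bigr do rewrite mulrBl; rewrite big_split /= sumrN aP dP.
  by rewrite /g ger0_norm ?subrr // subr_ge0.
have d0 x : 0 <= d x by have /eqP := g0 x; rewrite subr_eq0 => /eqP <-.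
have : \sum_x d x == 0 by rewrite big_split /= sumrN pi1 pi1' subrr.
rewrite psumr_eq0 // => /allP h; apply/ffunP => x; apply/eqP; rewrite -subr_eq0.
by apply: h; apply: mem_index_enum.
Qed.

Lemma wt_repr (R : realFieldType) (alpha beta q : R) n r (psi : Psi n r) W H : in_class psi W H ->
  wt alpha beta q (Defs.repr psi) = weight alpha beta q W H.
Proof.
move=> h; have [H' hF] := hist_exists (Defs.repr psi).
have h' : in_class psi (word (Defs.repr psi)) H'.
  exists (Defs.repr psi); split=> //; apply: val_inj; apply/eqP.
  by have := xchooseP (existsP (valP psi)).
have [-> e] := in_class_unique h h'; by rewrite (wt_hist _ _ _ hF) (weight_heq _ _ _ _ e).
Qed.

Lemma wt_class (R : realFieldType) (alpha beta q : R) n r (F : RAT n r) :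
  wt alpha beta q (Defs.repr (class F)) = wt alpha beta q F.
Proof.
have [H hF] := hist_exists F.
by rewrite (wt_repr _ _ _ (in_class_of_hist hF)) (wt_hist _ _ _ hF).
Qed.

Definition active_pair n r (x : Psi n r * 'I_n.+1) : bool := active (type_of x.1) x.2.

(** [link] is functional and injective, and its domain and its range are the
    pairs with a rule. *)
Lemma transition_perm n r : exists dst : Psi n r * 'I_n.+1 -> Psi n r * 'I_n.+1,
  [/\ injective dst, forall x, active_pair (dst x) = active_pair x,
      forall x phi, active_pair x -> class_move x.2 x.1 phi = (phi == (dst x).1)
    & forall (R : realFieldType) (alpha beta q : R) x, active_pair x ->
        wt alpha beta q (Defs.repr (dst x).1) * prob n alpha beta q (type_of (dst x).1) (dst x).2 =
        wt alpha beta q (Defs.repr x.1) * prob n alpha beta q (type_of x.1) x.2].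
Proof.
pose lk (x y : Psi n r * 'I_n.+1) := link (x.1, x.2 : nat) (y.1, y.2 : nat).
have [dst hd] : exists dst, forall x, if active_pair x then lk x (dst x) else dst x = x.
  apply: (@fin_all_exists _ (fun _ => (Psi n r * 'I_n.+1)%type)
    (fun x y => if active_pair x then lk x y else y = x)) => x; case ax: (active_pair x); last by exists x.
  have [phi hm] := class_move_exists ax; have [j hl] := class_move_link ax hm.
  have hj : (j < n.+1)%N by rewrite ltnS; apply: link_bound hl _; rewrite -ltnS.
  by exists (phi, Ordinal hj).
have eqp (x y : Psi n r * 'I_n.+1) : (x.1, x.2 : nat) = (y.1, y.2 : nat) -> x = y.
  by case: x y => [x i] [y j] /= [-> /val_inj ->].
have flow x : active_pair x -> active_pair (dst x) /\ forall (R : realFieldType) (alpha beta q : R),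
    wt alpha beta q (Defs.repr (dst x).1) * prob n alpha beta q (type_of (dst x).1) (dst x).2 =
    wt alpha beta q (Defs.repr x.1) * prob n alpha beta q (type_of x.1) x.2.
  move=> ax; have := hd x; rewrite ax => hl.
  have [W [H h]] := in_class_exists x.1; have [W' [H' h']] := in_class_exists (dst x).1.
  split=> [|R alpha beta q].
    by have [_ a _] := link_flow (0 : rat) 0 0 hl h h'; rewrite /active_pair (in_class_type h').
  have [_ _ e] := link_flow alpha beta q hl h h'.
  by rewrite (wt_repr _ _ _ h) (wt_repr _ _ _ h') (in_class_type h) (in_class_type h') e.
exists dst; split=> [x y e|x|x phi ax|R alpha beta q x ax].
- have := hd x; have := hd y; case: ifP => ay; case: ifP => ax.
  + by rewrite -e => h h'; apply: eqp; apply: link_inj h' h.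
  + by move=> _ e'; have [] := flow _ ay; rewrite -e e' ax.
  + by move=> e' _; have [] := flow _ ax; rewrite e e' ay.
  + by move=> <- <-.
- by case ax: (active_pair x); [have [] := flow _ ax | have := hd x; rewrite ax => ->].
- have h phi' : class_move x.2 x.1 phi' -> phi' = (dst x).1.
    move=> hm; have [j hl] := class_move_link ax hm.
    by have := hd x; rewrite ax => hl'; have [] := link_fun hl hl'.
  apply/idP/eqP => [/h //|->]; have [phi' hm] := class_move_exists ax.
  by rewrite -(h _ hm).
by have [_ ->] := flow _ ax.
Qed.

Lemma prob_ge0 (R : realFieldType) (alpha beta q : R) n W i :
  0 <= q -> 0 <= alpha -> 0 <= beta -> 0 <= prob n alpha beta q W i.
Proof.
move=> q0 a0 b0; rewrite /prob.
case: (ohead (rev _)) => [B|]; case: (ohead (drop _ _)) => [C|] //.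
- have h : 0 <= if kind_of B C then 1 / n.+1%:R else if kind_of C B then q / n.+1%:R else 0 :> R.
    by do 2?case: ifP => _ //; rewrite divr_ge0 ?ler0n.
  by case: B h; case: C.
- by case: B => //; rewrite divr_ge0 ?ler0n.
- by case: C => //; rewrite divr_ge0 ?ler0n.
Qed.

(** Crossing a corner lowers the first term and keeps the second one, and
    turning the last d into an e lowers the second term and keeps the first
    one. *)
Definition measure n r (psi : Psi n r) : nat :=
  (potential (map live (type_of psi)) + count_mem Ld (type_of psi))%N.

Lemma potential_rcons w x y : potential (rcons w x) = potential (rcons w y).
Proof. by elim: w => [|z w IH] /=; rewrite ?muln0 // !size_rcons IH. Qed.

Lemma class_move_word n r (psi phi : Psi n r) (i : 'I_n.+1) W : class_move i psi phi ->
  (forall F T : RAT n r, word F = type_of psi :> seq letter -> move i F T ->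
     word T = W :> seq letter) ->
  type_of phi = W :> seq letter.
Proof.
move=> /exists_inP[F /mem_Psi eF /exists_inP[T /mem_Psi eT hm]] h.
have [H hF] := hist_exists F; have [H' hT] := hist_exists T.
rewrite eT (in_class_type (in_class_of_hist hT)); apply: h hm.
by rewrite eF (in_class_type (in_class_of_hist hF)).
Qed.

(** Sorting the letters, and then turning the last d into an e, leads from each
    class to the one of the word without d and without corners. *)
Lemma measure_decreases (R : realFieldType) (alpha beta q : R) n r (psi psi0 : Psi n r) :
  0 <= q -> 0 < alpha -> 0 < beta ->
  in_class psi0 (nseq (n - r) Le ++ nseq r La) [::] -> psi != psi0 ->
  exists i phi, [/\ class_move i psi phi, 0 < prob n alpha beta q (type_of psi) i
                  & (measure phi < measure psi)%N].
Proof.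
move=> q0 a0 b0 h0 ne; have [W [H h]] := in_class_exists psi; have eW := in_class_type h.
have [sW cW [u r1 fu]] := in_classP h; have N0 : 0 < n.+1%:R :> R by rewrite ltr0n.
(* If the word is sorted then its last letter is a d, unless the class is [psi0]. *)
have [fw|[p cp]] := final_or_corner (map live W).
  have eS := final_sorted fw; rewrite map_letter_live /sorted_word in eS.
  have eH := run_final fw r1; subst H.
  have [d0|[k dk]] : count_mem Ld W = 0%N \/ exists k, count_mem Ld W = k.+1.
    by case: (count_mem Ld W) => [|k]; [left | right; exists k].
    case/eqP: ne; apply/(in_class_eq h h0); split; last exact: heq_refl.
    rewrite eS d0 cats0 cW; congr (nseq _ _ ++ _).
    by move: sW; rewrite {1}eS d0 cats0 size_cat !size_nseq cW => <-; rewrite addnK.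
  pose X := nseq (count_mem Le W) Le ++ nseq (count_mem La W) La ++ nseq k Ld.
  have eX : W = rcons X Ld.
    by rewrite {1}eS dk /X -!cats1 -!catA; do 2!congr (_ ++ _); rewrite cats1; elim: (k) => //= j <-.
  have sX : (size X).+1 = n by rewrite -sW eX size_rcons.
  have ha : active (type_of psi) (@ord_max n).
    have := active_cat (rcons X Ld) [::]; rewrite cats0 rev_rcons /= size_rcons sX.
    by rewrite eW eX => ->.
  have [phi hm] := class_move_exists ha; exists ord_max, phi; split=> //.
    have := prob_cat alpha beta q n (rcons X Ld) [::]; rewrite cats0 rev_rcons /= size_rcons sX.
    by rewrite eW eX => ->; rewrite divr_gt0.
  have eP : type_of phi = rcons X Le :> seq letter.
    apply: (class_move_word hm) => F T eF; rewrite eW eX in eF.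
    by rewrite (move_last _ eF) ?sX // => /andP[/eqP <-].
  rewrite /measure eW eP eX !map_rcons (potential_rcons _ _ LiveD) ltn_add2l.
  by rewrite -!cats1 !count_cat /= ltn_add2l.
have [w1 [x1 [y1 [w2 [ew sp lt]]]]] := corner_split cp.
have [X [B [C [Y [eX sX lBC]]]]] : exists X B C Y,
    [/\ W = X ++ B :: C :: Y, size X = p & (lrank C < lrank B)%N].
  exists (map letter_of w1), (letter_of x1), (letter_of y1), (map letter_of w2).
  by rewrite size_map sp; split=> //; rewrite -[W]map_letter_live ew map_cat.
have [K hK] : exists K, kind_of B C = Some K by case: (B) lBC; case: (C) => // _; eexists.
have hi : ((size X).+1 < n.+1)%N by rewrite -sW eX size_cat /= ltnS !addnS ltnS; apply: leqW; apply: leq_addr.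
pose i := Ordinal hi.
have ha : active (type_of psi) i by rewrite eW eX active_mid hK.
have [phi hm] := class_move_exists ha; exists i, phi; split=> //.
  by rewrite eW eX prob_mid hK divr_gt0.
have eP : type_of phi = X ++ C :: B :: Y :> seq letter.
  apply: (class_move_word hm) => F T eF; rewrite eW eX in eF.
  by rewrite (move_corner _ eF _ hK) // => /andP[/eqP <-].
have hK' : kind_of B C by rewrite hK.
have /potential_sweep hp := kind_of_sweep X Y hK'.
rewrite /measure eW eP eX.
have -> : count_mem Ld (X ++ C :: B :: Y) = count_mem Ld (X ++ B :: C :: Y).
  by rewrite !count_cat /=; congr (_ + _)%N; rewrite addnCA.
by rewrite ltn_add2r.
Qed.

Theorem theorem7p10 (R : realFieldType) (n r : nat) (alpha beta q : R)
    (hr : (r <= n)%N) (hq0 : 0 <= q) (hq1 : q <= 1)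
    (halpha : 0 < alpha) (hbeta : 0 < beta)
    (hout : forall psi : Psi n r, out_prob alpha beta q psi <= 1) :
  is_transition_matrix (@RAT_chain n r R alpha beta q) /\
  exists pi : {ffun Psi n r -> R},
    [/\ steady_state (@RAT_chain n r R alpha beta q) pi,
        forall pi' : {ffun Psi n r -> R},
          steady_state (@RAT_chain n r R alpha beta q) pi' -> pi' = pi
      & exists2 c : R, 0 < c &
          forall F : RAT n r, pi (class F) = c * wt alpha beta q F].
Proof.
have [dst [dst_inj dst_act dst_move dst_flow]] := transition_perm n r.
pose pr (psi : Psi n r) (i : 'I_n.+1) : R := prob n alpha beta q (type_of psi) i.
have pr0 psi i : 0 <= pr psi i by apply: prob_ge0 => //; apply: ltW.
have pr_inactive psi i : ~~ active_pair (psi, i) -> pr psi i = 0 by apply: prob_inactive.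
pose P := @RAT_chain n r R alpha beta q.
have PE psi phi : P psi phi =
    \sum_(i | active_pair (psi, i) && ((dst (psi, i)).1 == phi)) pr psi i +
    (if psi == phi then 1 - out_prob alpha beta q psi else 0).
  rewrite /P /RAT_chain; congr (_ + _); rewrite big_mkcond [RHS]big_mkcond /=.
  apply: eq_bigr => i _; case ax: (active_pair (psi, i)) => /=.
    by rewrite (dst_move (psi, i)) // eq_sym.
  by rewrite -/(pr psi i) pr_inactive ?ax //; case: ifP.
have hP : is_transition_matrix P.
  split=> [psi phi|psi].
    by rewrite PE addr_ge0 ?sumr_ge0 //; case: ifP => // _; rewrite subr_ge0.
  under eq_bigr do rewrite PE; rewrite big_split /= -[X in _ + X]big_mkcond /=.
  rewrite [X in _ + X](big_pred1 psi) => [|phi]; last by rewrite /= eq_sym.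
  suff -> : \sum_phi \sum_(i | active_pair (psi, i) && ((dst (psi, i)).1 == phi)) pr psi i =
      out_prob alpha beta q psi by rewrite addrC subrK.
  under eq_bigr do rewrite big_mkcond; rewrite exchange_big /=.
  apply: eq_bigr => i _; case ax: (active_pair (psi, i)) => /=; last first.
    by rewrite big1 // -/(pr psi i) pr_inactive ?ax.
  by rewrite -big_mkcond (big_pred1 (dst (psi, i)).1) // => phi; rewrite /= eq_sym.
pose w (psi : Psi n r) : R := wt alpha beta q (Defs.repr psi).
have w0 psi : 0 <= w psi.
  by rewrite /w /wt !mulr_ge0 ?exprn_ge0 // ltW.
have wP phi : \sum_psi w psi * P psi phi = w phi.
  under eq_bigr do rewrite PE mulrDr; rewrite big_split /=.
  have -> : \sum_psi w psi * (if psi == phi then 1 - out_prob alpha beta q psi else 0) =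
      w phi - w phi * out_prob alpha beta q phi.
    rewrite (bigD1 phi) //= eqxx mulrBr mulr1 big1 ?addr0 // => psi /negbTE ->.
    by rewrite mulr0.
  (* The flow into [phi] is reindexed by the permutation. *)
  suff -> : \sum_psi w psi * (\sum_(i | active_pair (psi, i) && ((dst (psi, i)).1 == phi)) pr psi i) =
      w phi * out_prob alpha beta q phi by rewrite addrC subrK.
  under eq_bigr do rewrite mulr_sumr.
  rewrite (pair_big_dep xpredT (fun psi i => active_pair (psi, i) && ((dst (psi, i)).1 == phi))
    (fun psi i => w psi * pr psi i)) /=.
  transitivity (\sum_(x | active_pair (dst x) && ((dst x).1 == phi)) w (dst x).1 * pr (dst x).1 (dst x).2).
    apply: eq_big => [[psi i]|[psi i] /= /andP[ax _]]; first by rewrite dst_act.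
    by rewrite /w /pr dst_flow.
  rewrite -(reindex_inj dst_inj (P := fun x => active_pair x && (x.1 == phi)) (F := fun x => w x.1 * pr x.1 x.2)).
  transitivity (\sum_(x : Psi n r * 'I_n.+1 | x.1 == phi) w x.1 * pr x.1 x.2).
    rewrite big_mkcond [RHS]big_mkcond; apply: eq_bigr => -[psi i] _ /=.
    by case ax: (active_pair _) => //=; rewrite pr_inactive ?ax // mulr0; case: ifP.
  transitivity (\sum_(psi | psi == phi) \sum_i w psi * pr psi i).
    by rewrite pair_big; apply: eq_bigl => x; rewrite andbT.
  by rewrite big_pred1_eq -mulr_sumr.
have sW0 : size (nseq (n - r) Le ++ nseq r La) = n by rewrite size_cat !size_nseq subnK.
have cW0 : count_mem La (nseq (n - r) Le ++ nseq r La) = r.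
  by rewrite count_cat !count_nseq /= mul0n mul1n.
have fW0 : final (map live (nseq (n - r) Le ++ nseq r La)).
  apply: sorted_final; rewrite map_letter_live /sorted_word !count_cat !count_nseq /=.
  by rewrite !mul1n !mul0n !addn0 cats0.
have [psi0 h0] := in_class_build (H := [::]) sW0 cW0 erefl fW0.
have w_gt0 : 0 < w psi0.
  by rewrite /w (wt_repr _ _ _ h0) /weight /nb_label /= !expr0 !mul1r mulr_gt0 ?exprn_gt0.
have s_gt0 : 0 < \sum_psi w psi.
  by rewrite (bigD1 psi0) //= ltr_wpDr // sumr_ge0.
pose pi := [ffun psi => (\sum_phi w phi)^-1 * w psi].
have hpi : steady_state P pi.
  split=> [psi||phi].
  - by rewrite ffunE mulr_ge0 // invr_ge0 ltW.
  - under eq_bigr do rewrite ffunE; rewrite -mulr_sumr mulVf //; exact: lt0r_neq0.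
  - by under eq_bigr do rewrite ffunE -mulrA; rewrite -mulr_sumr wP ffunE.
split=> //; exists pi; split=> // [pi' hpi'|].
  apply: (steady_state_unique (x0 := psi0) (M := @measure n r) hP _ hpi hpi') => psi ne.
  have [i [phi [hm hp hd]]] := measure_decreases hq0 halpha hbeta h0 ne.
  exists phi => //; rewrite /P /RAT_chain (bigD1 i) //= -addrA ltr_wpDr //.
  rewrite addr_ge0 //; first by apply: sumr_ge0 => j _; apply: pr0.
  by case: ifP => // _; rewrite subr_ge0.
by exists (\sum_phi w phi)^-1; [rewrite invr_gt0 | move=> F; rewrite ffunE /w wt_class].
Qed.
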